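(* Assume that for every $\ell\in\{1,\dots,L\}$, $0<D(f_{1,\ell}\,\|\,f_{0,\ell})<\infty$ and $0<D(f_{0,\ell}\,\|\,f_{1,\ell})<\infty$, and that the log likelihood ratios $\log\frac{f_{1,\ell}(X)}{f_{0,\ell}(X)}$ have finite and positive absolute moments up to third order, both when $X\sim f_{0,\ell}$ and when $X\sim f_{1,\ell}$. Let $\mu_\ell>0$, $0\le h_\ell<\infty$ and $D_\ell\ge 0$ for all $\ell$ be fixed, let $\alpha\in(0,1]$, and let $\Pi_{\mathrm{DCS}}$ be the DE-Censor-Sum algorithm with these parameters and with fusion center threshold $A=L\log\frac{L}{\alpha}$. Suppose the change affects the nonempty subset $\kappa=\{k_1,\dots,k_m\}\subset\{1,\dots,L\}$ of streams. Then $$\mathsf{FAR}(\Pi_{\mathrm{DCS}})\le\alpha,$$ $$\mathsf{PDC}_\ell(\Pi_{\mathrm{DCS}})=\frac{\mathbb{E}_\infty[\tau_{\ell-}]}{\mathbb{E}_\infty[\tau_{\ell-}]+\mathbb{E}_\infty\big[\lceil |W_{\tau_{\ell-}}^{h_\ell+}|/\mu_\ell\rceil\big]}\quad\forall\ell,$$ $$\mathsf{PTC}_\ell(\Pi_{\mathrm{DCS}})=\frac{\mathbb{E}_\infty[U_{D_\ell}]}{\mathbb{E}_\infty[\tau_{\ell-}]+\mathbb{E}_\infty\big[\lceil |W_{\tau_{\ell-}}^{h_\ell+}|/\mu_\ell\rceil\big]}\quad\forall\ell,$$ $$\mathsf{WADD}(\Pi_{\mathrm{DCS}})\le\frac{A}{\sum_{i=1}^m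 D(f_{1,k_i}\,\|\,f_{0,k_i})}(1+o(1))\quad\text{as }A\to\infty.$$ Moreover, if instead $h_\ell=\infty$ for all $\ell$ (other parameters as before), then $$\mathsf{PDC}_\ell(\Pi_{\mathrm{DCS}})\le\frac{\mu_\ell}{\mu_\ell+D(f_{0,\ell}\,\|\,f_{1,\ell})}\quad\forall\ell.$$
   Context: **Model.** There are $L\ge1$ sensors. At sensor $\ell$ a sequence of random variables $\{X_{n,\ell}\}_{n\ge1}$ is observed. For known densities $f_{0,\ell},f_{1,\ell}$, a deterministic change point $\gamma\in\{1,2,\dots\}\cup\{\infty\}$ and a nonempty affected subset $\kappa\subset\{1,\dots,L\}$: all $X_{n,\ell}$ are independent over $n$ and $\ell$; for $\ell\in\kappa$, $X_{n,\ell}\sim f_{0,\ell}$ if $n<\gamma$ and $X_{n,\ell}\sim f_{1,\ell}$ if $n\ge\gamma$; for $\ell\notin\kappa$, $X_{n,\ell}\sim f_{0,\ell}$ for all $n$. $\mathbb{P}_\gamma,\mathbb{E}_\gamma$ denote the corresponding probability and expectation ($\gamma=\infty$: no change). $D(f\,\|\,g)$ is the Kullback–Leibler divergence. **Algorithm.** Write $(x)^{h+}=\max\{x,-h\}$ (so $(x)^{\infty+}=x$). For parameters $\mu_\ell>0$, $h_\ell\in[0,\infty]$, the DE-CuSum statistics start at $W_{0,\ell}=0$ and evolve, for all $n\ge0$, by: $S_{n+1,\ell}=1$ if $W_{n,\ell}\ge0$ and $S_{n+1,\ell}=0$ otherwise ($S_{n,\ell}$ indicates whether $X_{n,\ell}$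 is used), and $$W_{n+1,\ell}=\begin{cases}\min\{W_{n,\ell}+\mu_\ell,0\}&\text{if }S_{n+1,\ell}=0,\\ \Big(W_{n,\ell}+\log\frac{f_{1,\ell}(X_{n+1,\ell})}{f_{0,\ell}(X_{n+1,\ell})}\Big)^{h_\ell+}&\text{if }S_{n+1,\ell}=1.\end{cases}$$ At time $n$ sensor $\ell$ transmits iff $W_{n,\ell}>D_\ell$; let $T_{n,\ell}=\mathbb{I}_{\{W_{n,\ell}>D_\ell\}}$ and $Y_{n,\ell}=W_{n,\ell}\mathbb{I}_{\{W_{n,\ell}>D_\ell\}}$ (no transmission counts as $0$ at the fusion center). DE-Censor-Sum, $\Pi_{\mathrm{DCS}}$, stops at $\tau=\inf\{n\ge1:\sum_{\ell=1}^L Y_{n,\ell}>A\}$. **Metrics.** The recursions for $W_{n,\ell},S_{n,\ell},T_{n,\ell}$ are run for all $n$, also beyond $\tau$. $$\mathsf{PDC}_\ell=\limsup_{\gamma\to\infty}\frac1\gamma\mathbb{E}_\infty\Big[\sum_{k=1}^{\gamma-1}S_{k,\ell}\Big],\qquad \mathsf{PTC}_\ell=\limsup_{\gamma\to\infty}\frac1\gamma\mathbb{E}_\infty\Big[\sum_{k=1}^{\gamma-1}T_{k,\ell}\Big],\qquad \mathsf{FAR}=\frac{1}{\mathbb{E}_\infty[\tau]},$$ $$\mathsf{WADD}=\sup_{\gamma\ge1}\operatorname{ess\,sup}\;\mathbb{E}_\gamma\big[(\tau-\gamma)^+\mid\boldsymbol{\mathcal I}_{\gamma-1}\big],$$ where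 $\boldsymbol{\mathcal I}_n$ is the information at time $n$: all $S_{k,\ell}$, $k\le n$, $1\le\ell\le L$, and those $X_{k,\ell}$, $k\le n$, with $S_{k,\ell}=1$. The change points $\gamma$ in the supremum are finite and the affected subset $\kappa$ is fixed. **Ladder quantities.** Let $Z_{n,\ell}=\sum_{k=1}^n\log\frac{f_{1,\ell}(X_{k,\ell})}{f_{0,\ell}(X_{k,\ell})}$. Then $\tau_{\ell-}=\inf\{n\ge1:Z_{n,\ell}<0\}$; $W_{\tau_{\ell-}}$ is the ladder height $Z_{\tau_{\ell-},\ell}$ and $W_{\tau_{\ell-}}^{h_\ell+}=\max\{Z_{\tau_{\ell-},\ell},-h_\ell\}$; $U_{D_\ell}$ is the number of $n$ with $1\le n<\tau_{\ell-}$ and $Z_{n,\ell}>D_\ell$. **Asymptotic notation.** $p(A)\le q(A)(1+o(1))$ as $A\to\infty$ means $\limsup_{A\to\infty}p(A)/q(A)\le1$, with the model and the parameters $\mu_\ell,h_\ell,D_\ell$ fixed ($A\to\infty$ corresponds to $\alpha\to0$). *)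

(* Defs.v *)
From HB Require Import structures.
From mathcomp Require Import all_boot all_order all_algebra.
From mathcomp Require Import all_classical all_reals all_analysis.
From mathcomp Require Import measurable_realfun ess_sup_inf.

Set Implicit Arguments.
Unset Strict Implicit.
Unset Printing Implicit Defensive.

Import Order.TTheory GRing.Theory Num.Theory.
Import numFieldNormedType.Exports.

Local Open Scope classical_set_scope.
Local Open Scope ring_scope.
Local Open Scope ereal_scope.

Section Densities.
Context {R : realType}.
Variable nu : {measure set (measurableTypeR R) -> \bar R}.

Definition is_density (f : R -> R) : Prop :=
  [/\ measurable_fun setT f, (forall x, (0 <= f x)%R) &
      \int[nu]_x (f x)%:E = 1].

(* 0 log (0 / q) = 0 and p log (p / 0) = +oo for p > 0. The negative part of
   the integrand is at most g (as p log (p / q) >= p - q), so the integral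
   never has the form oo - oo. *)
Definition KL (f g : R -> R) : \bar R :=
  \int[nu]_x (if f x == 0%R then 0
              else if g x == 0%R then +oo
              else (f x * ln (f x / g x))%:E).

(* [ln] and [^-1] are total, so [llr] takes the value 0 where a density
   vanishes; if both divergences are finite, that is a null set under either
   density. *)
Definition llr (f g : R -> R) (x : R) : R := ln (f x / g x).

Definition llr_moment (k : nat) (f g p : R -> R) : \bar R :=
  \int[nu]_x (`|llr f g x| ^+ k * p x)%:E.

End Densities.

Section Model.
Context {R : realType} {d : measure_display} {Omega : measurableType d}.

Definition has_density (P : probability Omega R) (X : {mfun Omega >-> R})
    (nu : {measure set (measurableTypeR R) -> \bar R}) (f : R -> R) : Prop :=
  forall B : set R, measurable B -> P (X @^-1` B) = \int[nu]_(x in B) (f x)%:E.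

Definition mutually_independent (P : probability Omega R) (I : choiceType)
    (J : set I) (X : I -> {mfun Omega >-> R}) : Prop :=
  forall (s : seq I) (B : I -> set R), uniq s ->
    (forall i, i \in s -> J i) -> (forall i, measurable (B i)) ->
    P (\bigcap_(i in [set` s]) (X i @^-1` B i)) =
    \prod_(i <- s) P (X i @^-1` B i).

(* Change points are elements of [option nat]: [Some g], with [g >= 1], is the
   change point g, and [None] is the change point oo. Observations are indexed
   by [n >= 1]; [P (Some 0)] and [X 0] are junk. *)
Definition is_change_point (g : option nat) : Prop := g != Some 0%N.

Definition changed (g : option nat) (n : nat) : bool :=
  if g is Some g0 then (g0 <= n)%N else false.

Definition change_point_model (L : nat)
    (nu : 'I_L -> {sigma_finite_measure set (measurableTypeR R) -> \bar R})
    (f0 f1 : 'I_L -> R -> R) (kappa : {set 'I_L})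
    (P : option nat -> probability Omega R)
    (X : nat -> 'I_L -> {mfun Omega >-> R}) : Prop :=
  [/\ forall l, is_density (nu l) (f0 l) /\ is_density (nu l) (f1 l),
      forall g, is_change_point g -> forall n l, (1 <= n)%N ->
        has_density (P g) (X n l) (nu l)
          (if (l \in kappa) && changed g n then f1 l else f0 l)
    & forall g, is_change_point g ->
        mutually_independent (P g) [set i : nat * 'I_L | (1 <= i.1)%N]
          (fun i => X i.1 i.2)].

End Model.

Section Algorithm.
Context {R : realType}.
Implicit Types (mu D : R) (h : \bar R) (z : nat -> R) (n : nat).

Definition trunc h (x : R) : R := fine (maxe x%:E (- h)).

(* [z n] is the log likelihood ratio of the n-th observation of one sensor. *)
Fixpoint deW mu h z n : R :=
  if n is m.+1 then
    let w := deW mu h z m in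
    if (0 <= w)%R then trunc h (w + z m.+1) else Num.min (w + mu)%R 0%R
  else 0%R.

(* Meaningful for [n >= 1] only. *)
Definition deS mu h z n : bool := (0 <= deW mu h z n.-1)%R.

Definition deT mu h D z n : bool := (D < deW mu h z n)%R.

Definition deY mu h D z n : R :=
  if deT mu h D z n then deW mu h z n else 0%R.

Definition first_time (p : pred nat) : \bar R :=
  ereal_inf [set n%:R%:E | n in [set n | (1 <= n)%N && p n]].

Definition dcs_time (L : nat) (mu : 'I_L -> R) (h : 'I_L -> \bar R)
    (D : 'I_L -> R) (A : R) (z : 'I_L -> nat -> R) : \bar R :=
  first_time
    (fun n => A < \sum_(l < L) deY (mu l) (h l) (D l) (z l) n)%R.

Definition walk z n : R := (\sum_(1 <= k < n.+1) z k)%R.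

Definition ladder_time z : \bar R := first_time (fun n => walk z n < 0)%R.

(* When [ladder_time z = +oo] this is [walk z 0 = 0]. *)
Definition ladder_height z : R := walk z (Num.truncn (fine (ladder_time z))).

Definition ladder_count D z : \bar R :=
  \sum_(1 <= n <oo)
    ((n%:R%:E < ladder_time z)%E && (D < walk z n)%R)%:R%:E.

Definition off_time mu h z : R :=
  (Num.ceil (`|trunc h (ladder_height z)| / mu))%:~R%R.

End Algorithm.

Section Metrics.
Context {R : realType} {d : measure_display} {Omega : measurableType d}.

(* [V] is a nonnegative, possibly infinite, random variable and [G] a
   sub-sigma-algebra of the measurable sets. *)
Definition is_cond_expectation (P : probability Omega R) (G : set_system Omega)
    (V E : Omega -> \bar R) : Prop :=
  [/\ forall w, 0 <= E w,
      forall B : set (\bar R), measurable B -> G (E @^-1` B)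
    & forall C, G C -> \int[P]_(w in C) E w = \int[P]_(w in C) V w].

(* A version always exists, by Radon-Nikodym; the default value +oo is never
   taken. *)
Definition cond_expectation (P : probability Omega R) (G : set_system Omega)
    (V : Omega -> \bar R) : Omega -> \bar R :=
  xget (fun=> +oo) [set E | is_cond_expectation P G V E].

(* Sigma-algebra generated by the [S k l] and by the [X k l] on the event
   [S k l]; [B = setT] gives the events [S k l] themselves. *)
Definition information (L : nat) (X : nat -> 'I_L -> {mfun Omega >-> R})
    (S : nat -> 'I_L -> Omega -> bool) (n : nat) : set_system Omega :=
  <<s [set C | exists (k : nat) (l : 'I_L) (B : set R),
         [/\ (1 <= k <= n)%N, measurable B
           & C = [set w | S k l w /\ B (X k l w)]]] >>.

Definition PDC (Pinf : probability Omega R) (S : nat -> Omega -> bool) :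
    \bar R :=
  limn_esup (fun g : nat =>
    (g%:R^-1)%:E * 'E_Pinf[fun w => (\sum_(1 <= k < g) (S k w)%:R)%R]).

Definition PTC (Pinf : probability Omega R) (T : nat -> Omega -> bool) :
    \bar R :=
  limn_esup (fun g : nat =>
    (g%:R^-1)%:E * 'E_Pinf[fun w => (\sum_(1 <= k < g) (T k w)%:R)%R]).

(* [(+oo)^-1 = 0] *)
Definition FAR (Pinf : probability Omega R) (tau : Omega -> \bar R) : \bar R :=
  (\int[Pinf]_w tau w)^-1.

Definition WADD (P : option nat -> probability Omega R)
    (I : nat -> set_system Omega) (tau : Omega -> \bar R) : \bar R :=
  ereal_sup [set ess_sup (P (Some g))
                   (cond_expectation (P (Some g)) (I g.-1)
                      (fun w => maxe (tau w - g%:R%:E) 0))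
            | g in [set g | (1 <= g)%N]].

Definition llr_path (L : nat) (f0 f1 : 'I_L -> R -> R)
    (X : nat -> 'I_L -> {mfun Omega >-> R}) (w : Omega) (l : 'I_L) (n : nat) :
    R :=
  llr (f1 l) (f0 l) (X n l w).

End Metrics.

(* Main.v *)
Require Import Defs.
From HB Require Import structures.
From mathcomp Require Import all_boot all_order all_algebra.
From mathcomp Require Import all_classical all_reals all_analysis.
From mathcomp Require Import measurable_realfun ess_sup_inf.
From mathcomp Require Import zify ring lra.

Set Implicit Arguments.
Unset Strict Implicit.
Unset Printing Implicit Defensive.

Import Order.TTheory GRing.Theory Num.Theory.
Import numFieldNormedType.Exports.

Local Open Scope classical_set_scope.
Local Open Scope ring_scope.
Local Open Scope ereal_scope.

(**
Let W be a DE-CuSum statistic driven by independent increments z (the log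
likelihood ratios).

False alarms: where W > 0, exp W is dominated by the Shiryaev-Roberts statistic
R_{n+1} = (1 + R_n) exp z_{n+1}, whose mean grows by at most 1 per step; at an
alarm some R exceeds L / alpha, and optional stopping of the sum of the R's
gives E tau >= 1 / alpha.

Duty cycles: W restarts from 0 at renewal times. Decomposing an event at time n
according to the last renewal j <= n turns P(W_n >= 0) and P(W_n > D) into
convolutions of the renewal probabilities u_j with P(ladder time > i),
P(ladder time > i, Z_i > D); the same decomposition of the sure event
normalizes u. Cesaro means then give the ratios of means. The ladder time has
geometric tails since E exp (z / 2) < 1. For h = oo, the bound follows from
W_n <= sum (S z + mu (1 - S)) by taking expectations, because
W_n >= - c - sum z^2 / c for every c > 0.

Delay: after the change, the sum of the W's over kappa is a random walk with
drift, up to the times when a sensor is off; a Lyapunov function equal to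
a exp (- W / 2) on W >= 0 bounds the conditional expectation of their number.
Optional stopping, with the overshoot controlled by |z| <= c + z^2 / c, yields
E (tau - gamma)^+ <= (A + K_c) / (sum KL - s / c) conditionally on the past.
*)

(** Random times never enter as such. An alarm, a ladder time or a renewal is handled through
    indicators at deterministic times that are measurable with respect to the past of that time, so
    independence is only used between such a past and later observations. Expectations are integrals
    of nonnegative functions in the extended reals: increments are split into positive and negative
    parts, moved to opposite sides of pathwise inequalities before integrating. The exponent 1/2
    provides strictness. The mean of [exp z] before the change is only known to be at most 1,
    whereas that of [exp (z / 2)] is below 1 by Cauchy-Schwarz unless [z] vanishes almost
    everywhere, which the positive absolute moments exclude. The same fact for [- z] after the
    change makes the Lyapunov function contract. Conditional bounds are proved as integrals over an
    arbitrary event of the past. They are uniform in it because a finite [h] keeps every statistic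
    above [- h] at the change. The constant [c] in [|z| <= c + z^2 / c] depends on the tolerance
    only and stays fixed while [A] grows. *)

Section FirstTime.
Context {R : realType}.
Implicit Types (p : pred nat) (n i m : nat).

(** The event [first_time p > i]. It depends on times up to [i] only, hence is an event of the past
    at [i] whenever [p] is adapted. *)
Definition alive p i : bool := ~~ has p (iota 1 i).

Lemma aliveP p i : reflect (forall k, (1 <= k <= i)%N -> ~~ p k) (alive p i).
Proof.
apply: (iffP hasPn) => h k.
  by move=> /andP[k1 ki]; apply: h; rewrite mem_iota k1 add1n ltnS.
by rewrite mem_iota add1n ltnS; exact: h.
Qed.

Lemma alive0 p : alive p 0.
Proof. by []. Qed.

Lemma aliveS p i : alive p i.+1 = alive p i && ~~ p i.+1.
Proof. by rewrite /alive -(addn1 i) (iotaD 1 i 1) has_cat negb_or /= orbF add1n addn1. Qed.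

Lemma alive_le p i m : (i <= m)%N -> alive p m -> alive p i.
Proof.
move=> im /aliveP h; apply/aliveP => k /andP[k1 ki].
by apply: h; rewrite k1 (leq_trans ki).
Qed.

Lemma nneseries_ltn m :
  \sum_(0 <= i <oo) (i < m)%N%:R%:E = m%:R%:E :> \bar R.
Proof.
rewrite (nneseries_split 0 m); last by move=> k _; rewrite lee_fin ler0n.
rewrite add0n (@eseries0 _ _ m); last by move=> i mi _; rewrite ltnNge mi.
rewrite adde0 big_nat (eq_bigr (fun=> 1%:E)); last by move=> i /andP[_ ->].
by rewrite -big_nat sumEFin sumr_const_nat subn0.
Qed.

Lemma nneseries_true p : (forall i, p i) ->
  \sum_(0 <= i <oo) (p i)%:R%:E = +oo :> \bar R.
Proof.
move=> pi; apply/eqyP => A A0; apply: (@le_trans _ _ (Num.truncn A).+1%:R%:E).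
  by rewrite lee_fin ltW// truncnS_gt.
rewrite -nneseries_ltn; apply: lee_nneseries => i _; first by rewrite lee_fin.
by rewrite lee_fin ler_nat pi; case: ltnP.
Qed.

Lemma first_time_cases p :
  (exists m, [/\ (1 <= m)%N, p m, first_time p = m%:R%:E :> \bar R
      & forall i, alive p i = (i < m)%N])
  \/ (first_time p = +oo :> \bar R /\ forall i, alive p i).
Proof.
have [[m0 /andP[m01 pm0]]|np] := pselect (exists m, (1 <= m)%N && p m).
  left; have hex : exists m, (1 <= m)%N && p m by exists m0; rewrite m01 pm0.
  case: (ex_minnP hex) => m /andP[m1 pm] mmin; exists m; split => //.
    apply/eqP; rewrite eq_le; apply/andP; split.
      by apply: ereal_inf_lbound; exists m => //=; rewrite m1 pm.
    apply: le_ereal_inf_tmp => _ [k /= /mmin mk <-].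
    by rewrite lee_fin ler_nat.
  move=> i; apply/aliveP/idP => [h|im k /andP[k1 ki]].
    rewrite ltnNge; apply/negP => mi.
    by have := h m; rewrite m1 mi pm => /(_ isT).
  apply/negP => pk; have := mmin k; rewrite k1 pk => /(_ isT) mk.
  by move: (leq_trans im (leq_trans mk ki)); rewrite ltnn.
right; split.
  rewrite /first_time (_ : [set _ | _ in _] = set0) ?ereal_inf0//.
  by apply/seteqP; split => // _ [k /= pk _]; apply: np; exists k.
move=> i; apply/aliveP => k /andP[k1 _]; apply/negP => pk.
by apply: np; exists k; rewrite k1 pk.
Qed.

(** Pathwise tail-sum formula, valid also when [p] never occurs. Integrated termwise, it gives E tau
    as the sum over n >= 0 of P(tau > n), finite or not. *)
Lemma first_timeE p :
  first_time p = \sum_(0 <= i <oo) (alive p i)%:R%:E :> \bar R.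
Proof.
have [[m [m1 pm -> h]]|[-> h]] := first_time_cases p.
  by rewrite -nneseries_ltn; apply: eq_eseriesr => i _; rewrite h.
by rewrite nneseries_true.
Qed.

Lemma lt_first_time p n : (n%:R%:E < first_time p :> \bar R) = alive p n.
Proof.
have [[m [m1 pm -> h]]|[-> h]] := first_time_cases p.
  by rewrite lte_fin ltr_nat h.
by rewrite ltry h.
Qed.

End FirstTime.

(** * Truncation from below *)

Section Trunc.
Context {R : realType}.
Implicit Types (h : \bar R) (x r : R).
Local Open Scope ring_scope.

Lemma trunc_fin r x : trunc r%:E x = Num.max x (- r).
Proof. by rewrite /trunc -EFinN -EFin_max. Qed.

Lemma trunc_cases h x : (0 <= h)%E ->
  trunc h x = x \/ exists2 r, 0 <= r & trunc h x = Num.max x (- r).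
Proof.
case: h => [r r0|_|//]; last by left; rewrite /trunc max_l ?leNye.
by right; exists r; rewrite ?trunc_fin.
Qed.

Lemma trunc_ge h x : (0 <= h)%E -> x <= trunc h x.
Proof.
by move=> /(trunc_cases x)[->//|[r _ ->]]; rewrite le_max lexx.
Qed.

Lemma trunc_le h x : (0 <= h)%E -> trunc h x <= Num.max x 0.
Proof.
move=> /(trunc_cases x)[->|[r r0 ->]]; first by rewrite le_max lexx.
by rewrite ge_max !le_max lexx/= oppr_le0 r0 orbT.
Qed.

Lemma trunc_id h x : (0 <= h)%E -> 0 <= x -> trunc h x = x.
Proof.
move=> h0 x0; apply/le_anti; rewrite trunc_ge// andbT.
by rewrite (le_trans (trunc_le _ h0))// ge_max lexx.
Qed.

Lemma trunc_le0 h x : (0 <= h)%E -> x <= 0 -> trunc h x <= 0.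
Proof. by move=> h0 x0; rewrite (le_trans (trunc_le _ h0))// ge_max x0 lexx. Qed.

End Trunc.

(** * Pathwise analysis of one sensor: cycles, ladder time, bounds on [deW] *)

Section Path.
Context {R : realType}.
Variables (mu : R) (h : \bar R).
Hypotheses (mu_gt0 : (0 < mu)%R) (h_ge0 : 0 <= h).
Implicit Types (z : nat -> R) (n i j k m : nat) (D c : R).
Local Open Scope ring_scope.

Local Notation W z n := (deW mu h z n).

(** Only arguments [n >= 1] matter: [deW], [walk] and [cycle_end] never read the increment of index
    0, which here is [z j]. *)
Definition shift j z : nat -> R := fun n => z (j + n)%N.

Lemma deWS z n : W z n.+1 = if 0 <= W z n then trunc h (W z n + z n.+1)
                            else Num.min (W z n + mu) 0.
Proof. by []. Qed.

Lemma deW_shift z j i : W z j = 0 -> W (shift j z) i = W z (j + i).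
Proof.
by move=> Wj; elim: i => [|i IH]; rewrite ?addn0 // addnS !deWS IH /shift addnS.
Qed.

(** A cycle ends when the statistic is back at 0 after an excursion below 0. The second disjunct
    covers [h = 0], where the excursion is cut off at 0 within the same step and the off period has
    length 0. The condition [W z k = 0] alone would not do: the walk can return to 0 without having
    been negative. *)
Definition cycle_end z k : bool :=
  if k is m.+1 then
    (0 <= W z k) && ((W z m < 0) || (W z m + z k < 0))
  else false.

Arguments cycle_end : simpl never.

Lemma cycle_endS z m : cycle_end z m.+1 =
  (0 <= W z m.+1) && ((W z m < 0) || (W z m + z m.+1 < 0)).
Proof. by []. Qed.

Definition renewal z j : bool := (j == 0%N) || cycle_end z j.

Lemma renewal_deW z j : renewal z j -> W z j = 0.
Proof.
case: j => [//|j]; rewrite /renewal orFb cycle_endS => /andP[Wj1].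
case: (ltP (W z j) 0) => Wj Wz; apply/le_anti; rewrite Wj1 andbT deWS.
  by rewrite (leNgt 0 (W z j)) Wj ge_min lexx orbT.
by rewrite Wj trunc_le0// ltW.
Qed.

Lemma cycle_end_shift z j i : W z j = 0 ->
  cycle_end (shift j z) i.+1 = cycle_end z (j + i.+1).
Proof.
by move=> Wj; rewrite addnS !cycle_endS !deW_shift// addnS /shift addnS.
Qed.

Lemma alive_cycle_shiftS z j i : W z j = 0 ->
  alive (cycle_end (shift j z)) i.+1 =
  alive (cycle_end (shift j z)) i && ~~ cycle_end z (j + i.+1).
Proof. by move=> Wj; rewrite aliveS cycle_end_shift. Qed.

(* Exactly one [j <= n] is the last renewal up to time [n]. *)
Lemma sum_renewal z n :
  (\sum_(j < n.+1) (renewal z j && alive (cycle_end (shift j z)) (n - j)) = 1)%N.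
Proof.
elim: n => [|n IH]; first by rewrite big_ord1.
rewrite big_ord_recr /= subnn alive0 andbT.
rewrite (eq_bigr (fun j : 'I_n.+1 =>
  (renewal z j && alive (cycle_end (shift j z)) (n - j)) *
  ~~ cycle_end z n.+1)%N); last first.
  move=> j _; have jn : (j <= n)%N by rewrite -ltnS.
  rewrite subSn//; case rj: (renewal z j); last by rewrite !andFb mul0n.
  rewrite !andTb.
  rewrite alive_cycle_shiftS; last exact: renewal_deW.
  by rewrite addnS subnKC//; case: (alive _ _) => //; case: (cycle_end _ _).
by rewrite -big_distrl /= IH mul1n /renewal /=; case: (cycle_end _ _).
Qed.

Lemma walkS z n : walk z n.+1 = walk z n + z n.+1.
Proof. by rewrite /walk big_nat_recr. Qed.

Lemma walk0 z : walk z 0 = 0.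
Proof. by rewrite /walk big_geq. Qed.

Local Notation on z i := (alive (fun n => walk z n < 0) i).

Lemma deW_on z i : on z i -> W z i = walk z i.
Proof.
elim: i => [|i IH]; first by rewrite walk0.
rewrite aliveS -leNgt => /andP[zi wi]; rewrite deWS IH//.
have wi0 : 0 <= walk z i.
  by case: i {IH wi} zi => [|i]; rewrite ?walk0// aliveS -leNgt => /andP[].
by rewrite wi0 walkS trunc_id// -walkS.
Qed.

Lemma on_walk_ge0 z i : on z i -> 0 <= walk z i.
Proof. by case: i => [|i]; rewrite ?walk0// aliveS -leNgt => /andP[]. Qed.

(** Within a cycle the sensor is on exactly until [walk] first becomes negative: that step either
    sends the statistic below 0 or, when truncated to 0, ends the cycle. *)
Lemma cycle_on z i :
  alive (cycle_end z) i && (0 <= W z i) = on z i.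
Proof.
elim: i => [|i IH]; first by rewrite /= lexx.
apply/idP/idP.
  rewrite aliveS cycle_endS => /andP[/andP[ci + Wi1]].
  rewrite Wi1 andTb negb_or -!leNgt => /andP[Wi Wz].
  have zi : on z i by rewrite -IH ci Wi.
  by rewrite aliveS zi -leNgt walkS -deW_on.
move=> zi1; have := zi1; rewrite {1}aliveS => /andP[zi].
rewrite -leNgt => wi1; have := zi; rewrite -IH => /andP[ci Wi].
by rewrite aliveS ci cycle_endS (deW_on zi1) wi1 andbT !andTb negb_or -!leNgt Wi deW_on// -walkS.
Qed.

(** This is [sum_renewal] multiplied by the indicator on the left. By [cycle_on], being on at time
    [n] means that the walk restarted at the last renewal has not yet been negative. *)
Lemma sum_renewal_on z n : ((0 <= W z n)%R : nat) =
  (\sum_(j < n.+1) (renewal z j && on (shift j z) (n - j)))%N.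
Proof.
rewrite -[LHS]mul1n -(sum_renewal z n) big_distrl /=; apply: eq_bigr => j _.
have jn : (j <= n)%N by rewrite -ltnS.
case rj: (renewal z j); last by rewrite !andFb mul0n.
rewrite !andTb -cycle_on deW_shift; last exact: renewal_deW.
by rewrite subnKC//; case: (alive _ _) => //=; case: (0 <= _).
Qed.

(** As [D >= 0], a value above [D] forces the sensor to be on, and then the statistic is the walk
    restarted at the last renewal. *)
Lemma sum_renewal_above D z n : 0 <= D -> ((D < W z n)%R : nat) =
  (\sum_(j < n.+1) (renewal z j &&
     (on (shift j z) (n - j) && (D < walk (shift j z) (n - j))%R)))%N.
Proof.
move=> D0; rewrite -[LHS]mul1n -(sum_renewal z n) big_distrl /=.
apply: eq_bigr => j _.
have jn : (j <= n)%N by rewrite -ltnS.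
case rj: (renewal z j); last by rewrite !andFb mul0n.
rewrite !andTb; have Wj := renewal_deW rj.
case sj: (on (shift j z) (n - j)) => /=.
  rewrite -deW_on// deW_shift// subnKC//.
  by move: sj; rewrite -cycle_on => /andP[-> _]; case: (D < _).
case cj: (alive _ _) => //=; rewrite ?mul0n// mul1n.
move: sj; rewrite -cycle_on cj /= deW_shift// subnKC// => Wn.
by rewrite ltNge ltW// (lt_le_trans _ D0)// ltNge Wn.
Qed.

(** A cycle consists of [m] on-steps, up to the ladder time, and [N] off-steps, in which the
    statistic climbs by [mu] from the truncated ladder height [x] to 0; hence [N] is the ceiling of
    [|x| / mu]. *)
Lemma ladder_cycle z : let x := trunc h (ladder_height z) in
  (exists m N : nat, [/\ ladder_time z = m%:R%:E, walk z m < 0,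
     ladder_height z = walk z m, off_time mu h z = N%:R &
     forall i, alive (cycle_end z) i = (i < m + N)%N])
  \/ [/\ ladder_time z = +oo%E, off_time mu h z = 0 &
      forall i, alive (cycle_end z) i].
Proof.
move=> x.
have [[m [m1 wm tm hm]]|[tz hz]] :=
    @first_time_cases R (fun n => walk z n < 0); last first.
  right; split => //.
    (* For an infinite ladder time [fine] returns 0, so the height is [walk z 0 = 0] and the off
       time is 0. *)
    rewrite /off_time /ladder_height /ladder_time tz /= truncn0 walk0.
    by rewrite trunc_id// normr0 mul0r ceil0.
  by move=> i; have := hz i; rewrite -cycle_on => /andP[].
have Ez : ladder_height z = walk z m by rewrite /ladder_height /ladder_time tm /= natrK.
have x0 : x <= 0 by rewrite /x Ez trunc_le0// ltW.
have Wm : W z m = x.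
  rewrite /x Ez; case: m m1 wm tm hm Ez => // m _ wm tm hm Ez.
  have zm : on z m by rewrite hm.
  by rewrite deWS deW_on// on_walk_ge0// walkS.
(* While the cycle lasts the cap at 0 is inactive, so the climb is exactly linear. The value of [W]
   is claimed only before the end, since afterwards a new cycle runs. *)
have key p : alive (cycle_end z) (m + p) = (x + p%:R * mu < 0) /\
             (alive (cycle_end z) (m + p) -> W z (m + p) = x + p%:R * mu).
  elim: p => [|p [IHc IHW]].
    rewrite addn0 mul0r addr0 Wm; split => //.
    case: m m1 wm tm hm Ez Wm => // m _ wm tm hm Ez Wm.
    have zm : on z m by rewrite hm.
    have := zm; rewrite -cycle_on => /andP[cm _].
    rewrite aliveS cm cycle_endS Wm (deW_on zm) -walkS wm orbT andbT.
    by rewrite -ltNge.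
  have xp : x + p.+1%:R * mu = x + p%:R * mu + mu by rewrite -natr1; ring.
  rewrite addnS aliveS cycle_endS deWS IHc xp.
  case: (ltP (x + p%:R * mu) 0) => xp0 /=; last first.
    by split=> //; apply/esym/negbTE; rewrite -leNgt addr_ge0// ltW.
  have Wmp : W z (m + p) = x + p%:R * mu by apply: IHW; rewrite IHc.
  rewrite Wmp xp0 andbT (leNgt 0 (x + p%:R * mu)) xp0 /= le_min lexx andbT -ltNge; split => // xp1.
  by apply/min_idPl/ltW.
left; pose N := `|Num.ceil (`|x| / mu)|%N; exists m, N.
have cN : (N%:Z = Num.ceil (`|x| / mu))%R.
  by rewrite /N abszE ger0_norm// ceil_ge0// (@lt_le_trans _ _ 0)// ?divr_ge0// ltW.
split=> //; first by rewrite /off_time -/x -cN.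
move=> i; case: (ltnP i m) => im.
  have := hm i; rewrite im -cycle_on => /andP[-> _].
  by apply/esym; rewrite ltn_addr.
rewrite -(subnKC im) ltn_add2l (key (i - m)%N).1.
(* An integer [p] is below the ceiling of [|x| / mu] iff [p < |x| / mu], that is [x + p * mu < 0],
   as [x <= 0]. *)
rewrite -ltz_nat cN ceil_gt_int -pmulrn ltr_pdivlMr// ler0_norm//.
by apply/idP/idP => ?; lra.
Qed.

Lemma cycle_length z :
  (\sum_(0 <= i <oo) (alive (cycle_end z) i)%:R%:E =
   ladder_time z + (off_time mu h z)%:E)%E.
Proof.
have [[m [N [-> _ _ -> hc]]]|[-> _ hc]] := ladder_cycle z.
  by rewrite -EFinD -natrD -nneseries_ltn; apply: eq_eseriesr => i _; rewrite hc.
by rewrite nneseries_true.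
Qed.

Lemma off_time_ge0 z : 0 <= off_time mu h z.
Proof.
by have [[m [N [_ _ _ -> _]]]|[_ -> _]] := ladder_cycle z.
Qed.

Lemma off_time_le z r : h = r%:E -> off_time mu h z <= r / mu + 1.
Proof.
move=> hr; have r0 : 0 <= r by move: h_ge0; rewrite hr.
have [[m [N [_ wm Ez _ _]]]|[_ -> _]] := ladder_cycle z; last first.
  by rewrite addr_ge0// divr_ge0// ltW.
have xr : `|trunc h (ladder_height z)| / mu <= r / mu.
  rewrite ler_pM2r ?invr_gt0// Ez hr trunc_fin ler_norml.
  by rewrite le_max lexx orbT /= ge_max (le_trans (ltW wm))//=; lra.
rewrite -lerBlDr (le_trans _ xr)// /off_time.
by have := ceilB1_lt (`|trunc h (ladder_height z)| / mu); rewrite intrB => /ltW.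
Qed.

(* The Shiryaev-Roberts statistic, driven by the log likelihood ratios [z]. *)
Fixpoint sr z n : R := if n is m.+1 then (1 + sr z m) * expR (z m.+1) else 0.

Lemma sr_ge0 z n : 0 <= sr z n.
Proof.
by elim: n => //= n IH; rewrite mulr_ge0 ?expR_ge0// addr_ge0.
Qed.

(** A positive value comes from an untruncated step. If [W z n] was positive, induction applies; if
    it was 0, the summand 1 in [sr] pays for the restart from [expR 0]. *)
Lemma deW_sr z n : W z n <= 0 \/ expR (W z n) <= sr z n.
Proof.
elim: n => [|n IH]; first by left.
case: (leP (W z n.+1) 0) => [?|H]; [by left|right].
move: H; rewrite deWS; case: ifPn => [W0 H|_]; last by rewrite lt_min ltxx andbF.
have x0 : 0 < W z n + z n.+1.
  by rewrite ltNge; apply/negP => /(trunc_le0 h_ge0); rewrite leNgt H.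
rewrite trunc_id ?(ltW x0)// expRD ler_pM2r ?expR_gt0//.
case: IH => [Wn|]; last by move=> /le_trans; apply; rewrite lerDr.
by rewrite (_ : W z n = 0) ?expR0 ?lerDl ?sr_ge0//; apply/le_anti; rewrite W0 Wn.
Qed.

(** Truncation and the climb while off only raise the statistic, so it gains at least the log
    likelihood ratios that are used. *)
Lemma deW_step_ge z n : ((0 <= W z n)%R)%:R * z n.+1 <= W z n.+1 - W z n.
Proof.
rewrite deWS; case: (leP 0 (W z n)) => Wn /=.
  by rewrite mul1r lerBrDl trunc_ge.
by rewrite mul0r subr_ge0 le_min (ltW Wn) lerDl ltW.
Qed.

Lemma deW_step_le z n : W z n.+1 <= W z n + (`|z n.+1| + mu).
Proof.
rewrite deWS; case: (leP 0 (W z n)) => Wn /=.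
  rewrite (le_trans (trunc_le _ h_ge0))// ge_max.
  rewrite lerD2l (le_trans (ler_norm _)) ?lerDl ?(ltW mu_gt0)//=.
  by rewrite !addr_ge0// ltW.
by rewrite ge_min lerD2l lerDr normr_ge0.
Qed.

Lemma deW_ge z n r : h = r%:E -> - r <= W z n.
Proof.
move=> hr; have r0 : 0 <= r by move: h_ge0; rewrite hr.
elim: n => [|n IH]; first by rewrite oppr_le0.
rewrite deWS; case: ifPn => Wn.
  by rewrite hr trunc_fin le_max lexx orbT.
by rewrite le_min oppr_le0 r0 andbT ler_wpDr// ltW.
Qed.

(** Either [|x| <= c], or [|x| <= x^2 / c]. An unbounded quantity is traded for a constant plus a
    small multiple of a square, whose sum over time costs only [s / c] per step in the mean. *)
Lemma norm_le_sq c (x : R) : 0 < c -> `|x| <= c + x ^+ 2 / c.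
Proof.
move=> c0; case: (leP `|x| c) => xc.
  by rewrite (le_trans xc)// lerDl divr_ge0 ?sqr_ge0// ltW.
rewrite ler_wpDl ?(ltW c0)// ler_pdivlMr// -real_normK ?num_real// expr2.
by rewrite ler_wpM2l// ltW.
Qed.

(** For [h = +oo] nothing bounds the statistic from below. But it goes below 0 only in a step from a
    nonnegative value and then rises until it is on again, so one single increment bounds it; the
    sum over all steps is a crude bound for that increment. *)
Lemma deW_ge_sq c z n : 0 < c ->
  - (c + \sum_(1 <= k < n.+1) z k ^+ 2 / c) <= W z n.
Proof.
move=> c0; elim: n => [|n IH]; first by rewrite oppr_le0 big_geq// addr0 ltW.
have s0 : 0 <= \sum_(1 <= k < n.+1) z k ^+ 2 / c.
  by apply: sumr_ge0 => k _; rewrite divr_ge0 ?sqr_ge0// ltW.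
have q0 : 0 <= z n.+1 ^+ 2 / c by rewrite divr_ge0 ?sqr_ge0// ltW.
rewrite big_nat_recr//= ; case: ifPn => Wn.
  rewrite (le_trans _ (trunc_ge _ h_ge0))//.
  rewrite (le_trans _ (lerD Wn (lerNnormlW (norm_le_sq (z n.+1) c0))))//.
  by rewrite add0r lerN2 lerD2l lerDr.
by have m0 := mu_gt0; rewrite le_min; apply/andP; split; lra.
Qed.

End Path.

(** * Independence of the past from later observations *)

Section Independence.
Context {R : realType} {d : measure_display} {Omega : measurableType d}.
Variables (L : nat) (X : nat -> 'I_L -> {mfun Omega >-> R}).
Implicit Types (n k : nat) (l : 'I_L) (s : seq (nat * 'I_L)).

Definition gens n : set_system Omega := [set C | exists k l (B : set R),
  [/\ (1 <= k <= n)%N, measurable B & C = X k l @^-1` B]].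

(** Full history of all sensors, skipped samples included, so it is finer than [information]; bounds
    valid for all its events carry over. *)
Definition past n : set_system Omega := <<s gens n >>.

Definition box s (B : nat * 'I_L -> set R) : set Omega :=
  \bigcap_(i in [set` s]) (X i.1 i.2 @^-1` B i).

Lemma measurable_preim k l (B : set R) :
  measurable B -> measurable (X k l @^-1` B).
Proof. by move=> mB; rewrite -[X in measurable X]setTI; exact: measurable_funP. Qed.

Lemma past_measurable n : past n `<=` measurable.
Proof.
apply: smallest_sub; first exact: sigma_algebra_measurable.
by move=> _ [k [l [B [_ mB ->]]]]; exact: measurable_preim.
Qed.

Lemma past_mono n m : (n <= m)%N -> past n `<=` past m.
Proof.
move=> nm; apply: sub_sigma_algebra2.
move=> _ [k [l [B [/andP[k1 kn] mB ->]]]].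
by exists k, l, B; rewrite k1 (leq_trans kn).
Qed.

Lemma measurable_box s B : (forall i, measurable (B i)) -> measurable (box s B).
Proof.
move=> mB; rewrite /box bigcap_seq; elim/big_ind : _ => //.
  exact: measurableI.
by move=> i _; exact: measurable_preim.
Qed.

Definition idx n : seq (nat * 'I_L) :=
  [seq (k, l) | k <- iota 1 n, l <- enum 'I_L].

Lemma mem_idx n i : (i \in idx n) = (1 <= i.1 <= n)%N.
Proof.
case: i => k l; apply/allpairsP/idP => /=.
  by move=> [[k' l'] /= [+ _ [-> _]]]; rewrite mem_iota add1n ltnS.
by move=> kn; exists (k, l); rewrite mem_iota add1n ltnS mem_enum.
Qed.

Lemma uniq_idx n : uniq (idx n).
Proof. by apply: allpairs_uniq; [exact: iota_uniq|exact: enum_uniq|move=> [? ?] []]. Qed.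

(** The generators of [past] constrain one coordinate and are not closed under intersection; boxes
    over the whole grid [idx n] are, as the uniqueness theorem for measures requires. *)
Lemma box_mono_past n : past n `<=`
  <<s [set C | exists2 B, (forall i, measurable (B i)) & C = box (idx n) B] >>.
Proof.
apply: sub_sigma_algebra2.
move=> _ [k [l [B [kn mB ->]]]].
exists (fun i => if i == (k, l) then B else setT).
  by move=> i; case: ifP.
apply/seteqP; split => [w Bw i _ /=|w /(_ (k, l))].
  by case: eqP => [->|].
by rewrite /= eqxx; apply; rewrite mem_idx.
Qed.

Variable P : probability Omega R.
Hypothesis ind : mutually_independent P [set i : nat * 'I_L | (1 <= i.1)%N]
  (fun i => X i.1 i.2).

(** As functions of [C] both sides are finite measures. They agree on the boxes up to time [n] by
    mutual independence, hence on the sigma-algebra these generate. *)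
Lemma indep_past n s B C : past n C -> uniq s ->
  (forall i, i \in s -> (n < i.1)%N) -> (forall i, measurable (B i)) ->
  P (C `&` box s B) = P C * P (box s B).
Proof.
move=> pC us sn mB; have mD := measurable_box s mB.
have D01 : P (box s B) \is a fin_num by exact: fin_num_measure.
have D0 : (0 <= fine (P (box s B)))%R by rewrite fine_ge0.
suff : mrestr P mD C = mscale (NngNum D0) P C.
  by rewrite /mrestr /mscale /= fineK// muleC.
apply: (g_sigma_algebra_measure_unique
  [set C | exists2 B, (forall i, measurable (B i)) & C = box (idx n) B]
  _ (fun=> setT)) => //.
- by move=> _ [B' mB' ->]; exact: measurable_box.
- by move=> _; exists (fun=> setT) => //; apply/seteqP; split.
- by rewrite bigcup_const//; exists 0%N.
- move=> _ _ [B1 mB1 ->] [B2 mB2 ->]; exists (fun i => B1 i `&` B2 i).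
    by move=> i; exact: measurableI.
  by rewrite /box -bigcapI.
- move=> _ [B' mB' ->]; rewrite /mrestr /mscale /= /mrestr /mscale /= fineK//.
  (* One family of sides serves both boxes, whose index sets are separated by time [n]. *)
  pose B2 i := if (i.1 <= n)%N then B' i else B i.
  have mB2 i : measurable (B2 i) by rewrite /B2; case: ifP.
  have E1 : box (idx n) B' = box (idx n) B2.
    apply: eq_bigcapr => i /=; rewrite mem_idx /B2 => /andP[_ ->//].
  have E2 : box s B = box s B2.
    by apply: eq_bigcapr => i /= /sn; rewrite ltnNge /B2 => /negbTE ->.
  have us2 : uniq (idx n ++ s).
    rewrite cat_uniq uniq_idx us andbT /=; apply/hasPn => i /sn ni.
    by rewrite mem_idx negb_and -(ltnNge n) ni orbT.
  have s1 i : i \in s -> (1 <= i.1)%N by move=> /sn; case: i.1.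
  have i1 i : i \in idx n -> (1 <= i.1)%N by rewrite mem_idx => /andP[].
  rewrite E1 E2 (_ : _ `&` _ = box (idx n ++ s) B2); last first.
    rewrite /box -bigcap_setU; congr bigcap.
    by apply/seteqP; split => i /=; rewrite mem_cat => /orP.
  have si1 i : i \in idx n ++ s -> (1 <= i.1)%N.
    by rewrite mem_cat => /orP[/i1|/s1].
  rewrite (ind us2 si1 mB2) (ind us s1 mB2) (ind (uniq_idx n) i1 mB2).
  by rewrite big_cat /= muleC.
- move=> _; apply: (@le_lt_trans _ _ 1); last exact: ltry.
  by rewrite /= /mrestr probability_le1//; exact: measurableI.
- exact: box_mono_past.
Qed.

Lemma indep_past1 n k l (B : set R) C : past n C -> (n < k)%N -> measurable B ->
  P (C `&` X k l @^-1` B) = P C * P (X k l @^-1` B).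
Proof.
move=> pC nk mB.
have E : X k l @^-1` B = box [:: (k, l)] (fun=> B).
  apply/seteqP; split => [w Bw i /=|w /(_ (k, l))].
    by rewrite inE => /eqP ->.
  by apply; rewrite /= inE.
by rewrite E (@indep_past n)// => i; rewrite inE => /eqP ->.
Qed.

End Independence.

(** * Measurability of path functionals, over any space: [Omega], a past, the path space *)

Section PathMeasurability.
Context {R : realType} {d : measure_display} {T : measurableType d}.
Variables (mu : R) (h : \bar R) (h_ge0 : 0 <= h) (z : nat -> T -> R) (n : nat).
Hypothesis mz : forall k, (1 <= k <= n)%N -> measurable_fun setT (z k).
Local Open Scope ring_scope.

Let path w : nat -> R := z^~ w.

Lemma measurable_trunc (f : T -> R) : measurable_fun setT f ->
  measurable_fun setT (fun w => trunc h (f w)).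
Proof.
move=> mf; case: h h_ge0 => [r _|_|//].
  rewrite (_ : (fun w => _) = (fun w => Num.max (f w) (- r))).
    by apply: measurable_maxr => //; exact: measurable_cst.
  by apply/funext => w; rewrite trunc_fin.
by rewrite (_ : (fun w => _) = f).
Qed.

Lemma measurable_deW k : (k <= n)%N ->
  measurable_fun setT (fun w => deW mu h (path w) k).
Proof.
elim: k => [_|k IH kn]; first exact: measurable_cst.
have mW := IH (ltnW kn); have mk : measurable_fun setT (z k.+1) by exact: mz.
rewrite [X in measurable_fun _ X](_ : _ = fun w =>
  if 0 <= deW mu h (path w) k then trunc h (deW mu h (path w) k + z k.+1 w)
  else Num.min (deW mu h (path w) k + mu) 0)//.
apply: measurable_fun_ifT.
- by apply: measurable_fun_ler => //; exact: measurable_cst.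
- by apply: measurable_trunc; exact: measurable_funD.
- apply: measurable_minr; last exact: measurable_cst.
  by apply: measurable_funD => //; exact: measurable_cst.
Qed.

Lemma measurable_walk k : (k <= n)%N ->
  measurable_fun setT (fun w => walk (path w) k).
Proof.
elim: k => [_|k IH kn].
  by rewrite (_ : (fun _ => _) = cst 0)//; apply/funext => w; rewrite walk0.
rewrite (_ : (fun _ => _) = fun w => walk (path w) k + z k.+1 w).
  by apply: measurable_funD; [exact: IH (ltnW kn)|exact: mz].
by apply/funext => w; rewrite walkS.
Qed.

Lemma measurable_sr k : (k <= n)%N ->
  measurable_fun setT (fun w => sr (path w) k).
Proof.
elim: k => [_|k IH kn]; first exact: measurable_cst.
rewrite [X in measurable_fun _ X](_ : _ = fun w =>
  (1 + sr (path w) k) * expR (z k.+1 w))//.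
apply: measurable_funM.
  by apply: measurable_funD; [exact: measurable_cst|exact: IH (ltnW kn)].
by apply: measurableT_comp => //; exact: mz.
Qed.

Lemma measurable_alive (p : T -> pred nat) k :
  (forall i, (1 <= i <= k)%N -> measurable_fun setT (fun w => p w i)) ->
  measurable_fun setT (fun w => alive (p w) k).
Proof.
elim: k => [_|k IH mp]; first exact: measurable_cst.
rewrite (_ : (fun _ => _) = fun w => alive (p w) k && ~~ p w k.+1); last first.
  by apply/funext => w; rewrite aliveS.
apply: measurable_and.
  by apply: IH => i /andP[i1 ik]; apply: mp; rewrite i1 ltnW.
by apply: measurable_neg; apply: mp; rewrite ltnS leqnn.
Qed.

Lemma measurable_on k : (k <= n)%N ->
  measurable_fun setT (fun w => alive (fun i => walk (path w) i < 0) k).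
Proof.
move=> kn; apply: measurable_alive => i /andP[_ ik].
apply: measurable_fun_ltr; last exact: measurable_cst.
exact: measurable_walk (leq_trans ik kn).
Qed.

Lemma measurable_cycle_end k : (k <= n)%N ->
  measurable_fun setT (fun w => cycle_end mu h (path w) k).
Proof.
case: k => [_|k kn]; first exact: measurable_cst.
rewrite (_ : (fun _ => _) = fun w => (0 <= deW mu h (path w) k.+1) &&
  ((deW mu h (path w) k < 0) || (deW mu h (path w) k + z k.+1 w < 0)))//.
apply: measurable_and.
  by apply: measurable_fun_ler; [exact: measurable_cst|exact: measurable_deW].
apply: measurable_or; apply: measurable_fun_ltr; try exact: measurable_cst.
  exact: measurable_deW (ltnW kn).
by apply: measurable_funD; [exact: measurable_deW (ltnW kn)|exact: mz].
Qed.

Lemma measurable_cycle k : (k <= n)%N ->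
  measurable_fun setT (fun w => alive (cycle_end mu h (path w)) k).
Proof.
move=> kn; apply: measurable_alive => i /andP[_ ik].
exact: measurable_cycle_end (leq_trans ik kn).
Qed.

Lemma measurable_deY D k : (k <= n)%N ->
  measurable_fun setT (fun w => deY mu h D (path w) k).
Proof.
move=> kn; rewrite /deY /deT; apply: measurable_fun_ifT.
- by apply: measurable_fun_ltr; [exact: measurable_cst|exact: measurable_deW].
- exact: measurable_deW.
- exact: measurable_cst.
Qed.

End PathMeasurability.

Lemma measurable_bool_set d (T : measurableType d) (b : T -> bool) :
  measurable_fun setT b -> measurable [set w | b w].
Proof.
move=> mb; rewrite (_ : [set w | _] = setT `&` b @^-1` [set true]).
  exact: mb.
by rewrite setTI; apply/seteqP; split.
Qed.

Lemma measurable_bool_natr d (T : measurableType d) (R : realType)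
  (b : T -> bool) : measurable_fun setT b ->
  measurable_fun setT (fun w => (b w)%:R : R).
Proof.
move=> mb; rewrite (_ : (fun _ => _) = fun w => if b w then 1%R else 0%R : R).
  by apply: measurable_fun_ifT => //; exact: measurable_cst.
by apply/funext => w; case: (b w).
Qed.

Lemma integral_bool d (T : measurableType d) (R : realType)
  (P : {measure set T -> \bar R}) (b : T -> bool) : measurable_fun setT b ->
  \int[P]_w (b w)%:R%:E = P [set w | b w].
Proof.
move=> mb; rewrite -(setIT [set w | b w]) -integral_indic//; last exact: measurable_bool_set.
apply: eq_integral => w _; rewrite indicE; congr ((nat_of_bool _)%:R%:E).
by apply/idP/idP; rewrite inE.
Qed.

Section IndependentExpectation.
Context {R : realType} {d : measure_display} {Omega : measurableType d}.
Variables (L : nat) (X : nat -> 'I_L -> {mfun Omega >-> R}).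
Variable P : probability Omega R.
Hypothesis ind : mutually_independent P [set i : nat * 'I_L | (1 <= i.1)%N]
  (fun i => X i.1 i.2).

Local Notation pastT n := (g_sigma_algebraType (gens X n)).

Lemma measurable_past n d' (T' : measurableType d') (Y : Omega -> T') :
  measurable_fun setT (Y : pastT n -> T') -> measurable_fun setT Y.
Proof. by move=> mY mD B mB; apply: (@past_measurable _ _ _ _ X n); exact: mY. Qed.

Lemma measurable_past_mono n m d' (T' : measurableType d') (Y : Omega -> T') :
  (n <= m)%N ->
  measurable_fun setT (Y : pastT n -> T') -> measurable_fun setT (Y : pastT m -> T').
Proof. by move=> nm mY mD B mB; apply: (past_mono nm); exact: mY. Qed.

Lemma measurable_X_past n k l : (1 <= k <= n)%N ->
  measurable_fun setT (X k l : pastT n -> R).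
Proof.
move=> kn _ B mB; rewrite setTI; apply: sub_sigma_algebra.
by exists k, l, B.
Qed.

(** By [indep_past1] the joint law of [Y] and [X k l] agrees with the product law on rectangles;
    Tonelli then factors the integral. *)
Lemma integral_mul_indep n k l (Y : Omega -> R) (phi : R -> R) :
  measurable_fun setT (Y : pastT n -> R) -> (n < k)%N ->
  (forall w, 0 <= Y w)%R -> measurable_fun setT phi -> (forall x, 0 <= phi x)%R ->
  \int[P]_w (Y w * phi (X k l w))%:E =
  \int[P]_w (Y w)%:E * \int[P]_w (phi (X k l w))%:E.
Proof.
move=> mYp nk Y0 mphi phi0; have mY := measurable_past mYp.
pose Ym : {mfun Omega >-> R} :=
  HB.pack Y (isMeasurableFun.Build _ _ _ _ _ mY).
have mYX : measurable_fun setT (fun w => (Y w, X k l w)).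
  by apply: measurable_fun_pair.
pose YX : {mfun Omega >-> (R * R)%type} :=
  HB.pack (fun w => (Y w, X k l w)) (isMeasurableFun.Build _ _ _ _ _ mYX).
(* The absolute value makes [f] nonnegative on the whole plane and changes nothing under the law of
   [Y >= 0]. *)
pose f (p : R * R) : \bar R := (`|p.1| * phi p.2)%:E.
have mf : measurable_fun setT f.
  apply/measurable_EFinP; apply: measurable_funM.
    by apply: measurableT_comp.
  by apply: measurableT_comp.
have f0 p : 0 <= f p by rewrite lee_fin mulr_ge0.
transitivity (\int[distribution P YX]_p f p).
  rewrite ge0_integral_distribution//; apply: eq_integral => w _ /=.
  by rewrite /f /= ger0_norm.
transitivity (\int[distribution P Ym \x distribution P (X k l)]_p f p).
  apply: eq_measure_integral => A mA _; apply/esym.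
  apply: (@product_measure_unique _ _ _ _ _ (distribution P Ym) (distribution P (X k l)) (distribution P YX)) => //.
  move=> B1 B2 mB1 mB2; rewrite -(indep_past1 ind l _ nk mB2)//.
  by rewrite -[Y @^-1` B1]setTI; exact: mYp.
have mphiE : measurable_fun setT (EFin \o phi) by exact/measurable_EFinP.
have mnorm : measurable_fun setT (EFin \o (@Num.norm _ R : R -> R)).
  exact/measurable_EFinP.
have EX : \int[distribution P (X k l)]_y (phi y)%:E = \int[P]_w (phi (X k l w))%:E.
  by rewrite (@ge0_integral_distribution _ _ _ _ _ P (X k l) (EFin \o phi)).
have EY : \int[distribution P Ym]_x (`|x|)%:E = \int[P]_w (Y w)%:E.
  rewrite (@ge0_integral_distribution _ _ _ _ _ P Ym (EFin \o (@Num.norm _ R : R -> R)))//.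
    by apply: eq_integral => w _ /=; rewrite ger0_norm.
  by move=> y; rewrite lee_fin normr_ge0.
have I0 : 0 <= \int[distribution P (X k l)]_y (phi y)%:E.
  by apply: integral_ge0 => y _; rewrite lee_fin.
have phiE0 y : setT y -> 0 <= (phi y)%:E by rewrite lee_fin.
transitivity (\int[distribution P Ym]_x \int[distribution P (X k l)]_y f (x, y)).
  exact: fubini_tonelli1.
rewrite -EX -EY -ge0_integralZr//.
by apply: eq_integral => x _; rewrite -ge0_integralZl_EFin.
Qed.

End IndependentExpectation.

(** * Path space and the law of the shifted path *)

Section PathSpace.
Context {R : realType}.
Implicit Types (m k : nat) (B : nat -> set R).

(** Coordinate 0 stays free: increments are indexed from 1 and [z 0] is junk. *)
Definition cylinder m B : set (nat -> R) :=
  [set z | forall k, (1 <= k <= m)%N -> B k (z k)].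

Definition cylinders : set_system (nat -> R) :=
  [set E | exists m B, (forall k, measurable (B k)) /\ E = cylinder m B].

Local Notation pathT := (g_sigma_algebraType cylinders).

Lemma cylinders_setI : setI_closed cylinders.
Proof.
move=> _ _ [m1 [B1 [mB1 ->]]] [m2 [B2 [mB2 ->]]].
exists (maxn m1 m2), (fun k => (if (k <= m1)%N then B1 k else setT) `&`
                               (if (k <= m2)%N then B2 k else setT)).
split; first by move=> k; apply: measurableI; case: ifP.
apply/seteqP; split => [z [h1 h2] k /andP[k1 _]|z hz].
  by split; case: ifP => // km; [apply: h1|apply: h2]; rewrite k1.
split=> k /andP[k1 km].
  have [|+ _] := hz k; first by rewrite k1 leq_max km.
  by rewrite km.
have [|_] := hz k; first by rewrite k1 leq_max km orbT.
by rewrite km.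
Qed.

Lemma measurable_coord k : (1 <= k)%N ->
  measurable_fun setT (fun z : pathT => z k : R).
Proof.
move=> k1 _ B mB; rewrite setTI; apply: sub_sigma_algebra.
exists k, (fun i => if i == k then B else setT); split.
  by move=> i; case: ifP.
apply/seteqP; split => [z /= Bz i _|z hz].
  by case: eqP => [->|].
by have := hz k; rewrite eqxx; apply; rewrite k1 leqnn.
Qed.

End PathSpace.

Notation pathT R := (g_sigma_algebraType (@cylinders R)).

Section ShiftLaw.
Context {R : realType} {d : measure_display} {Omega : measurableType d}.
Variables (L : nat) (X : nat -> 'I_L -> {mfun Omega >-> R}).
Variable P : probability Omega R.
Hypothesis ind : mutually_independent P [set i : nat * 'I_L | (1 <= i.1)%N]
  (fun i => X i.1 i.2).
Variables (l : 'I_L) (phi : R -> R).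
Hypothesis mphi : measurable_fun setT phi.
Hypothesis ident : forall n (B : set R), (1 <= n)%N -> measurable B ->
  P (X n l @^-1` B) = P (X 1%N l @^-1` B).

Let path w : nat -> R := fun n => phi (X n l w).

Let mpre B : measurable B -> measurable (phi @^-1` B).
Proof. by move=> mB; rewrite -[X in measurable X]setTI; exact: mphi. Qed.

Lemma measurable_path_shift j : measurable_fun setT ((fun w => shift j (path w)) : Omega -> pathT R).
Proof.
apply: (@measurability d _ Omega (pathT R) setT (fun w => shift j (path w)) (@cylinders R)) => //. 
move=> _ [_ [m [B [mB ->]]] <-]; rewrite setTI.
rewrite (_ : _ @^-1` _ = \bigcap_(k in [set` iota 1 m])
    (X (j + k)%N l @^-1` (phi @^-1` B k))).
  rewrite bigcap_seq; elim/big_ind : _ => //; first exact: measurableI.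
  by move=> k _; apply: measurable_preim; exact: mpre.
apply/seteqP; split => w h k.
  by rewrite /= mem_iota add1n ltnS => /h.
by move=> km; apply: (h k); rewrite /= mem_iota add1n ltnS.
Qed.

Let P_cylinder j m B C : past X j C -> (forall k, measurable (B k)) ->
  P (C `&` (fun w => shift j (path w)) @^-1` cylinder m B) =
  P C * \prod_(k <- iota 1 m) P (X 1%N l @^-1` (phi @^-1` B k)).
Proof.
move=> pC mB; pose s := [seq ((j + k)%N, l) | k <- iota 1 m].
pose B' (i : nat * 'I_L) := phi @^-1` B (i.1 - j)%N.
have mB' i : measurable (B' i) by exact: mpre.
have us : uniq s by rewrite map_inj_uniq ?iota_uniq// => a b [] /addnI.
have js i : i \in s -> (j < i.1)%N.
  by move=> /mapP[k]; rewrite mem_iota => /andP[k1 _] -> /=; rewrite -addn1 leq_add2l.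
have s1 i : i \in s -> (1 <= i.1)%N by move=> /js; case: i.1.
rewrite (_ : _ @^-1` _ = box X s B').
  rewrite (indep_past ind pC us js mB'); congr (_ * _).
  rewrite /box (ind us s1 mB') big_map; apply: eq_big_seq => k.
  rewrite mem_iota => /andP[k1 _] /=; rewrite /B' /= addKn.
  by rewrite ident ?addn_gt0 ?k1 ?orbT//; exact: mpre.
apply/seteqP; split => w /=.
  move=> h i /mapP[k]; rewrite mem_iota add1n ltnS => km ->.
  by rewrite /B' /= addKn; exact: h.
move=> h k km; have /= := h ((j + k)%N, l); rewrite /B' /= addKn; apply.
by apply/mapP; exists k => //; rewrite mem_iota add1n ltnS.
Qed.

(** The path after time [j] is independent of the past at [j] and distributed like the original
    path. Both sides are finite measures in [E], compared on cylinders. The time [j] is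
    deterministic because [sum_renewal] sums over all candidates for the last renewal. *)
Lemma shift_law j C (E : set (pathT R)) : past X j C -> measurable E ->
  P (C `&` (fun w => shift j (path w)) @^-1` E) = P C * P (path @^-1` E).
Proof.
move=> pC mE; have mC := past_measurable pC.
have mpsi := measurable_path_shift.
pose psi i : Omega -> pathT R := fun w => shift i (path w).
have C0 : (0 <= fine (P C))%R by rewrite fine_ge0.
have CE : (fine (P C))%:E = P C by rewrite fineK// fin_num_measure.
suff : pushforward (mrestr P mC) (psi j) E =
       mscale (NngNum C0) (pushforward P (psi 0%N)) E.
  by move=> /(_ (mpsi 0%N)) H; rewrite setIC -CE; exact: H.
have past0 : past X 0 setT by exact: (@measurableT _ (g_sigma_algebraType (gens X 0))).
pose m1 := pushforward (mrestr P mC) (psi j) : {measure set (pathT R) -> \bar R}.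
pose m2 := mscale (NngNum C0) (pushforward P (psi 0%N)) : {measure set (pathT R) -> \bar R}.
move=> mpsi0; rewrite (Prop_irrelevance mpsi0 (mpsi 0%N)).
apply: (@measure_unique _ R (pathT R) cylinders (fun=> setT) _ _ _ _ (m1 (mpsi j)) (m2 (mpsi 0%N))) => //.
- exact: cylinders_setI.
- by move=> _; exists 0%N, (fun=> setT); split => //; apply/seteqP; split.
- by rewrite bigcup_const//; exists 0%N.
- move=> _ [m [B [mB ->]]].
  rewrite /= /pushforward /mrestr /mscale /= /pushforward /mrestr /mscale /= CE.
  rewrite setIC P_cylinder//; congr (_ * _).
  by have := @P_cylinder 0%N m B _ past0 mB; rewrite setTI probability_setT mul1e => ->.
- move=> _; apply: (@le_lt_trans _ _ 1); last exact: ltry.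
  rewrite /m1 /= /pushforward /mrestr /= probability_le1//; apply: measurableI => //.
  by rewrite preimage_setT.
Qed.

End ShiftLaw.

Lemma aeS d (T : measurableType d) (R : realType)
  (m : {measure set T -> \bar R}) (A B : T -> Prop) : {ae m, forall x, A x} ->
  (forall x, A x -> B x) -> {ae m, forall x, B x}.
Proof. by move=> mA AB; apply: filterS mA. Qed.

(** * Expectations through densities, and the log likelihood ratio *)

Section DensityExpectation.
Context {R : realType} {d : measure_display} {Omega : measurableType d}.
Variables (P : probability Omega R) (X : {mfun Omega >-> R}).
Variables (nu : {sigma_finite_measure set (measurableTypeR R) -> \bar R}).
Variables (f : R -> R).
Hypotheses (df : is_density nu f) (Xf : has_density P X nu f).

(** [has_density] describes the law on events only. It makes the law absolutely continuous with
    respect to [nu], with a Radon-Nikodym derivative equal to [f] almost everywhere, so the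
    change-of-variables formula applies. *)
Lemma integral_has_density (phi : R -> R) : measurable_fun setT phi ->
  (forall x, 0 <= phi x)%R ->
  \int[P]_w (phi (X w))%:E = \int[nu]_x (phi x * f x)%:E.
Proof.
move=> mphi phi0; have [mf f0 _] := df.
have mX1 : measurable_fun setT (X : Omega -> measurableTypeR R).
  by move=> mD B mB; apply: measurable_funP.
pose X1 : {mfun Omega >-> measurableTypeR R} :=
  HB.pack (X : Omega -> measurableTypeR R) (isMeasurableFun.Build _ _ _ _ _ mX1).
pose Q : {finite_measure set (measurableTypeR R) -> \bar R} := distribution P X1.
have QE B : measurable B -> Q B = \int[nu]_(x in B) (f x)%:E by exact: Xf.
have Qnu : Q `<< nu.
  apply/null_content_dominatesP => A mA nuA; rewrite QE//.
  by apply: null_set_integral => //; apply/measurable_EFinP; exact: measurable_funTS.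
have mphiE : measurable_fun setT (EFin \o phi) by exact/measurable_EFinP.
have mfE : measurable_fun setT (EFin \o f) by exact/measurable_EFinP.
have mRN : measurable_fun setT (Radon_Nikodym_SigmaFinite.f Q nu).
  exact: measurable_int (Radon_Nikodym_SigmaFinite.f_integrable Qnu).
have ffE : ae_eq nu setT (Radon_Nikodym_SigmaFinite.f Q nu) (EFin \o f).
  apply: integral_ae_eq => //.
  - exact: Radon_Nikodym_SigmaFinite.f_integrable.
  - by move=> A _ mA; rewrite -Radon_Nikodym_SigmaFinite.f_integral// QE.
transitivity (\int[Q]_x (phi x)%:E).
  by rewrite (@ge0_integral_distribution _ _ _ _ _ P X1 (EFin \o phi)).
rewrite -(@Radon_Nikodym_SigmaFinite.change_of_variables _ _ _ Q nu Qnu (EFin \o phi))//.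
apply: ge0_ae_eq_integral => //.
- exact: emeasurable_funM.
- by apply/measurable_EFinP; exact: measurable_funM.
- by move=> x _; rewrite mule_ge0 ?lee_fin// Radon_Nikodym_SigmaFinite.f_ge0.
- by move=> x _; rewrite lee_fin mulr_ge0.
- apply: filterS ffE => x /(_ I) /= E _; by rewrite E EFinM.
Qed.

End DensityExpectation.

Section Densities.
Context {R : realType}.
Variable nu : {measure set (measurableTypeR R) -> \bar R}.
Variables f g : R -> R.
Hypotheses (df : is_density nu f) (dg : is_density nu g).
Local Open Scope ring_scope.

Let mf : measurable_fun setT f. Proof. by case: df. Qed.
Let mg : measurable_fun setT g. Proof. by case: dg. Qed.
Let f0 x : 0 <= f x. Proof. by case: df. Qed.
Let g0 x : 0 <= g x. Proof. by case: dg. Qed.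

Lemma measurable_llr : measurable_fun setT (llr f g).
Proof.
rewrite (_ : llr f g = fun x => ln (f x * g x `^ (-1))).
  apply: measurableT_comp; first exact: measurable_ln.
  apply: measurable_funM => //.
  have mV : measurable_fun setT (@powR R ^~ (-1)) by exact: measurable_powR.
  exact: (measurableT_comp mV mg).
by apply/funext => x; rewrite /llr powR_inv1.
Qed.

End Densities.

(** Valid at every point: where a density vanishes both sides are 0. *)
Lemma llrC {R : realType} (f g : R -> R) x : (llr g f x = - llr f g x)%R.
Proof.
rewrite /llr -invf_div; have [t0|t0] := ltP 0%R (f x / g x)%R; first by rewrite lnV.
by rewrite !ln0 ?invr_le0// oppr0.
Qed.

(** * Kullback-Leibler divergence and exponential moments *)

Section Divergence.
Context {R : realType}.
Variable nu : {measure set (measurableTypeR R) -> \bar R}.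
Variables f g : R -> R.
Hypotheses (df : is_density nu f) (dg : is_density nu g).
Hypothesis KLfg : KL nu f g < +oo.

Let mf : measurable_fun setT f. Proof. by case: df. Qed.
Let mg : measurable_fun setT g. Proof. by case: dg. Qed.
Let f0 x : (0 <= f x)%R. Proof. by case: df. Qed.
Let g0 x : (0 <= g x)%R. Proof. by case: dg. Qed.
Let y := llr g f.
Let my : measurable_fun setT y := measurable_llr dg df.

Let k x : \bar R := if f x == 0%R then 0
  else if g x == 0%R then +oo else (f x * ln (f x / g x))%:E.

Let mk : measurable_fun setT k.
Proof.
apply: measurable_fun_ifT.
- by apply: measurable_fun_eqr => //; exact: measurable_cst.
- exact: measurable_cst.
apply: measurable_fun_ifT.
- by apply: measurable_fun_eqr => //; exact: measurable_cst.
- exact: measurable_cst.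
apply/measurable_EFinP; apply: measurable_funM => //.
exact: (measurable_llr df dg).
Qed.

(** Where [f] is positive and [g] vanishes the integrand of [KL] is infinite, so that set is null
    once the positive part is integrable. Finiteness of [KL] yields this because the negative part
    has integral at most 1. *)
Lemma ae_abs_cont : {ae nu, forall x, f x = 0%R \/ g x != 0%R}.
Proof.
(* By [ln t <= t] at [t = g x / f x], the negative part of [f ln (f / g)] is at most [g]. *)
have kneg x : k^\- x <= (g x)%:E.
  rewrite funenegE /k; have [_|fx] := eqVneq (f x) 0%R.
    by rewrite oppe0 maxxx lee_fin.
  have [->|gx] := eqVneq (g x) 0%R; first by rewrite maxNye.
  rewrite -EFinN -EFin_max lee_fin ge_max g0 andbT.
  have f1 : (0 < f x)%R by rewrite lt_def fx f0.
  have g1 : (0 < g x)%R by rewrite lt_def gx g0.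
  rewrite -mulrN -lnV ?posrE ?divr_gt0// invf_div -ler_pdivlMl// (mulrC _ (g x)).
  exact: ltW (ln_sublinear (divr_gt0 g1 f1)).
have kn : \int[nu]_x k^\- x <= 1.
  have [_ _ <-] := dg; apply: ge0_le_integral => //.
  - exact: measurable_funeneg.
  - exact/measurable_EFinP.
have kp : \int[nu]_x k^\+ x < +oo.
  move: KLfg; rewrite /KL -/k integralE.
  have : \int[nu]_x k^\- x \is a fin_num.
    rewrite ge0_fin_numE; first exact: le_lt_trans kn (ltry _).
    by apply: integral_ge0 => x _; exact: funeneg_ge0.
  case: (\int[nu]_x k^\- x) => // r _.
  by case: (\int[nu]_x k^\+ x) => //= s; rewrite !ltry.
have ik : nu.-integrable setT k^\+.
  apply/integrableP; split; first exact: measurable_funepos.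
  by under eq_integral do rewrite gee0_abs//.
apply: filterS (integrable_ae measurableT ik) => x /(_ I).
rewrite funeposE /k; case: eqVneq => [->|fx]; first by left.
by case: eqVneq => // gx _; right.
Qed.

(** Almost everywhere on [f != 0] the integrand is [g]; on [f = 0] it is 0, so mass of [g] may be
    lost and only an inequality holds. Points with [g x = 0] and [f x != 0], where the convention
    [llr = 0] would contribute [f x], form a null set. *)
Lemma integral_exp_llr_le1 : \int[nu]_x (expR (y x) * f x)%:E <= 1.
Proof.
have [_ _ <-] := dg; apply: ae_ge0_le_integral => //.
- by move=> x _; rewrite lee_fin mulr_ge0 ?expR_ge0.
- apply/measurable_EFinP; apply: measurable_funM => //.
  exact: measurableT_comp.
- by move=> x _; rewrite lee_fin.
- exact/measurable_EFinP.
- apply: (aeS ae_abs_cont) => x fg _; rewrite lee_fin.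
  have [->|fx] := eqVneq (f x) 0%R; first by rewrite mulr0.
  have gx : g x != 0%R by case: fg => // fx0; rewrite fx0 eqxx in fx.
  rewrite /y /llr lnK ?divfK// posrE divr_gt0// lt_def.
    by rewrite gx g0.
  by rewrite fx f0.
Qed.

(** With [u = expR (y / 2)], the means of [(1 - u)^2] and of [2 u] under [f] add up to the mean of
    [1 + u^2], at most 2. Were the mean of [u] at least 1, that of [(1 - u)^2] would be 0, hence
    [y = 0] almost everywhere under [f], against the positive absolute moment. *)
Lemma integral_exp_half_llr_lt1 : 0 < \int[nu]_x (`|y x| * f x)%:E ->
  \int[nu]_x (expR (y x / 2) * f x)%:E < 1.
Proof.
move=> y0; pose u x := expR (y x / 2).
have mu_ : measurable_fun setT u.
  by apply: measurableT_comp => //; apply: measurable_funM => //; exact: measurable_cst.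
pose a := \int[nu]_x ((1 - u x) ^+ 2 * f x)%:E.
pose b := \int[nu]_x (u x * f x)%:E.
have msq : measurable_fun setT (fun x => ((1 - u x) ^+ 2 * f x)%R).
  apply: measurable_funM => //; apply: measurable_funX.
  by apply: measurable_funB => //; exact: measurable_cst.
have muf : measurable_fun setT (fun x => (u x * f x)%R) by exact: measurable_funM.
have mef : measurable_fun setT (fun x => (expR (y x) * f x)%R).
  by apply: measurable_funM => //; exact: measurableT_comp.
have a0 : 0 <= a.
  by apply: integral_ge0 => x _; rewrite lee_fin mulr_ge0// sqr_ge0.
have b0 : 0 <= b.
  by apply: integral_ge0 => x _; rewrite lee_fin mulr_ge0// expR_ge0.
have ab : a + (b + b) <= 2%:E.
  have : \int[nu]_x ((f x)%:E + (expR (y x) * f x)%:E) <= 2%:E.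
    rewrite ge0_integralD//; last 4 first.
    - by move=> x _; rewrite lee_fin.
    - exact/measurable_EFinP.
    - by move=> x _; rewrite lee_fin mulr_ge0// expR_ge0.
    - exact/measurable_EFinP.
    have [_ _ ->] := df; rewrite (_ : 2%:E = 1 + 1)//.
    by apply: leeD => //; exact: integral_exp_llr_le1.
  apply: le_trans; rewrite /a /b -ge0_integralD//; last 4 first.
  - by move=> x _; rewrite lee_fin mulr_ge0// expR_ge0.
  - exact/measurable_EFinP.
  - by move=> x _; rewrite lee_fin mulr_ge0// expR_ge0.
  - exact/measurable_EFinP.
  rewrite -ge0_integralD//; last 4 first.
  - by move=> x _; rewrite lee_fin mulr_ge0// sqr_ge0.
  - exact/measurable_EFinP.
  - by move=> x _; rewrite -EFinD lee_fin addr_ge0// mulr_ge0// expR_ge0.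
  - by apply: emeasurable_funD; exact/measurable_EFinP.
  rewrite le_eqVlt; apply/orP; left; apply/eqP; apply: eq_integral => x _.
  rewrite -!EFinD; congr EFin.
  have -> : expR (y x) = (u x ^+ 2)%R by rewrite /u -expRM_natl; congr expR; field.
  by ring.
rewrite ltNge; apply/negP => b1; rewrite -/b in b1.
have a00 : a = 0.
  apply/eqP; rewrite eq_le a0 andbT.
  move: ab b1 a0; case: (a) => [a'| |]; case: (b) => [b'| |] //=.
  by rewrite -!EFinD !lee_fin => ? ? ?; lra.
move: y0; rewrite (_ : \int[nu]_x _ = 0) ?ltxx//.
have : \int[nu]_x `|((1 - u x) ^+ 2 * f x)%:E| = 0.
  by rewrite -a00; apply: eq_integral => x _; rewrite gee0_abs// lee_fin mulr_ge0// sqr_ge0.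
move/ae_eq_integral_abs => /(_ measurableT) h.
rewrite (ae_eq_integral (cst 0)) ?integral0//.
- apply/measurable_EFinP; apply: measurable_funM => //.
  exact: measurableT_comp.
- have /h : measurable_fun setT (fun x => ((1 - u x) ^+ 2 * f x)%:E) by exact/measurable_EFinP.
  apply: filterS => x /(_ I) /= [] /eqP; rewrite mulf_eq0 => /orP[|/eqP ->]; last by rewrite mulr0.
  rewrite sqrf_eq0 subr_eq0 eq_sym => /eqP ux1 _.
  have : (y x / 2 = 0)%R by apply: expR_inj; rewrite expR0.
  by move=> /eqP; rewrite mulf_eq0 => /orP[/eqP->|]; rewrite ?normr0 ?mul0r// invr_eq0 pnatr_eq0.
Qed.

(** A difference of nonnegative integrals is the form in which means of increments enter later. The
    integrand of [KL] and the log likelihood ratio differ only on a null set, by [ae_abs_cont]. *)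
Lemma KL_llr : KL nu f g =
  \int[nu]_x (Num.max (- y x) 0 * f x)%:E - \int[nu]_x (Num.max (y x) 0 * f x)%:E.
Proof.
have myf : measurable_fun setT (fun x => (- y x * f x)%R).
  by apply: measurable_funM => //; exact: measurable_funN.
transitivity (\int[nu]_x (- y x * f x)%:E).
  apply: ae_eq_integral => //; first exact/measurable_EFinP.
  apply: (aeS ae_abs_cont) => x fg _.
  have [->|fx] := eqVneq (f x) 0%R; first by rewrite mulr0.
  case: eqVneq => [gx|gx]; first by case: fg => fg; [rewrite fg eqxx in fx|rewrite gx eqxx in fg].
  by rewrite /y llrC opprK mulrC.
rewrite integralE; congr (_ - _); apply: eq_integral => x _.
  by rewrite funeposE -EFin_max maxr_pMl// mul0r.
by rewrite funenegE -EFinN mulNr opprK -EFin_max maxr_pMl// mul0r.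
Qed.

End Divergence.

(** * Expectations of nonnegative functions *)

Section Expectation.
Context {R : realType} {d : measure_display} {Omega : measurableType d}.
Variable P : probability Omega R.
Implicit Types f g : Omega -> R.

Definition Ex f : \bar R := \int[P]_w (f w)%:E.

Lemma Ex_ge0 f : (forall w, 0 <= f w)%R -> 0 <= Ex f.
Proof. by move=> f0; apply: integral_ge0 => w _; rewrite lee_fin. Qed.

Lemma Ex_le f g : measurable_fun setT f -> measurable_fun setT g ->
  (forall w, 0 <= f w)%R -> (forall w, f w <= g w)%R -> Ex f <= Ex g.
Proof.
move=> mf mg f0 fg; apply: ge0_le_integral => //.
- by move=> w _; rewrite lee_fin.
- exact/measurable_EFinP.
- exact/measurable_EFinP.
- by move=> w _; rewrite lee_fin.
Qed.

Lemma ExD f g : measurable_fun setT f -> measurable_fun setT g ->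
  (forall w, 0 <= f w)%R -> (forall w, 0 <= g w)%R ->
  Ex (fun w => f w + g w)%R = Ex f + Ex g.
Proof.
move=> mf mg f0 g0; rewrite /Ex -ge0_integralD//.
- by move=> w _; rewrite lee_fin.
- exact/measurable_EFinP.
- by move=> w _; rewrite lee_fin.
- exact/measurable_EFinP.
Qed.

Lemma ExZ (c : R) f : measurable_fun setT f -> (0 <= c)%R ->
  (forall w, 0 <= f w)%R -> Ex (fun w => c * f w)%R = c%:E * Ex f.
Proof.
move=> mf c0 f0; rewrite /Ex -ge0_integralZl_EFin//.
- by move=> w _; rewrite lee_fin.
- exact/measurable_EFinP.
Qed.

Lemma Ex_sum (I : Type) (s : seq I) (Q : pred I) (F : I -> Omega -> R) :
  (forall i, measurable_fun setT (F i)) -> (forall i w, 0 <= F i w)%R ->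
  Ex (fun w => \sum_(i <- s | Q i) F i w)%R = \sum_(i <- s | Q i) Ex (F i).
Proof.
move=> mF F0; rewrite -big_filter.
rewrite [LHS](_ : _ = Ex (fun w => \sum_(i <- [seq i <- s | Q i]) F i w)%R); last first.
  by rewrite /Ex; apply: eq_integral => w _; rewrite big_filter.
elim: [seq i <- s | Q i] => [|i r IH].
  rewrite big_nil /Ex; under eq_integral do rewrite big_nil.
  by rewrite integral0.
rewrite big_cons -IH -ExD//.
- by rewrite /Ex; apply: eq_integral => w _; rewrite big_cons.
- exact: measurable_sum.
- by move=> w; apply: sumr_ge0.
Qed.

Lemma Ex_bool (b : Omega -> bool) : measurable_fun setT b ->
  Ex (fun w => (b w)%:R)%R = P [set w | b w].
Proof. exact: integral_bool. Qed.

Lemma Ex_cst (c : R) : Ex (fun=> c) = c%:E.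
Proof. by rewrite /Ex integral_cst// [X in _ * X]probability_setT mule1. Qed.

Lemma eq_Ex f g : f =1 g -> Ex f = Ex g.
Proof. by move=> /funext ->. Qed.

Lemma Ex_fin_le f (c : R) : (forall w, 0 <= f w)%R -> Ex f <= c%:E ->
  Ex f \is a fin_num.
Proof.
by move=> f0 fc; rewrite ge0_fin_numE ?Ex_ge0// (le_lt_trans fc)// ltry.
Qed.

Lemma Ex_first_time (p : Omega -> pred nat) :
  (forall k, (1 <= k)%N -> measurable_fun setT (fun w => p w k)) ->
  \int[P]_w first_time (p w) =
  \sum_(0 <= n <oo) Ex (fun w => (alive (p w) n)%:R)%R.
Proof.
move=> mp; under eq_integral do rewrite first_timeE.
rewrite integral_nneseries// => n; apply/measurable_EFinP.
apply: measurable_bool_natr; apply: measurable_alive => i /andP[i1 _].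
exact: mp.
Qed.

End Expectation.

(** * False alarms: optional stopping of the Shiryaev-Roberts statistics *)

Section Process.
Context {R : realType} {d : measure_display} {Omega : measurableType d}.
Variables (L : nat) (X : nat -> 'I_L -> {mfun Omega >-> R}).
Variable P : probability Omega R.
Hypothesis ind : mutually_independent P [set i : nat * 'I_L | (1 <= i.1)%N]
  (fun i => X i.1 i.2).
Variable phi : 'I_L -> R -> R.
Hypothesis mphi : forall l, measurable_fun setT (phi l).
Variables (mu : 'I_L -> R) (h : 'I_L -> \bar R) (D : 'I_L -> R).
Hypotheses (mu_gt0 : forall l, (0 < mu l)%R) (h_ge0 : forall l, 0 <= h l).
Hypothesis D_ge0 : forall l, (0 <= D l)%R.

Local Notation pastT n := (g_sigma_algebraType (gens X n)).

Definition obs l w n : R := phi l (X n l w).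

Lemma measurable_obs_past n l k : (1 <= k <= n)%N ->
  measurable_fun setT ((fun w => obs l w k) : pastT n -> R).
Proof. by move=> kn; apply: measurableT_comp => //; exact: measurable_X_past. Qed.

Lemma Ex_mul_indep n k l (Y : Omega -> R) (psi : R -> R) :
  measurable_fun setT (Y : pastT n -> R) -> (n < k)%N ->
  (forall w, 0 <= Y w)%R -> measurable_fun setT psi ->
  (forall x, 0 <= psi x)%R ->
  Ex P (fun w => Y w * psi (obs l w k))%R = Ex P Y * Ex P (fun w => psi (obs l w k)).
Proof.
move=> mY nk Y0 mpsi psi0.
have mpp : measurable_fun setT (psi \o phi l) by exact: measurableT_comp.
by apply: (@integral_mul_indep _ _ _ _ _ _ ind n k l Y (psi \o phi l)) => // x /=.
Qed.

Definition fusion A w : pred nat :=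
  fun n => (A < \sum_(l < L) deY (mu l) (h l) (D l) (obs l w) n)%R.

Lemma measurable_fusion_past A n k : (k <= n)%N ->
  measurable_fun setT ((fun w => fusion A w k) : pastT n -> bool).
Proof.
move=> kn; apply: measurable_fun_ltr; first exact: measurable_cst.
apply: measurable_sum => l.
have mz j (jn : (1 <= j <= n)%N) := @measurable_obs_past n l j jn.
exact: (@measurable_deY R _ (pastT n) (mu l) (h l) (h_ge0 l) _ n mz (D l) k kn).
Qed.

Lemma measurable_alive_past A n k : (k <= n)%N ->
  measurable_fun setT ((fun w => alive (fusion A w) k) : pastT n -> bool).
Proof.
move=> kn; apply: measurable_alive => i /andP[_ ik].
exact: measurable_fusion_past (leq_trans ik kn).
Qed.

Lemma measurable_sr_past n k l : (k <= n)%N ->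
  measurable_fun setT ((fun w => sr (obs l w) k) : pastT n -> R).
Proof. by apply: measurable_sr => j; exact: measurable_obs_past. Qed.

Lemma deY_ge0 l w n : (0 <= deY (mu l) (h l) (D l) (obs l w) n)%R.
Proof.
rewrite /deY /deT; case: ifPn => // /ltW; exact: le_trans.
Qed.

Hypothesis L_ge1 : (1 <= L)%N.

(** If a sum of [L] terms exceeds [L * b], one of them exceeds [b]: this is why the threshold
    carries the factor [L]. The statistic of that sensor is positive, so [deW_sr] applies to it. *)
Lemma fusion_sr (b : R) w n : (0 <= b)%R -> fusion (L%:R * b)%R w n ->
  (expR b <= \sum_(l < L) sr (obs l w) n)%R.
Proof.
move=> b0 hn.
have [l Wl] : exists l, (b < deY (mu l) (h l) (D l) (obs l w) n)%R.
  apply/not_existsP => hl; move: hn; rewrite /fusion ltNge => /negP; apply.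
  rewrite (_ : (L%:R * b = \sum_(l < L) b)%R).
    by apply: ler_sum => l _; rewrite leNgt; apply/negP/hl.
  by rewrite sumr_const card_ord mulr_natl.
have {}Wl : (b < deW (mu l) (h l) (obs l w) n)%R.
  by move: Wl; rewrite /deY; case: ifP => // _; rewrite ltNge b0.
rewrite (bigD1 l)//= (@le_trans _ _ (sr (obs l w) n))//; last first.
  by rewrite lerDl; apply: sumr_ge0 => i _; exact: sr_ge0.
have [W0|] := deW_sr (mu l) (h_ge0 l) (obs l w) n.
  by move: (le_lt_trans b0 Wl); rewrite ltNge W0.
by apply: le_trans; rewrite ler_expR ltW.
Qed.

Hypothesis exp1 : forall l n, (1 <= n)%N ->
  Ex P (fun w => expR (obs l w n)) <= 1.

Local Notation S w n := (\sum_(l < L) sr (obs l w) n)%R.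

Let mS n k : (k <= n)%N -> measurable_fun setT ((fun w => S w k) : pastT n -> R).
Proof. by move=> kn; apply: measurable_sum => l; exact: measurable_sr_past. Qed.

Let S_ge0 w n : (0 <= S w n)%R.
Proof. by apply: sumr_ge0 => l _; exact: sr_ge0. Qed.

(** Survival and [sr] at time [n] are decided by the past at [n], so the factor
    [expR (obs l w n.+1)] splits off with mean at most 1; the summands 1 of the [L] statistics give
    the term in [L]. *)
Let sr_step A n :
  Ex P (fun w => S w n.+1 * (alive (fusion A w) n)%:R)%R <=
  L%:R%:E * Ex P (fun w => (alive (fusion A w) n)%:R)%R +
  Ex P (fun w => S w n * (alive (fusion A w) n)%:R)%R.
Proof.
pose al w := (alive (fusion A w) n)%:R : R.
have mal : measurable_fun setT (al : pastT n -> R).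
  by apply: measurable_bool_natr; exact: measurable_alive_past.
pose Y l w := ((1 + sr (obs l w) n) * al w)%R.
have mY l : measurable_fun setT (Y l : pastT n -> R).
  apply: measurable_funM => //; apply: measurable_funD; first exact: measurable_cst.
  exact: measurable_sr_past.
have Y0 l w : (0 <= Y l w)%R by rewrite mulr_ge0// addr_ge0// sr_ge0.
have mYO l : measurable_fun setT (Y l) by exact: (measurable_past (mY l)).
have mobs l : measurable_fun setT (fun w => expR (obs l w n.+1)).
  by apply: measurableT_comp => //; apply: (measurable_past (@measurable_obs_past n.+1 l n.+1 _)) => //=.
rewrite (_ : Ex P _ = Ex P (fun w => \sum_(l < L) Y l w * expR (obs l w n.+1))%R); last first.
  apply: eq_Ex => w; rewrite big_distrl /=; apply: eq_bigr => l _.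
  by rewrite /Y /al; ring.
rewrite Ex_sum; last 2 first.
- by move=> l; exact: measurable_funM.
- by move=> l w; rewrite mulr_ge0// expR_ge0.
apply: (@le_trans _ _ (\sum_(l < L) Ex P (Y l))).
  apply: lee_sum => l _; rewrite (@Ex_mul_indep n)//.
  by rewrite -[leRHS]mule1; apply: lee_wpmul2l; [exact: Ex_ge0|exact: exp1].
have malO := measurable_past mal.
rewrite -Ex_sum// -ExZ// -ExD//.
- rewrite le_eqVlt; apply/orP; left; apply/eqP; apply: eq_Ex => w.
  by rewrite /Y -big_distrl /= big_split /= sumr_const card_ord -mulrDl.
- by apply: measurable_funM => //; exact: measurable_cst.
- by apply: measurable_funM => //; exact: (measurable_past (mS (leqnn n))).
- by move=> w; rewrite mulr_ge0.
Qed.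

Let stop A w n := alive (fusion A w) n && fusion A w n.+1.

Let mstop A n : measurable_fun setT (fun w => stop A w n).
Proof.
apply: (measurable_past (n := n.+1) (X := X)); apply: measurable_and.
  exact: measurable_alive_past.
exact: measurable_fusion_past.
Qed.

Let malive A n : measurable_fun setT (fun w => alive (fusion A w) n).
Proof. by apply: (measurable_past (n := n) (X := X)); exact: measurable_alive_past. Qed.

(** Optional stopping at the minimum of the alarm time and [N]: the stopped sum is at least [expR b]
    at an alarm, by [fusion_sr], and each step before the alarm adds at most [L] to its mean, by
    [sr_step]. *)
Let sr_bound b N : (0 <= b)%R ->
  (expR b)%:E * (\sum_(0 <= n < N) P [set w | stop (L%:R * b)%R w n]) +
  Ex P (fun w => S w N * (alive (fusion (L%:R * b)%R w) N)%:R)%R <=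
  L%:R%:E * \sum_(0 <= n < N) P [set w | alive (fusion (L%:R * b)%R w) n].
Proof.
move=> b0; set A := (L%:R * b)%R; elim: N => [|N IH].
  rewrite !big_geq// !mule0 add0e (_ : Ex P _ = Ex P (fun=> 0%R)); last first.
    by apply: eq_Ex => w; rewrite big1 ?mul0r.
  by rewrite Ex_cst.
rewrite !big_nat_recr// ge0_muleDr ?sume_ge0// [leRHS]ge0_muleDr ?sume_ge0//.
(* Paths alive at [N] either raise the alarm at [N.+1], where the sum is at least [expR b], or stay
   alive. *)
apply: (@le_trans _ _ ((expR b)%:E * (\sum_(0 <= n < N) P [set w | stop A w n]) +
   Ex P (fun w => S w N.+1 * (alive (fusion A w) N)%:R)%R)).
  rewrite -addeA; apply: leeD => //.
  rewrite -(Ex_bool _ (mstop A N)) -ExZ ?expR_ge0//; last first.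
    exact: measurable_bool_natr.
  have mSO : measurable_fun setT (fun w => S w N.+1).
    exact: (measurable_past (mS (leqnn N.+1))).
  have m1 : measurable_fun setT (fun w => expR b * (stop A w N)%:R)%R.
    apply: measurable_funM; first exact: measurable_cst.
    exact: measurable_bool_natr.
  have m2 k : measurable_fun setT (fun w => S w N.+1 * (alive (fusion A w) k)%:R)%R.
    by apply: measurable_funM => //; exact: measurable_bool_natr.
  have p1 w : (0 <= expR b * (stop A w N)%:R)%R by rewrite mulr_ge0// expR_ge0.
  have p2 k w : (0 <= S w N.+1 * (alive (fusion A w) k)%:R)%R by rewrite mulr_ge0.
  rewrite -ExD//; apply: Ex_le => //; first exact: measurable_funD.
    by move=> w; rewrite addr_ge0.
  move=> w; rewrite aliveS /stop; case: (alive _ N); last by rewrite !andFb !mulr0 addr0.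
  case fN: (fusion A w N.+1); last by rewrite andbF mulr0 add0r.
  by rewrite andbF mulr1 mulr0 addr0 mulr1; exact: fusion_sr.
apply: (@le_trans _ _ ((expR b)%:E * (\sum_(0 <= n < N) P [set w | stop A w n]) +
  (L%:R%:E * P [set w | alive (fusion A w) N] +
  Ex P (fun w => S w N * (alive (fusion A w) N)%:R)%R))).
  by apply: leeD => //; rewrite -Ex_bool//; exact: sr_step.
rewrite addeCA addeC; exact: leeD2r.
Qed.

Let stop_alive A N : \sum_(0 <= n < N) P [set w | stop A w n] +
  P [set w | alive (fusion A w) N] = 1.
Proof.
elim: N => [|N IH].
  rewrite big_geq// add0e (_ : [set w | _] = setT) ?probability_setT//.
  by apply/seteqP; split.
rewrite big_nat_recr//= -addeA -[RHS]IH; congr (_ + _).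
rewrite -!Ex_bool// -ExD//; try exact: measurable_bool_natr.
apply: eq_Ex => w; rewrite /stop aliveS.
by case: alive; case: fusion; rewrite /= ?addr0 ?add0r.
Qed.

(** An infinite mean is trivial. Otherwise [expR b * P(tau <= N) <= L * E tau] for all [N], and
    [P(tau > N)] tends to 0. *)
Lemma mean_time_false_alarm b : (0 <= b)%R ->
  (expR b / L%:R)%:E <= \int[P]_w first_time (fusion (L%:R * b)%R w).
Proof.
move=> b0; set A := (L%:R * b)%R.
have malE n : Ex P (fun w => (alive (fusion A w) n)%:R)%R = P [set w | alive (fusion A w) n].
  by rewrite Ex_bool.
rewrite Ex_first_time; last first.
  by move=> k _; apply: (measurable_past (n := k) (X := X)); exact: measurable_fusion_past.
set T := \sum_(0 <= n <oo) _.
have Tge N : \sum_(0 <= n < N) P [set w | alive (fusion A w) n] <= T.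
  under eq_bigr do rewrite -malE.
  by apply: nneseries_lim_ge => n _ _; apply: Ex_ge0.
have T0 : 0 <= T by have := Tge 0%N; rewrite big_geq.
have [->|Tfin] := eqVneq T +oo; first exact: leey.
have {Tfin} : T \is a fin_num by rewrite ge0_fin_numE// lt_neqAle Tfin leey.
case: T T0 Tge => // t t0 Tge _.
pose p N := fine (P [set w | alive (fusion A w) N]).
have pE N : P [set w | alive (fusion A w) N] = (p N)%:E.
  rewrite /p fineK// fin_num_measure//; exact: measurable_bool_set.
have p0 N : (0 <= p N)%R by rewrite fine_ge0.
have pdec N n : (n <= N)%N -> (p N <= p n)%R.
  move=> nN; rewrite -lee_fin -!pE; apply: le_measure; rewrite ?inE//; try exact: measurable_bool_set.
  by move=> w /=; exact: alive_le.
have main N : (expR b * (1 - p N) <= L%:R * t)%R.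
  have := sr_bound N b0; have := stop_alive A N; rewrite pE.
  set s := \sum_(0 <= n < N) _.
  have s0 : 0 <= s by apply: sume_ge0.
  case: s s0 => // s s0 [] sp.
  have -> : (1 - p N = s)%R by rewrite -sp addrK.
  move=> H; rewrite -lee_fin !EFinM.
  apply: le_trans (le_trans H _); last by apply: lee_wpmul2l => //; exact: Tge.
  rewrite leeDl//; apply: Ex_ge0 => w; by rewrite mulr_ge0.
(* Markov's inequality: [N * P(tau > N)] is at most the sum of [P(tau > n)] over [n < N]. *)
have pt N : (p N * N%:R <= t)%R.
  rewrite -lee_fin; apply: le_trans (Tge N).
  under eq_bigr do rewrite pE.
  rewrite sumEFin lee_fin mulr_natr -[N in (_ *+ N)%R]subn0 -sumr_const_nat.
  by apply: ler_sum_nat => i /andP[_ iN]; apply: pdec; exact: ltnW.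
rewrite lee_fin ler_pdivrMr ?ltr0n// mulrC.
have e0 := expR_gt0 b.
(* The two bounds give [e * N <= expR b * t] for every [N], which fails beyond [expR b * t / e] if
   the gap [e] is positive. *)
rewrite leNgt; apply/negP => lt; pose e := (expR b - L%:R * t)%R.
have ee : (0 < e)%R by rewrite subr_gt0.
have := main (Num.truncn (expR b * t / e)).+1.
have := pt (Num.truncn (expR b * t / e)).+1.
have := truncnS_gt (expR b * t / e).
set N := (_.+1); rewrite ltr_pdivrMr// => H1 H2 H3.
have N0 : (0 < N%:R :> R)%R by rewrite ltr0n.
have : (e * N%:R <= expR b * (p N * N%:R))%R.
  rewrite mulrA ler_pM2r// /e; lra.
have : (expR b * (p N * N%:R) <= expR b * t)%R by rewrite ler_pM2l.
by move: H1; rewrite (mulrC N%:R); lra.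
Qed.

End Process.

(** * Cesaro limits in the renewal equation *)

Section RenewalLimit.
Context {R : realType}.
Implicit Types (a b u : nat -> R) (n N j i : nat).
Local Open Scope ring_scope.

Definition psum a n : R := \sum_(i < n) a i.
Definition conv u a n : R := \sum_(j < n.+1) u j * a (n - j)%N.

Lemma sum_convolution u a N :
  \sum_(n < N) conv u a n = \sum_(j < N) u j * psum a (N - j).
Proof.
elim: N => [|N IH]; first by rewrite !big_ord0.
rewrite big_ord_recr /= IH [RHS]big_ord_recr /= subSnn /conv big_ord_recr /= subnn.
rewrite addrA -big_split /=; congr (_ + _); last by rewrite /psum big_ord1.
apply: eq_bigr => j _; rewrite -mulrDr subSn; last exact: ltnW.
by rewrite /psum big_ord_recr.
Qed.

(** Exchanging the sums leaves [u j * psum a (N - j)]. Replacing each partial sum by its limit [A]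
    costs at most its tail, as [u j <= 1], and the tails vanish in the Cesaro mean. *)
Lemma sum_convolution_approx u a (A : R) N : (forall j, 0 <= u j <= 1) ->
  (forall n, psum a n <= A) ->
  `|(\sum_(j < N) u j) * A - \sum_(n < N) conv u a n| <=
  series (fun i => A - psum a i.+1) N.
Proof.
move=> u01 aA; rewrite sum_convolution big_distrl /= -sumrB.
rewrite (le_trans (ler_norm_sum _ _ _))//.
have step (j : 'I_N) : `|u j * A - u j * psum a (N - j)| <= A - psum a (N - j).
  have /andP[u0 u1] := u01 j; have d0 : 0 <= A - psum a (N - j) by rewrite subr_ge0.
  by rewrite -mulrBr normrM !ger0_norm// ler_piMl.
rewrite (le_trans (ler_sum _ (fun (j : 'I_N) _ => step j)))//.
rewrite /series /= le_eqVlt; apply/orP; left; apply/eqP.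
elim: N {step} => [|N IH]; first by rewrite big_ord0 big_geq.
by rewrite big_ord_recl subn0 big_nat_recr//= -IH addrC.
Qed.

(** Let [U] be the expected number of renewals up to time [n]. Then [U * A] approximates the sum of
    [conv u a], and [U * B] approximates [n.+1], both with errors that are small compared with
    [n]. *)
Lemma renewal_limit u a b (A B : R) : (forall j, 0 <= u j <= 1) ->
  (forall n, psum a n <= A) -> (forall n, psum b n <= B) ->
  psum a @ \oo --> A -> psum b @ \oo --> B -> 0 <= A -> 0 < B ->
  (forall n, conv u b n = 1) ->
  (\sum_(j < n.+1) conv u a j) / n.+1%:R @[n --> \oo] --> A / B.
Proof.
move=> u01 aA bB cA cB A0 B0 ub.
have tail c (C : R) : psum c @ \oo --> C ->
    arithmetic_mean (fun i => C - psum c i.+1) @ \oo --> 0.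
  move=> cC; apply: cesaro; rewrite -[0](subrr C); apply: cvgB; first exact: cvg_cst.
  by rewrite (cvg_shiftS (psum c)).
pose err n := (A * arithmetic_mean (fun i => B - psum b i.+1) n +
               B * arithmetic_mean (fun i => A - psum a i.+1) n) / B.
have err0 : err @ \oo --> 0.
  rewrite -[0](mul0r B^-1) -[0 in X in _ --> X](addr0 0) -[X in (X + _) / _](mulr0 A).
  rewrite -[X in (_ + X) / _](mulr0 B).
  apply: cvgMl; apply: cvgD; apply: cvgMr; exact: tail.
suff key n : `|A / B - (\sum_(j < n.+1) conv u a j) / n.+1%:R| <= err n.
  apply/cvgrPdist_le => e e0; move/cvgrPdist_le : err0 => /(_ _ e0).
  apply: filterS => n; rewrite sub0r normrN => h.
  by apply: le_trans (key n) (le_trans (ler_norm _) h).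
set F := \sum_(j < n.+1) conv u a j; set U := \sum_(j < n.+1) u j.
have n0 : 0 < n.+1%:R :> R by rewrite ltr0n.
have HA := sum_convolution_approx n.+1 u01 aA.
have HB := sum_convolution_approx n.+1 u01 bB.
rewrite -/U -/F in HA; rewrite -/U in HB.
have FB : \sum_(j < n.+1) conv u b j = n.+1%:R.
  by under eq_bigr do rewrite ub; rewrite sumr_const card_ord.
rewrite FB in HB.
(* [U] cancels in the numerator, which leaves only the two approximation errors. *)
have -> : A / B - F / n.+1%:R =
    (B * (U * A - F) - A * (U * B - n.+1%:R)) / (n.+1%:R * B).
  by field; rewrite !gt_eqF.
have nB : 0 < n.+1%:R * B by rewrite mulr_gt0.
rewrite normrM normfV (gtr0_norm nB) ler_pdivrMr//.
have -> : err n * (n.+1%:R * B) = A * series (fun i => B - psum b i.+1) n.+1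
    + B * series (fun i => A - psum a i.+1) n.+1.
  by rewrite /err /arithmetic_mean /=; field; rewrite !gt_eqF.
rewrite (le_trans (ler_normB _ _))// !normrM (ger0_norm A0) (gtr0_norm B0).
by rewrite addrC; apply: lerD; rewrite ler_wpM2l// ltW.
Qed.

Lemma limn_esup_cvg (v : nat -> \bar R) l : v @ \oo --> l -> limn_esup v = l.
Proof. by move=> vl; rewrite limn_esup_lim; apply/cvg_lim => //; exact: cvg_esups. Qed.

End RenewalLimit.

Section Series.
Context {R : realType}.

Lemma psum_cvg (a : nat -> R) (A : R) : (forall n, 0 <= a n)%R ->
  \sum_(0 <= n <oo) (a n)%:E = A%:E ->
  psum a @ \oo --> A /\ forall n, (psum a n <= A)%R.
Proof.
move=> a0 aA; have aE n : \sum_(0 <= i < n) (a i)%:E = (psum a n)%:E.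
  by rewrite sumEFin big_mkord.
split=> [|n]; last first.
  rewrite -lee_fin -aE -aA; apply: nneseries_lim_ge => k _ _.
  by rewrite lee_fin.
have h : (fun n => \sum_(0 <= i < n) (a i)%:E) @ \oo --> A%:E.
  have cv : cvgn (fun n => \sum_(0 <= i < n) (a i)%:E).
    by apply: is_cvg_nneseries => n _ _; rewrite lee_fin.
  by rewrite -aA; exact: cv.
rewrite (_ : psum a = fine \o (fun n => \sum_(0 <= i < n) (a i)%:E)).
  exact: fine_cvg h.
by apply/funext => n /=; rewrite aE.
Qed.

End Series.

(** * Duty cycle and transmission rate as ratios of means *)

Section Renewal.
Context {R : realType} {d : measure_display} {Omega : measurableType d}.
Variables (L : nat) (X : nat -> 'I_L -> {mfun Omega >-> R}).
Variable P : probability Omega R.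
Hypothesis ind : mutually_independent P [set i : nat * 'I_L | (1 <= i.1)%N]
  (fun i => X i.1 i.2).
Variable phi : 'I_L -> R -> R.
Hypothesis mphi : forall l, measurable_fun setT (phi l).
Variables (l : 'I_L) (mu r : R) (h : \bar R) (D : R).
Hypotheses (mu_gt0 : (0 < mu)%R) (h_ge0 : 0 <= h) (hr : h = r%:E).
Hypothesis D_ge0 : (0 <= D)%R.
Hypothesis ident : forall n (B : set R), (1 <= n)%N -> measurable B ->
  P (X n l @^-1` B) = P (X 1%N l @^-1` B).
Variable rho : R.
Hypotheses (rho_ge0 : (0 <= rho)%R) (rho_lt1 : (rho < 1)%R).
Hypothesis half_exp : forall n, (1 <= n)%N ->
  Ex P (fun w => expR (obs X phi l w n / 2))%R <= rho%:E.

Local Notation Z w := (obs X phi l w).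
Local Notation on w i := (alive (fun n => (walk (Z w) n < 0)%R) i).
Local Notation cyc w i := (alive (cycle_end mu h (Z w)) i).

Lemma measurable_obs n : (1 <= n)%N -> measurable_fun setT (fun w => Z w n).
Proof.
by move=> n1; apply: (measurable_past (n := n) (X := X));
  apply: measurable_obs_past => //; rewrite n1 leqnn.
Qed.

Let mon n : measurable_fun setT (fun w => on w n).
Proof.
apply: (@measurable_on _ _ _ (fun k w => Z w k) n) => // k /andP[k1 _].
exact: measurable_obs.
Qed.

Let mcyc n : measurable_fun setT (fun w => cyc w n).
Proof.
apply: (@measurable_cycle _ _ _ mu h h_ge0 (fun k w => Z w k) n) => // k /andP[k1 _].
exact: measurable_obs.
Qed.

Let mwalk n : measurable_fun setT (fun w => walk (Z w) n).
Proof.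
apply: (@measurable_walk _ _ _ (fun k w => Z w k) n) => // k /andP[k1 _].
exact: measurable_obs.
Qed.

Let mdeW n : measurable_fun setT (fun w => deW mu h (Z w) n).
Proof.
apply: (@measurable_deW _ _ _ mu h h_ge0 (fun k w => Z w k) n) => // k /andP[k1 _].
exact: measurable_obs.
Qed.

Lemma Ex_exp_walk n : Ex P (fun w => expR (walk (Z w) n / 2))%R <= (rho ^+ n)%:E.
Proof.
elim: n => [|n IH].
  rewrite (_ : Ex P _ = Ex P (fun=> 1%R)); first by rewrite Ex_cst.
  by apply: eq_Ex => w; rewrite walk0 mul0r expR0.
rewrite (_ : Ex P _ =
  Ex P (fun w => expR (walk (Z w) n / 2) * expR (Z w n.+1 / 2))%R); last first.
  by apply: eq_Ex => w; rewrite walkS mulrDl expRD.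
rewrite (@Ex_mul_indep _ _ _ _ _ _ ind _ mphi n n.+1 l
  (fun w => expR (walk (Z w) n / 2)%R) (fun x => expR (x / 2)%R))//.
- rewrite exprSr EFinM; apply: lee_pmul.
  + by apply: Ex_ge0 => w; exact: expR_ge0.
  + by apply: Ex_ge0 => w; exact: expR_ge0.
  + exact: IH.
  + exact: half_exp.
- apply: measurableT_comp => //; apply: measurable_funM; last exact: measurable_cst.
  apply: (@measurable_walk _ _ (g_sigma_algebraType (gens X n)) (fun k w => Z w k) n) => // k kn.
  exact: measurable_obs_past.
- by apply: measurableT_comp => //; apply: measurable_funM => //; exact: measurable_cst.
Qed.

(** Chernoff bound with exponent 1/2: on this event the walk is nonnegative. *)
Lemma prob_on_le n : P [set w | on w n] <= (rho ^+ n)%:E.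
Proof.
rewrite -Ex_bool//; apply: le_trans (Ex_exp_walk n); apply: Ex_le.
- exact: measurable_bool_natr.
- apply: measurableT_comp => //; apply: measurable_funM => //; exact: measurable_cst.
- by move=> w.
- move=> w; case: (boolP (on w n)) => [/on_walk_ge0 w0|_] /=; last exact: expR_ge0.
  by rewrite -expR0 ler_expR divr_ge0.
Qed.

Let pon n := fine (P [set w | on w n]).
Let pcyc n := fine (P [set w | cyc w n]).
Let pabove n := fine (P [set w | on w n && (D < walk (Z w) n)%R]).
Let pren n := fine (P [set w | renewal mu h (Z w) n]).

Let finP A : measurable A -> (fine (P A))%:E = P A.
Proof. by move=> mA; rewrite fineK// fin_num_measure. Qed.

Let mabove n : measurable_fun setT (fun w => on w n && (D < walk (Z w) n)%R).
Proof.
apply: measurable_and => //; apply: measurable_fun_ltr => //; exact: measurable_cst.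
Qed.

Lemma mean_ladder_time :
  \int[P]_w ladder_time (Z w) = \sum_(0 <= n <oo) (pon n)%:E.
Proof.
rewrite Ex_first_time; last first.
  by move=> k _; apply: measurable_fun_ltr => //; exact: measurable_cst.
apply: eq_eseriesr => n _; rewrite Ex_bool// /pon finP//; exact: measurable_bool_set.
Qed.

Lemma mean_ladder_time_fin : \int[P]_w ladder_time (Z w) \is a fin_num.
Proof.
rewrite mean_ladder_time ge0_fin_numE; last first.
  by apply: nneseries_ge0 => n _ _; rewrite lee_fin fine_ge0.
apply: (@le_lt_trans _ _ ((1 - rho)^-1)%:E); last exact: ltry.
apply: lime_le.
  by apply: is_cvg_nneseries => n _ _; rewrite lee_fin fine_ge0.
apply: nearW => n.
apply: (@le_trans _ _ (\sum_(0 <= i < n) (rho ^+ i)%:E)).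
  by apply: lee_sum => i _; rewrite /pon finP ?prob_on_le//; exact: measurable_bool_set.
rewrite sumEFin lee_fin big_mkord.
have d0 : (0 < 1 - rho)%R by rewrite subr_gt0.
rewrite -(ler_pM2l d0) -opprB mulNr -subrX1 divff ?gt_eqF// opprB.
  by rewrite gerBl exprn_ge0.
exact: d0.
Qed.

(** [off_time] reads the walk at a random time; this series of adapted indicators gives its
    measurability and its mean. It is [cycle_length] minus the ladder time. *)
Lemma off_timeE w : (off_time mu h (Z w))%:E =
  \sum_(0 <= n <oo) (cyc w n && ~~ on w n)%:R%:E.
Proof.
have := @cycle_length _ mu h mu_gt0 h_ge0 (Z w).
have cE n : (cyc w n)%:R%:E = (on w n)%:R%:E + (cyc w n && ~~ on w n)%:R%:E :> \bar R.
  rewrite -EFinD -natrD; congr (_%:R%:E).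
  by have := @cycle_on _ mu h h_ge0 (Z w) n; case: (alive _ _); case: (alive _ _); rewrite //= andbF.
under eq_eseriesr do rewrite cE.
rewrite nneseriesD//; try by move=> n _ _; rewrite lee_fin.
rewrite -first_timeE -/(ladder_time (Z w)).
have [[m [N [-> _ _ _ _]]]|[lt -> _]] := @ladder_cycle _ mu h mu_gt0 h_ge0 (Z w).
  by move/(congr1 (fun x => x - m%:R%:E)); rewrite addeAC subee// add0e addeAC subee// add0e.
(* An infinite ladder time cannot be subtracted, but then the walk stays nonnegative and every term
   is 0. *)
move=> _; rewrite eseries0// => n _ _.
have -> : on w n by rewrite -(@lt_first_time R) -/(ladder_time (Z w)) lt ltry.
by rewrite andbF.
Qed.

Lemma measurable_off_time : measurable_fun setT (fun w => (off_time mu h (Z w))%:E).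
Proof.
rewrite (_ : (fun w => _) = fun w => \sum_(0 <= n <oo) (cyc w n && ~~ on w n)%:R%:E).
  apply: ge0_emeasurable_sum => [n w _ _|n _]; first by rewrite lee_fin.
  apply/measurable_EFinP; apply: measurable_bool_natr.
  by apply: measurable_and => //; exact: measurable_neg.
by apply/funext => w; exact: off_timeE.
Qed.

Lemma mean_off_time_fin : \int[P]_w (off_time mu h (Z w))%:E \is a fin_num.
Proof.
rewrite ge0_fin_numE; last first.
  by apply: integral_ge0 => w _; rewrite lee_fin; exact: off_time_ge0.
apply: (@le_lt_trans _ _ (\int[P]_w (r / mu + 1)%:E)).
  apply: ge0_le_integral => //.
  - by move=> w _; rewrite lee_fin; exact: off_time_ge0.
  - exact: measurable_off_time.
  - by move=> w _; rewrite lee_fin; exact: off_time_le.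
by rewrite -/(Ex P (fun=> (r / mu + 1)%R)) Ex_cst ltry.
Qed.

Lemma mean_cycle_length : \sum_(0 <= n <oo) (pcyc n)%:E =
  \int[P]_w ladder_time (Z w) + \int[P]_w (off_time mu h (Z w))%:E.
Proof.
have -> : \int[P]_w (off_time mu h (Z w))%:E =
    \sum_(0 <= n <oo) P [set w | cyc w n && ~~ on w n].
  under eq_integral do rewrite off_timeE.
  have mco n : measurable_fun setT (fun w => cyc w n && ~~ on w n).
    by apply: measurable_and => //; exact: measurable_neg.
  rewrite integral_nneseries//.
    by apply: eq_eseriesr => n _; rewrite integral_bool.
  by move=> n; apply/measurable_EFinP; exact: measurable_bool_natr.
rewrite mean_ladder_time -nneseriesD//; last 1 first.
  by move=> n _ _; rewrite lee_fin fine_ge0.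
apply: eq_eseriesr => n _; rewrite /pcyc /pon !finP; try exact: measurable_bool_set.
have mco : measurable_fun setT (fun w => cyc w n && ~~ on w n).
  by apply: measurable_and => //; exact: measurable_neg.
rewrite -!Ex_bool// -ExD//; try exact: measurable_bool_natr.
apply: eq_Ex => w; rewrite -natrD; congr (_%:R)%R.
by have := @cycle_on _ mu h h_ge0 (Z w) n; case: (alive _ _); case: (alive _ _); rewrite //= andbF.
Qed.

Let past_renewal j : past X j [set w | renewal mu h (Z w) j].
Proof.
apply: (@measurable_bool_set _ (g_sigma_algebraType (gens X j))).
case: j => [|j]; first exact: measurable_cst.
have mz k (kj : (1 <= k <= j.+1)%N) := @measurable_obs_past _ _ _ _ X _ mphi j.+1 l k kj.
exact: (@measurable_cycle_end _ _ (g_sigma_algebraType (gens X j.+1)) mu h h_ge0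
  (fun k w => Z w k) j.+1 mz j.+1 (leqnn _)).
Qed.

(** A renewal at [j] belongs to the past at [j], and [g] reads only the path after [j]. By
    [shift_law] each term of the pathwise decomposition factors, and the probabilities form a
    convolution. *)
Lemma prob_renewal_sum (g : nat -> (nat -> R) -> bool) (p : nat -> R)
    (f : Omega -> bool) n :
  (forall i, measurable_fun setT (g i : pathT R -> bool)) ->
  (forall i, p i = fine (P [set w | g i (Z w)])) ->
  measurable_fun setT f ->
  (forall w, (f w : nat) = (\sum_(j < n.+1)
    (renewal mu h (Z w) j && g (n - j) (shift j (Z w))))%N) ->
  P [set w | f w] = (conv pren p n)%:E.
Proof.
move=> mg pE mf fE.
have mpre j : measurable_fun setT (fun w => g (n - j)%N (shift j (Z w))).
  have := measurable_path_shift X l (mphi l) j => mpath.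
  exact: (measurableT_comp (mg (n - j)%N) mpath).
have mren j : measurable_fun setT (fun w => renewal mu h (Z w) j).
  case: j => [|j]; first exact: measurable_cst.
  have mz k (kj : (1 <= k <= j.+1)%N) : measurable_fun setT (fun w => Z w k).
    by apply: measurable_obs; case/andP: kj.
  exact: (@measurable_cycle_end _ _ _ mu h h_ge0 (fun k w => Z w k) j.+1 mz j.+1 (leqnn _)).
have mand j : measurable_fun setT
    (fun w => renewal mu h (Z w) j && g (n - j)%N (shift j (Z w))).
  exact: measurable_and.
rewrite -Ex_bool// (_ : Ex P _ = Ex P (fun w => \sum_(j < n.+1)
   (renewal mu h (Z w) j && g (n - j)%N (shift j (Z w)))%:R)%R); last first.
  by apply: eq_Ex => w; rewrite fE natr_sum.
rewrite Ex_sum//; last by move=> j; exact: measurable_bool_natr.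
rewrite /conv -sumEFin; apply: eq_bigr => j _.
rewrite Ex_bool// EFinM /pren finP; last exact: measurable_bool_set.
have mgj : measurable [set z : pathT R | g (n - j)%N z] by exact: measurable_bool_set.
rewrite (_ : [set w | _ && _] = [set w | renewal mu h (Z w) j] `&`
    (fun w => shift j (Z w)) @^-1` [set z | g (n - j)%N z]); last first.
  by apply/seteqP; split => w /= /andP.
rewrite pE finP; first exact: (shift_law ind (mphi l) ident (@past_renewal j) mgj).
have mpath := measurable_path_shift X l (mphi l) 0%N.
by apply: measurable_bool_set; exact: (measurableT_comp (mg (n - j)%N) mpath).
Qed.

Let mcoord k m : (1 <= k <= m)%N -> measurable_fun setT (fun z : pathT R => z k).
Proof. by move=> /andP[k1 _]; exact: measurable_coord. Qed.

Let mg_on i : measurable_fun setT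
  ((fun z => alive (fun n => (walk z n < 0)%R) i) : pathT R -> bool).
Proof. by apply: (@measurable_on _ _ (pathT R) (fun k z => z k) i) => // k; exact: mcoord. Qed.

Let mg_cyc i : measurable_fun setT
  ((fun z => alive (cycle_end mu h z) i) : pathT R -> bool).
Proof. by apply: (@measurable_cycle _ _ (pathT R) mu h h_ge0 (fun k z => z k) i) => // k; exact: mcoord. Qed.

Let mg_above i : measurable_fun setT
  ((fun z => alive (fun n => (walk z n < 0)%R) i && (D < walk z i)%R) : pathT R -> bool).
Proof.
apply: measurable_and => //; apply: measurable_fun_ltr; first exact: measurable_cst.
by apply: (@measurable_walk _ _ (pathT R) (fun k z => z k) i) => // k; exact: mcoord.
Qed.

Let conv_cyc n : conv pren pcyc n = 1%R.
Proof.
apply: EFin_inj; rewrite -(@prob_renewal_sum _ _ (fun=> true) n mg_cyc)//.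
  by rewrite (_ : [set w | _] = setT) ?probability_setT//; apply/seteqP; split.
by move=> w; rewrite /= (@sum_renewal _ mu h h_ge0).
Qed.

Lemma prob_deW_ge0 n : P [set w | (0 <= deW mu h (Z w) n)%R] = (conv pren pon n)%:E.
Proof.
apply: (prob_renewal_sum mg_on) => // [|w].
  by apply: measurable_fun_ler => //; exact: measurable_cst.
exact: sum_renewal_on.
Qed.

Lemma prob_deW_gt n : P [set w | (D < deW mu h (Z w) n)%R] = (conv pren pabove n)%:E.
Proof.
apply: (prob_renewal_sum mg_above) => // [|w].
  by apply: measurable_fun_ltr => //; exact: measurable_cst.
exact: sum_renewal_above.
Qed.

Lemma mean_ladder_count :
  \int[P]_w ladder_count D (Z w) = \sum_(0 <= n <oo) (pabove n)%:E.
Proof.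
have E w : ladder_count D (Z w) =
    \sum_(0 <= n <oo) (on w n && (D < walk (Z w) n)%R)%:R%:E.
  rewrite [RHS](nneseries_split 0 1); last by move=> k _; rewrite lee_fin.
  (* [ladder_count] starts at 1; the term [n = 0] is added for free, as [walk] is 0 there and
     [D >= 0]. *)
  rewrite big_nat1 walk0 ltNge D_ge0 andbF add0e.
  by apply: eq_eseriesr => n _; rewrite lt_first_time.
under eq_integral do rewrite E.
rewrite integral_nneseries//.
  by apply: eq_eseriesr => n _; rewrite integral_bool// /pabove finP//; exact: measurable_bool_set.
by move=> n; apply/measurable_EFinP; exact: measurable_bool_natr.
Qed.

Lemma mean_ladder_count_fin : \int[P]_w ladder_count D (Z w) \is a fin_num.
Proof.
have := mean_ladder_time_fin; rewrite mean_ladder_time mean_ladder_count.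
rewrite !ge0_fin_numE; try by apply: nneseries_ge0 => n _ _; rewrite lee_fin fine_ge0.
apply: le_lt_trans; apply: lee_nneseries => n _; first by rewrite lee_fin fine_ge0.
rewrite /pabove /pon !finP; try exact: measurable_bool_set.
apply: le_measure; rewrite ?inE; try exact: measurable_bool_set.
by move=> w /= /andP[].
Qed.

Lemma renewal_ratio (p : nat -> R) : (forall n, 0 <= p n)%R ->
  \sum_(0 <= n <oo) (p n)%:E \is a fin_num ->
  exists lim : R, [/\ (\sum_(0 <= n <oo) (p n)%:E) /
     (\int[P]_w ladder_time (Z w) + 'E_P[fun w => off_time mu h (Z w)]) = lim%:E &
     ((\sum_(j < n.+1) conv pren p j) / n.+1%:R)%R @[n --> \oo] --> lim].
Proof.
move=> p0 pfin.
rewrite (_ : 'E_P[_] = \int[P]_w (off_time mu h (Z w))%:E); last by rewrite unlock.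
rewrite -mean_cycle_length.
have cfin : \sum_(0 <= n <oo) (pcyc n)%:E \is a fin_num.
  by rewrite mean_cycle_length fin_numD mean_ladder_time_fin mean_off_time_fin.
have c0 n : (0 <= pcyc n)%R by rewrite fine_ge0.
have [A eA] : exists A : R, \sum_(0 <= n <oo) (p n)%:E = A%:E.
  by exists (fine (\sum_(0 <= n <oo) (p n)%:E)); rewrite fineK.
have [B eB] : exists B : R, \sum_(0 <= n <oo) (pcyc n)%:E = B%:E.
  by exists (fine (\sum_(0 <= n <oo) (pcyc n)%:E)); rewrite fineK.
have A0 : (0 <= A)%R.
  by rewrite -lee_fin -eA; apply: nneseries_ge0 => n _ _; rewrite lee_fin.
rewrite eA eB.
have [pA leA] := psum_cvg p0 eA; have [pB leB] := psum_cvg c0 eB.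
(* Every cycle survives time 0, so the mean cycle length is at least 1 and can be divided by. *)
have B1 : (1 <= B)%R.
  apply: le_trans (leB 1%N); rewrite /psum big_ord1 /pcyc.
  by rewrite (_ : [set w | _] = setT) ?probability_setT//; apply/seteqP; split.
have B0 : (0 < B)%R := lt_le_trans ltr01 B1.
exists (A / B)%R; split; first by rewrite inver gt_eqF.
apply: (renewal_limit _ leA leB) => // j.
rewrite fine_ge0//= -lee_fin finP; first exact/probability_le1/(past_measurable (@past_renewal j)).
exact: (past_measurable (@past_renewal j)).
Qed.

Let cvg_ratio (v : nat -> \bar R) (x : nat -> R) lim :
  (forall n, v n.+1 = (x n)%:E) -> x @ \oo --> lim -> limn_esup v = lim%:E.
Proof.
move=> vx xl; apply: limn_esup_cvg; rewrite -cvg_shiftS.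
rewrite (_ : (fun n => v n.+1) = EFin \o x); last by apply/funext => n; exact: vx.
by apply: cvg_EFin => //; exact: nearW.
Qed.

Let Ex_count (b : nat -> Omega -> bool) m g :
  (forall k, measurable_fun setT (b k)) ->
  'E_P[fun w => (\sum_(m <= k < g) (b k w)%:R)%R] =
  \sum_(m <= k < g) P [set w | b k w].
Proof.
move=> mb; rewrite unlock -[LHS]/(Ex P (fun w => \sum_(m <= k < g) (b k w)%:R)%R).
rewrite Ex_sum//; last by move=> k; exact: measurable_bool_natr.
by apply: eq_bigr => k _; rewrite Ex_bool.
Qed.

Lemma PTC_renewal : PTC P (fun n w => deT mu h D (Z w) n) =
  (\int[P]_w ladder_count D (Z w)) /
  (\int[P]_w ladder_time (Z w) + 'E_P[fun w => off_time mu h (Z w)]).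
Proof.
have [||lim [e lime]] := @renewal_ratio pabove.
- by move=> n; rewrite fine_ge0.
- by rewrite -mean_ladder_count mean_ladder_count_fin.
rewrite mean_ladder_count e; apply: cvg_ratio lime => n /=.
rewrite Ex_count; last first.
  by move=> k; apply: measurable_fun_ltr => //; exact: measurable_cst.
rewrite (eq_bigr _ (fun k _ => prob_deW_gt k)).
rewrite sumEFin -EFinM mulrC; congr (_ / _)%:E.
(* The sum of [deT] starts at [k = 1]; the missing term [k = 0] is 0, since the statistic starts at
   [0 <= D]. *)
rewrite -(big_mkord xpredT (conv pren pabove)) [RHS]big_ltn//.
rewrite (_ : conv pren pabove 0 = 0%R) ?add0r//.
apply: EFin_inj; rewrite -prob_deW_gt (_ : [set w | _] = set0) ?measure0//.
by apply/seteqP; split => // w /=; rewrite ltNge D_ge0.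
Qed.

Lemma PDC_renewal : PDC P (fun n w => deS mu h (Z w) n) =
  (\int[P]_w ladder_time (Z w)) /
  (\int[P]_w ladder_time (Z w) + 'E_P[fun w => off_time mu h (Z w)]).
Proof.
have [||lim [e lime]] := @renewal_ratio pon.
- by move=> n; rewrite fine_ge0.
- by rewrite -mean_ladder_time mean_ladder_time_fin.
rewrite [X in _ = X / _]mean_ladder_time e.
have c01 n : (0 <= conv pren pon n <= 1)%R.
  have mW : measurable [set w | (0 <= deW mu h (Z w) n)%R].
    by apply: measurable_bool_set; apply: measurable_fun_ler => //; exact: measurable_cst.
  by rewrite -!lee_fin -prob_deW_ge0 measure_ge0 probability_le1.
have c0 : (fun n => conv pren pon n / n.+1%:R)%R @ \oo --> (0 : R)%R.
  apply: (@squeeze_cvgr _ _ _ _ (cst 0%R) harmonic).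
  - apply: nearW => n /=; have /andP[n0 n1] := c01 n.
    by rewrite divr_ge0//= ler_piMl ?invr_ge0.
  - exact: cvg_cst.
  - exact: cvg_harmonic.
(* [deS] at [k] looks at time [k.-1], so for [g = n.+1] the sum runs over [j < n] but is divided by
   [n.+1]: one term fewer than in the Cesaro mean, negligible in the limit. *)
have lim2 : (fun n => (\sum_(j < n) conv pren pon j) / n.+1%:R)%R @ \oo --> lim.
  rewrite (_ : (fun n => _) = (fun n => (\sum_(j < n.+1) conv pren pon j) / n.+1%:R -
     conv pren pon n / n.+1%:R)%R).
    by rewrite -[lim]subr0; exact: cvgB.
  by apply/funext => n; rewrite big_ord_recr /= mulrDl addrK.
apply: cvg_ratio lim2 => n /=.
rewrite Ex_count; last first.
  by move=> k; apply: measurable_fun_ler => //; exact: measurable_cst.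
rewrite big_add1 /= (eq_bigr _ (fun k _ => prob_deW_ge0 k)).
by rewrite sumEFin -EFinM mulrC big_mkord.
Qed.

End Renewal.

Lemma limf_esup_le {R : realType} (T : choiceType) (U : filteredType T)
  (F : set_system U) (v : U -> \bar R) (x : \bar R) :
  (forall e : R, (0 < e)%R -> F [set t | v t <= x + e%:E]) ->
  limf_esup v F <= x.
Proof.
move=> h; apply/lee_addgt0Pr => e e0.
apply: (@le_trans _ _ (ereal_sup (v @` [set t | v t <= x + e%:E]))).
  apply: ereal_inf_lbound; exists [set t | v t <= x + e%:E] => //; exact: h.
by apply: ge_ereal_sup => _ [t /= vt <-].
Qed.

(** * Duty cycle for [h = +oo] *)

Section Untruncated.
Context {R : realType} {d : measure_display} {Omega : measurableType d}.
Variables (L : nat) (X : nat -> 'I_L -> {mfun Omega >-> R}).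
Variable P : probability Omega R.
Hypothesis ind : mutually_independent P [set i : nat * 'I_L | (1 <= i.1)%N]
  (fun i => X i.1 i.2).
Variable phi : 'I_L -> R -> R.
Hypothesis mphi : forall l, measurable_fun setT (phi l).
Variables (l : 'I_L) (mu : R).
Hypotheses (mu_gt0 : (0 < mu)%R).
Variables p q s : R.
Local Notation Z w := (obs X phi l w).
Hypothesis mean_pos : forall n, (1 <= n)%N ->
  Ex P (fun w => Num.max (Z w n) 0%R) = p%:E.
Hypothesis mean_neg : forall n, (1 <= n)%N ->
  Ex P (fun w => Num.max (- Z w n)%R 0%R) = q%:E.
Hypothesis mean_sq : forall n, (1 <= n)%N ->
  Ex P (fun w => Z w n ^+ 2)%R = s%:E.
Hypothesis pq : (p < q)%R.

Local Notation W w n := (deW mu +oo (Z w) n).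
Local Notation S w n := ((0 <= W w n)%R : bool).

Let oo_ge0 : 0 <= +oo :> \bar R. Proof. by []. Qed.

Let mW n : measurable_fun setT (fun w => W w n).
Proof.
apply: (@measurable_deW _ _ _ mu +oo oo_ge0 (fun k w => Z w k) n) => // k /andP[k1 _].
exact: measurable_obs.
Qed.

(** The upper bound on [W] from its increments and the lower bound [deW_ge_sq], rearranged so that
    all terms on both sides are nonnegative and expectations can be taken termwise. *)
Let path_bound c w n : (0 < c)%R ->
  (\sum_(k < n) ((S w k)%:R * Num.max (- Z w k.+1) 0 + mu * (S w k)%:R)
   <= \sum_(k < n) ((S w k)%:R * Num.max (Z w k.+1) 0 + (mu + c^-1 * Z w k.+1 ^+ 2))
      + c)%R.
Proof.
move=> c0; have h0 := oo_ge0.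
suff up : (W w n + \sum_(k < n) ((S w k)%:R * Num.max (- Z w k.+1) 0 + mu * (S w k)%:R)
   <= \sum_(k < n) ((S w k)%:R * Num.max (Z w k.+1) 0 + mu))%R.
  have low := @deW_ge_sq _ mu +oo mu_gt0 h0 c (Z w) n c0.
  rewrite big_add1 /= big_mkord in low.
  have E : (\sum_(k < n) ((S w k)%:R * Num.max (Z w k.+1) 0 + (mu + c^-1 * Z w k.+1 ^+ 2))
    = \sum_(k < n) ((S w k)%:R * Num.max (Z w k.+1) 0 + mu) +
      \sum_(k < n) (Z w k.+1 ^+ 2 / c))%R.
    by rewrite -big_split /=; apply: eq_bigr => k _; rewrite addrA (mulrC c^-1%R).
  rewrite E; move: up low.
  move: (\sum_(k < n) _)%R (\sum_(k < n) _)%R (\sum_(k < n) _)%R (W w n) => x y t u.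
  by move=> ? ?; lra.
elim: n => [|n IH]; first by rewrite !big_ord0 addr0.
rewrite !big_ord_recr /= -/(W w n).
set x := (\sum_(k < n) _)%R in IH *; set y := (\sum_(k < n) _)%R in IH *.
have m0 := mu_gt0.
have Zmax : (Num.max (Z w n.+1) 0 - Num.max (- Z w n.+1) 0 = Z w n.+1)%R.
  case: (leP (Z w n.+1) 0%R) => z0.
    by rewrite max_l ?oppr_ge0// sub0r opprK.
  by rewrite max_r ?subr0// oppr_le0 ltW.
case: (boolP (0 <= W w n)%R) => Wn /=.
  have -> : trunc +oo (W w n + Z w n.+1) = (W w n + Z w n.+1)%R.
    by rewrite /trunc max_l ?leNye.
  rewrite !mul1r mulr1; move: Zmax IH; set a := Num.max (Z w n.+1) _.
  set b := Num.max (- Z w n.+1)%R _; move: (W w n) a b => u a b <- ?.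
  by lra.
have : (Num.min (W w n + mu) 0 <= W w n + mu)%R by rewrite ge_min lexx.
move: IH; set v := Num.min (W w n + mu)%R 0%R; move: v (W w n) => v u; rewrite !mul0r mulr0 ?addr0 ?add0r => ? ?.
by lra.
Qed.

Let prob_on k := fine (P [set w | S w k]).

Let mS k : measurable_fun setT (fun w => S w k).
Proof. by apply: measurable_fun_ler => //; exact: measurable_cst. Qed.

Let prob_onE k : Ex P (fun w => (S w k)%:R%R) = (prob_on k)%:E.
Proof.
by rewrite Ex_bool// /prob_on fineK// fin_num_measure//; exact: measurable_bool_set.
Qed.

Let Ex_S k (psi : R -> R) (m : R) : measurable_fun setT psi ->
  (forall x, 0 <= psi x)%R -> Ex P (fun w => psi (Z w k.+1)) = m%:E ->
  Ex P (fun w => (S w k)%:R * psi (Z w k.+1))%R = (prob_on k * m)%:E.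
Proof.
move=> mpsi psi0 Em; rewrite EFinM -prob_onE -Em.
apply: (@Ex_mul_indep _ _ _ _ _ _ ind _ mphi k k.+1 l (fun w => (S w k)%:R%R) psi) => //.
apply: measurable_bool_natr; apply: measurable_fun_ler; first exact: measurable_cst.
have mz j (jk : (1 <= j <= k)%N) := @measurable_obs_past _ _ _ _ X _ mphi k l j jk.
exact: (@measurable_deW _ _ (g_sigma_algebraType (gens X k)) mu +oo oo_ge0
  (fun k w => Z w k) k mz k (leqnn _)).
Qed.

Let mpos : measurable_fun setT (fun x : R => Num.max x 0%R).
Proof. by apply: measurable_maxr => //; exact: measurable_cst. Qed.

Let mneg : measurable_fun setT (fun x : R => Num.max (- x)%R 0%R).
Proof.
apply: measurable_maxr; last exact: measurable_cst.
exact: measurable_funN.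
Qed.

Lemma sum_prob_on_le c n : (0 < c)%R ->
  ((\sum_(k < n) prob_on k) * (mu + (q - p)) <= n%:R * (mu + s / c) + c)%R.
Proof.
move=> c0; have m0 : (0 <= mu)%R := ltW mu_gt0; have c0' : (0 <= c^-1)%R by rewrite invr_ge0 ltW.
have mZ k : measurable_fun setT (fun w => Z w k.+1) by exact: measurable_obs.
have mSn k : measurable_fun setT (fun w => (S w k)%:R : R) by exact: measurable_bool_natr.
pose f1 k w := ((S w k)%:R * Num.max (- Z w k.+1) 0)%R.
pose f2 k w := (mu * (S w k)%:R)%R.
pose f3 k w := ((S w k)%:R * Num.max (Z w k.+1) 0)%R.
pose f4 k w := (c^-1 * Z w k.+1 ^+ 2)%R.
have mf1 k : measurable_fun setT (f1 k).
  by apply: measurable_funM => //; exact: measurableT_comp mneg (mZ k).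
have mf2 k : measurable_fun setT (f2 k).
  by apply: measurable_funM => //; exact: measurable_cst.
have mf3 k : measurable_fun setT (f3 k).
  by apply: measurable_funM => //; exact: measurableT_comp mpos (mZ k).
have mf4 k : measurable_fun setT (f4 k).
  by apply: measurable_funM; [exact: measurable_cst|exact: measurable_funX].
have p1 k w : (0 <= f1 k w)%R by rewrite mulr_ge0// le_max lexx orbT.
have p2 k w : (0 <= f2 k w)%R by rewrite mulr_ge0.
have p3 k w : (0 <= f3 k w)%R by rewrite mulr_ge0// le_max lexx orbT.
have p4 k w : (0 <= f4 k w)%R by rewrite mulr_ge0// sqr_ge0.
have mc : measurable_fun setT (fun _ : Omega => c) by exact: measurable_cst.
have mm : measurable_fun setT (fun _ : Omega => mu) by exact: measurable_cst.
have m12 k : measurable_fun setT (fun w => f1 k w + f2 k w)%R by exact: measurable_funD.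
have m4m k : measurable_fun setT (fun w => mu + f4 k w)%R by exact: measurable_funD.
have m34 k : measurable_fun setT (fun w => f3 k w + (mu + f4 k w))%R by exact: measurable_funD.
have p34 k w : (0 <= f3 k w + (mu + f4 k w))%R by rewrite !addr_ge0.
have : Ex P (fun w => \sum_(k < n) (f1 k w + f2 k w))%R <=
    Ex P (fun w => \sum_(k < n) (f3 k w + (mu + f4 k w)) + c)%R.
  apply: Ex_le.
  - exact: measurable_sum.
  - by apply: measurable_funD => //; exact: measurable_sum.
  - by move=> w; apply: sumr_ge0 => k _; rewrite addr_ge0.
  - by move=> w; exact: path_bound.
rewrite ExD//; last 3 first.
- exact: measurable_sum.
- by move=> w; apply: sumr_ge0.
- by move=> _; exact: ltW.
rewrite Ex_cst !Ex_sum//; last by move=> k w; rewrite addr_ge0.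
under eq_bigr => k _.
  rewrite ExD// (@Ex_S k (fun x => Num.max (- x) 0)%R q)//; last 2 first.
  - by move=> x; rewrite le_max lexx orbT.
  - exact: mean_neg.
  rewrite ExZ// prob_onE -EFinM -EFinD -mulrC.
  over.
under [X in _ <= X + _]eq_bigr => k _.
  rewrite ExD//; last by move=> w; rewrite addr_ge0.
  rewrite (@Ex_S k (fun x => Num.max x 0)%R p)//; last 2 first.
  - by move=> x; rewrite le_max lexx orbT.
  - exact: mean_pos.
  rewrite ExD// Ex_cst ExZ//; last 2 first.
  - exact: measurable_funX.
  - by move=> w; rewrite sqr_ge0.
  rewrite mean_sq// -!EFinM -!EFinD.
  over.
rewrite !sumEFin -EFinD lee_fin.
rewrite (_ : (\sum_(k < n) (_ + (_ + _)))%R =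
   ((\sum_(k < n) prob_on k) * p + n%:R * (mu + s / c))%R); last first.
  by rewrite big_split /= big_distrl /= sumr_const card_ord mulr_natl (mulrC s).
rewrite (_ : (\sum_(k < n) (_ + _))%R = ((\sum_(k < n) prob_on k) * (mu + q))%R); last first.
  by rewrite big_distrl /=; apply: eq_bigr => k _; ring.
by set x := (\sum_(k < n) prob_on k)%R => ?; lra.
Qed.

Lemma PDC_untruncated : PDC P (fun n w => deS mu +oo (Z w) n) <=
  (mu / (mu + (q - p)))%:E.
Proof.
have m0 := mu_gt0; have pq0 := pq.
have d0 : (0 < mu + (q - p))%R by lra.
have s0 : (0 <= s)%R.
  by rewrite -lee_fin -(mean_sq (leqnn 1)); apply: Ex_ge0 => w; rewrite sqr_ge0.
apply: limf_esup_le => e e0.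
(* [c] makes [s / c] at most [t], and [g >= c / t] makes [c / g] at most [t]. The two losses sum to
   [2 t], which is [e] after division by [mu + (q - p)]. The 1 added to [s] keeps [c] positive. *)
pose t := (e * (mu + (q - p)) / 2)%R.
have t0 : (0 < t)%R by rewrite divr_gt0// mulr_gt0.
pose c := ((s + 1) / t)%R.
have c0 : (0 < c)%R by rewrite divr_gt0// ltr_wpDl.
have sc : (s / c <= t)%R.
  rewrite ler_pdivrMr// /c mulrCA mulfV ?gt_eqF// mulr1; lra.
suff H : \forall g \near \oo, g%:R^-1%:E *
    'E_P[fun w => (\sum_(1 <= k < g) (deS mu +oo (Z w) k)%:R)%R] <=
    (mu / (mu + (q - p)))%:E + e%:E by exact: H.
exists (Num.truncn (c / t)).+1 => // g /= gN.
have g0 : (0 < g%:R :> R)%R by rewrite ltr0n (leq_trans _ gN).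
have cg : (c <= t * g%:R)%R.
  rewrite mulrC -ler_pdivrMr// (le_trans (ltW (truncnS_gt _)))// ler_nat.
  exact: gN.
have -> : 'E_P[fun w => (\sum_(1 <= k < g) (deS mu +oo (Z w) k)%:R)%R] =
    (\sum_(k < g.-1) prob_on k)%:E.
  rewrite unlock -[LHS]/(Ex P (fun w => \sum_(1 <= k < g) (deS mu +oo (Z w) k)%:R)%R).
  rewrite Ex_sum//; last by move=> k; apply: measurable_bool_natr; exact: (mS k.-1).
  rewrite big_add1 /= big_mkord -sumEFin; apply: eq_bigr => k _.
  exact: prob_onE.
rewrite -EFinM -EFinD lee_fin mulrC ler_pdivrMr//.
have := sum_prob_on_le g.-1 c0; set x := (\sum_(k < g.-1) prob_on k)%R => H.
rewrite -(ler_pM2r d0) (le_trans H)//.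
have -> : ((mu / (mu + (q - p)) + e) * g%:R * (mu + (q - p)) =
  g%:R * (mu + t) + t * g%:R)%R.
  by rewrite /t; field; exact: lt0r_neq0.
apply: lerD => //; apply: ler_pM => //.
- by apply: addr_ge0; [exact: ltW|apply: divr_ge0 => //; exact: ltW].
- by rewrite ler_nat leq_pred.
- by rewrite lerD2l.
Qed.

End Untruncated.

(** * A Lyapunov function for the off-steps after the change *)

Section Lyapunov.
Context {R : realType}.
Variables (mu r rho : R).
Hypotheses (mu_gt0 : (0 < mu)%R) (r_ge0 : (0 <= r)%R)
  (rho_ge0 : (0 <= rho)%R) (rho_lt1 : (rho < 1)%R).
Local Open Scope ring_scope.

(* [lyap_a] and [lyap_b] are chosen so that [(lyap_a + lyap_b) * rho = lyap_a]. *)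
Definition lyap_b := 1 + r / mu.
Definition lyap_a := lyap_b * rho / (1 - rho).
(** Below 0, [- w / mu] is the remaining off time up to rounding, so each off-step lowers the
    function by 1; the additional 1 pays for the last, capped step, which lands at 0 with value
    [lyap_a]. Above 0, the exponential measures the risk of going off again. *)
Definition lyap w := if 0 <= w then lyap_a * expR (- w / 2)
                     else lyap_a + 1 - w / mu.

Lemma lyap_b_ge0 : 0 <= lyap_b.
Proof. by rewrite addr_ge0// divr_ge0// ltW. Qed.

Lemma lyap_a_ge0 : 0 <= lyap_a.
Proof. by rewrite !mulr_ge0 ?lyap_b_ge0// invr_ge0 subr_ge0 ltW. Qed.

Lemma lyap_ab : (lyap_a + lyap_b) * rho = lyap_a.
Proof.
rewrite /lyap_a; field; apply: lt0r_neq0; by rewrite subr_gt0.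
Qed.

Lemma lyap_ge0 w : 0 <= lyap w.
Proof.
rewrite /lyap; case: ifPn => [_|]; first by rewrite mulr_ge0 ?lyap_a_ge0 ?expR_ge0.
rewrite -ltNge => w0; have a0 := lyap_a_ge0.
have : w / mu <= 0 by rewrite pmulr_lle0 ?invr_gt0// ltW.
by lra.
Qed.

(** [lyap_b] is the largest value of [1 - w / mu] for [w >= - r], so one exponential dominates both
    branches. *)
Lemma lyap_le w : - r <= w -> lyap w <= (lyap_a + lyap_b) * expR (- w / 2).
Proof.
move=> rw; have a0 := lyap_a_ge0; have b0 := lyap_b_ge0.
rewrite /lyap; case: ifPn => [_|].
  by rewrite ler_wpM2r ?expR_ge0// lerDl.
rewrite -ltNge => w0; rewrite (@le_trans _ _ (lyap_a + lyap_b))//.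
  rewrite /lyap_b -addrA lerD2l lerD2l -mulNr ler_pM2r ?invr_gt0//.
  by rewrite lerNl.
apply: ler_peMr; first exact: addr_ge0.
by rewrite -[leLHS]expR0 ler_expR divr_ge0// oppr_ge0 ltW.
Qed.

Lemma lyap_le_cst w : - r <= w -> lyap w <= lyap_a + lyap_b.
Proof.
move=> rw; have a0 := lyap_a_ge0; have b0 := lyap_b_ge0.
rewrite /lyap; case: ifPn => [w0|].
  apply: (@le_trans _ _ lyap_a); last by rewrite lerDl.
  apply: ler_piMr => //.
  by rewrite -[leRHS]expR0 ler_expR mulNr oppr_le0 divr_ge0.
rewrite -ltNge => w0.
rewrite /lyap_b -addrA lerD2l lerD2l -mulNr ler_pM2r ?invr_gt0//.
by rewrite lerNl.
Qed.

(** An off-step costs 1, paid by the linear branch. After an on-step, [lyap_le] bounds the new value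
    by an exponential whose mean over [z n.+1] is at most [(lyap_a + lyap_b) * rho * expR (- W n /
    2)], again [lyap (W n)]. *)
Lemma lyap_step z n (W := deW mu r%:E z) :
  lyap (W n.+1) + (W n < 0)%R%:R <= (W n < 0)%R%:R * lyap (W n) +
  (lyap_a + lyap_b) * ((0 <= W n)%R%:R * expR (- W n / 2) * expR (- z n.+1 / 2)).
Proof.
have h0 : (0 <= r%:E)%E by rewrite lee_fin.
have a0 := lyap_a_ge0; have b0 := lyap_b_ge0.
have W1 : - r <= W n.+1 by exact: deW_ge.
case: (ltP (W n) 0) => Wn /=.
  rewrite mul1r !mul0r mulr0 addr0.
  rewrite {1}/W deWS -/(W n) (leNgt 0 (W n)) Wn /=.
  have WL : lyap (W n) = lyap_a + 1 - W n / mu by rewrite /lyap leNgt Wn.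
  rewrite WL; case: (ltP (W n + mu) 0) => Wm.
    by rewrite /lyap (leNgt 0 (W n + mu)) Wm /= mulrDl divff ?gt_eqF//; lra.
  rewrite /lyap lexx oppr0 mul0r expR0 mulr1.
  have : W n / mu <= 0 by rewrite pmulr_lle0 ?invr_gt0// ltW.
  by lra.
rewrite mul0r add0r addr0 mul1r -expRD (le_trans (lyap_le W1))//.
apply: ler_wpM2l; first exact: addr_ge0.
rewrite ler_expR -mulrDl ler_pM2r ?invr_gt0//.
rewrite -opprD lerN2 {2}/W deWS -/(W n) Wn; exact: trunc_ge.
Qed.

End Lyapunov.

(** * Delay: drift of the affected sensors up to the alarm *)

Section Delay.
Context {R : realType} {d : measure_display} {Omega : measurableType d}.
Variables (L : nat) (X : nat -> 'I_L -> {mfun Omega >-> R}).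
Variable P : probability Omega R.
Hypothesis ind : mutually_independent P [set i : nat * 'I_L | (1 <= i.1)%N]
  (fun i => X i.1 i.2).
Variable phi : 'I_L -> R -> R.
Hypothesis mphi : forall l, measurable_fun setT (phi l).
Variables (mu r D p q s rho : 'I_L -> R) (g0 : nat) (kappa : {set 'I_L}).
Hypotheses (mu_gt0 : forall l, (0 < mu l)%R) (r_ge0 : forall l, (0 <= r l)%R).
Hypothesis D_ge0 : forall l, (0 <= D l)%R.
Local Notation Z l w := (obs X phi l w).
Local Notation W l w n := (deW (mu l) (r l)%:E (Z l w) n).
Local Notation pastT n := (g_sigma_algebraType (gens X n)).
Hypotheses (rho_ge0 : forall l, (0 <= rho l)%R)
  (rho_lt1 : forall l, l \in kappa -> (rho l < 1)%R).
Hypothesis half_exp : forall l n, l \in kappa -> (g0 <= n)%N ->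
  Ex P (fun w => expR (- Z l w n.+1 / 2))%R <= (rho l)%:E.
Hypothesis mean_pos : forall l n, l \in kappa -> (g0 <= n)%N ->
  Ex P (fun w => Num.max (Z l w n.+1) 0%R) = (p l)%:E.
Hypothesis mean_neg : forall l n, l \in kappa -> (g0 <= n)%N ->
  Ex P (fun w => Num.max (- Z l w n.+1)%R 0%R) = (q l)%:E.
Hypothesis mean_sq : forall l n, l \in kappa -> (g0 <= n)%N ->
  Ex P (fun w => Z l w n.+1 ^+ 2)%R = (s l)%:E.
Hypothesis qp : forall l, l \in kappa -> (q l < p l)%R.

Variable C : set Omega.
Hypothesis pastC : past X g0 C.

Let h l := (r l)%:E.
Let h_ge0 l : 0 <= h l. Proof. by rewrite lee_fin. Qed.
Let inC w : bool := `[< C w >].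

Let minC n : (g0 <= n)%N -> measurable_fun setT (inC : pastT n -> bool).
Proof.
move=> gn; apply: (@measurable_past_mono _ _ _ _ X g0 n _ _ inC gn).
apply: (@measurable_fun_bool _ (pastT g0) setT inC true).
rewrite (_ : _ `&` _ = C); first exact: pastC.
rewrite setTI; apply/seteqP; split => w /=; first by move=> /asboolP.
by move=> Cw; apply/asboolP.
Qed.

Let mW l n : measurable_fun setT ((fun w => W l w n) : pastT n -> R).
Proof.
have mz j (jn : (1 <= j <= n)%N) := @measurable_obs_past _ _ _ _ X _ mphi n l j jn.
exact: (@measurable_deW _ _ (pastT n) (mu l) (h l) (h_ge0 l)
  (fun k w => Z l w k) n mz n (leqnn n)).
Qed.

Let ExR (Y : Omega -> R) : R := fine (Ex P Y).

Let ExRE (Y : Omega -> R) (b : R) : measurable_fun setT Y ->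
  (forall w, 0 <= Y w <= b)%R -> Ex P Y = (ExR Y)%:E.
Proof.
move=> mY Yb; rewrite /ExR fineK//; apply: (@Ex_fin_le _ _ _ _ _ b).
  by move=> w; case/andP: (Yb w).
rewrite -(Ex_cst P b); apply: Ex_le => //.
- by move=> w; case/andP: (Yb w).
- by move=> w; case/andP: (Yb w).
Qed.

Let PC : Ex P (fun w => (inC w)%:R%R) = P C.
Proof.
rewrite Ex_bool; last exact: (measurable_past (minC (leqnn g0))).
by congr (P _); apply/seteqP; split => w /asboolP.
Qed.

Let K l := (lyap_a (mu l) (r l) (rho l) + lyap_b (mu l) (r l))%R.

(** [lyap_step] is integrated over [C] and summed. The increment at [k.+1] is independent of the
    past at [k] and brings the factor [rho], so off-steps are paid for by the decrease of the mean
    of [lyap]. Its starting value is at most [K l] whatever the history, since [W >= - r]. *)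
Lemma off_count_le l m : l \in kappa ->
  \sum_(g0 <= k < g0 + m) Ex P (fun w => (inC w && (W l w k < 0)%R)%:R%R)
  <= (K l)%:E * P C.
Proof.
move=> lk; set ly := lyap (mu l) (r l) (rho l).
have mO k : measurable_fun setT (fun w => W l w k) by exact: (measurable_past (@mW l k)).
have minCO : measurable_fun setT inC by exact: (measurable_past (minC (leqnn g0))).
have mly k : (g0 <= k)%N -> measurable_fun setT ((fun w => ly (W l w k)) : pastT k -> R).
  move=> gk; rewrite /ly /lyap; apply: measurable_fun_ifT.
  - by apply: measurable_fun_ler; [exact: measurable_cst|exact: mW].
  - apply: measurable_funM; first exact: measurable_cst.
    apply: measurableT_comp => //; apply: measurable_funM; last exact: measurable_cst.
    by apply: measurable_funN; exact: mW.
  - apply: measurable_funB; first exact: measurable_cst.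
    by apply: measurable_funM; [exact: mW|exact: measurable_cst].
have rl := rho_lt1 lk.
have ly0 w : (0 <= ly w)%R by apply: lyap_ge0.
have ab0 : (0 <= K l)%R.
  by apply: addr_ge0; [exact: lyap_a_ge0|exact: lyap_b_ge0].
suff H : \sum_(g0 <= k < g0 + m) Ex P (fun w => (inC w && (W l w k < 0)%R)%:R%R) +
    Ex P (fun w => (inC w)%:R * ly (W l w (g0 + m)%N))%R <=
    Ex P (fun w => (inC w)%:R * ly (W l w g0))%R.
  apply: (@le_trans _ _ (Ex P (fun w => (inC w)%:R * ly (W l w g0))%R)).
    apply: le_trans H; rewrite leeDl//; apply: Ex_ge0 => w; by rewrite mulr_ge0.
  rewrite -PC -ExZ//; last exact: measurable_bool_natr.
  apply: Ex_le.
  - apply: measurable_funM; first exact: measurable_bool_natr.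
    exact: (measurable_past (mly g0 (leqnn g0))).
  - by apply: measurable_funM; [exact: measurable_cst|exact: measurable_bool_natr].
  - by move=> w; rewrite mulr_ge0.
  - move=> w; rewrite mulrC; apply: ler_wpM2r => //.
    by apply: lyap_le_cst => //; exact: (deW_ge (mu_gt0 l) (h_ge0 l)).
elim: m => [|m IH]; first by rewrite addn0 big_geq// add0e.
apply: le_trans IH; rewrite addnS big_nat_recr/= ?leq_addr// -addeA.
apply: leeD => //; set k := (g0 + m)%N; have gk : (g0 <= k)%N by exact: leq_addr.
pose Y w := ((inC w && (0 <= W l w k)%R)%:R * expR (- W l w k / 2))%R.
have mY : measurable_fun setT (Y : pastT k -> R).
  apply: measurable_funM.
    apply: measurable_bool_natr; apply: measurable_and; first exact: minC.
    by apply: measurable_fun_ler; [exact: measurable_cst|exact: mW].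
  apply: measurableT_comp => //; apply: measurable_funM; last exact: measurable_cst.
  by apply: measurable_funN; exact: mW.
have mYO := measurable_past mY.
have Y0 w : (0 <= Y w)%R by rewrite mulr_ge0// expR_ge0.
have mez : measurable_fun setT (fun w => expR (- Z l w k.+1 / 2)%R).
  apply: measurableT_comp => //; apply: measurable_funM; last exact: measurable_cst.
  by apply: measurable_funN; exact: measurable_obs.
pose N w := ((inC w && (W l w k < 0)%R)%:R * ly (W l w k))%R.
have mN : measurable_fun setT N.
  apply: measurable_funM; last exact: (measurable_past (mly k gk)).
  apply: measurable_bool_natr; apply: measurable_and => //.
  by apply: measurable_fun_ltr => //; exact: measurable_cst.
have N0 w : (0 <= N w)%R by rewrite mulr_ge0.
have moff : measurable_fun setT (fun w => (inC w && (W l w k < 0)%R)%:R : R).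
  apply: measurable_bool_natr; apply: measurable_and => //.
  by apply: measurable_fun_ltr => //; exact: measurable_cst.
have mlyS : measurable_fun setT (fun w => (inC w)%:R * ly (W l w k.+1))%R.
  apply: measurable_funM; first exact: measurable_bool_natr.
  exact: (measurable_past (mly k.+1 (leqW gk))).
apply: (@le_trans _ _ (Ex P (fun w => N w + K l * (Y w * expR (- Z l w k.+1 / 2)))%R)).
  rewrite -ExD//; last by move=> w; rewrite mulr_ge0.
  apply: Ex_le.
  - exact: measurable_funD.
  - apply: measurable_funD => //; apply: measurable_funM; first exact: measurable_cst.
    exact: measurable_funM.
  - by move=> w; rewrite addr_ge0// mulr_ge0.
  - move=> w; rewrite /N /Y; case: (inC w) => /=; last by rewrite !mul0r mulr0 addr0.
    rewrite mul1r addrC; exact: (lyap_step (mu_gt0 l) (r_ge0 l) (rho_ge0 l) (rho_lt1 lk)).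
rewrite ExD//; last 2 first.
- by apply: measurable_funM; [exact: measurable_cst|exact: measurable_funM].
- by move=> w; rewrite mulr_ge0// mulr_ge0// expR_ge0.
rewrite ExZ//; last 2 first.
- exact: measurable_funM.
- by move=> w; rewrite mulr_ge0// expR_ge0.
rewrite (@Ex_mul_indep _ _ _ _ _ _ ind _ mphi k k.+1 l Y (fun x => expR (- x / 2)%R))//; last first.
  by apply: measurableT_comp => //; apply: measurable_funM; [exact: measurable_funN|exact: measurable_cst].
apply: (@le_trans _ _ (Ex P N + (K l)%:E * (Ex P Y * (rho l)%:E))).
  by apply: leeD => //; apply: lee_wpmul2l => //; apply: lee_wpmul2l; [exact: Ex_ge0|exact: half_exp].
have a0 : (0 <= lyap_a (mu l) (r l) (rho l))%R by apply: lyap_a_ge0.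
rewrite (muleC (Ex P Y)) muleA -EFinM lyap_ab// -ExZ//.
rewrite -ExD//; last 2 first.
- by apply: measurable_funM => //; exact: measurable_cst.
- by move=> w; rewrite mulr_ge0.
rewrite le_eqVlt; apply/orP; left; apply/eqP; apply: eq_Ex => w.
rewrite /N /Y; case: (inC w) => /=; last by rewrite !mul0r mulr0 addr0.
rewrite mul1r /ly /lyap leNgt; case: (ltP (W l w k) 0%R) => _ /=.
  by rewrite mul1r mul0r mulr0 addr0.
by rewrite mul0r add0r mul1r.
Qed.

Variable A : R.
Hypothesis A_ge0 : (0 <= A)%R.

Local Notation Q w k := (alive (fusion X phi mu h D A w) k).
Local Notation V w k := (\sum_(l in kappa) W l w k)%R.

(** Censoring hides at most [D l] per sensor, and sensors outside [kappa] contribute nonnegative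
    terms to the fusion sum. *)
Let V_le w k : Q w k -> (V w k <= A + \sum_(l in kappa) D l)%R.
Proof.
case: k => [_|k].
  rewrite big1 => [|l _ //]; apply: addr_ge0; first exact: A_ge0.
  by apply: sumr_ge0 => l _; exact: D_ge0.
rewrite aliveS => /andP[_]; rewrite /fusion -leNgt => Y_le.
apply: (@le_trans _ _ (\sum_(l in kappa) (deY (mu l) (h l) (D l) (Z l w) k.+1 + D l))%R).
  apply: ler_sum => l _; rewrite /deY /deT; case: (ltP (D l)) => WD.
    by rewrite lerDl.
  by rewrite add0r.
rewrite big_split /= lerD2r (le_trans _ Y_le)//.
rewrite [leRHS](bigID (mem kappa)) /= lerDl.
by apply: sumr_ge0 => l _; exact: deY_ge0.
Qed.

(** The increments of [V] telescope up to the alarm. [V] starts above minus the sum of the [r l], is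
    bounded by [V_le] one step before the end, and its last increment is bounded by [deW_step_le]
    and [norm_le_sq]. *)
Let path_delay c w m : (0 < c)%R ->
  (\sum_(g0 <= k < g0 + m) (Q w k)%:R *
     \sum_(l in kappa) (0 <= W l w k)%R%:R * Z l w k.+1 <=
   A + \sum_(l in kappa) (D l + r l + mu l + c) +
   \sum_(g0 <= k < g0 + m) (Q w k)%:R * \sum_(l in kappa) c^-1 * Z l w k.+1 ^+ 2)%R.
Proof.
move=> c0; set E2 := fun k => (\sum_(l in kappa) c^-1 * Z l w k.+1 ^+ 2)%R.
have E2_ge0 k : (0 <= E2 k)%R.
  by apply: sumr_ge0 => l _; rewrite mulr_ge0 ?sqr_ge0// invr_ge0 ltW.
apply: (@le_trans _ _ (\sum_(g0 <= k < g0 + m) (Q w k)%:R * (V w k.+1 - V w k))%R).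
  apply: ler_sum => k _; apply: ler_wpM2l => //; rewrite -sumrB; apply: ler_sum => l _.
  exact: (deW_step_ge (mu_gt0 l) (h_ge0 l)).
have tele n : Q w (g0 + n)%N ->
    (\sum_(g0 <= k < g0 + n) (Q w k)%:R * (V w k.+1 - V w k) = V w (g0 + n)%N - V w g0)%R.
  elim: n => [|n IH]; first by rewrite addn0 big_geq// subrr.
  rewrite addnS aliveS => /andP[Qn _]; rewrite big_nat_recr ?leq_addr//= IH// Qn mul1r.
  by rewrite addrC subrKA.
have cst_ge0 : (0 <= \sum_(l in kappa) (D l + r l + mu l + c))%R.
  by apply: sumr_ge0 => l _; rewrite !addr_ge0// ltW.
elim: m => [|m IH]; first by rewrite addn0 !big_geq// addr0 addr_ge0.
(* After the alarm, the new terms vanish on both sides. *)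
rewrite addnS; case Qm: (Q w (g0 + m)%N); last first.
  by rewrite !big_nat_recr ?leq_addr//= Qm !mul0r !addr0.
rewrite big_nat_recr ?leq_addr//= tele// Qm mul1r addrC subrKA.
(* Only the last square is needed, for the overshoot; the others merely enlarge the bound. *)
apply: (@le_trans _ _ (A + \sum_(l in kappa) (D l + r l + mu l + c) + E2 (g0 + m)%N)%R);
  last first.
  rewrite lerD2l big_nat_recr ?leq_addr//= Qm mul1r lerDr.
  by apply: sumr_ge0 => k _; apply: mulr_ge0 => //; exact: E2_ge0.
have step : (V w (g0 + m).+1 <= V w (g0 + m)%N +
    \sum_(l in kappa) (c + c^-1 * Z l w (g0 + m).+1 ^+ 2 + mu l))%R.
  rewrite -big_split; apply: ler_sum => l _ /=.
  rewrite (le_trans (deW_step_le (mu_gt0 l) (h_ge0 l) _ _))// lerD2l lerD2r.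
  by rewrite mulrC norm_le_sq.
have low : (- (\sum_(l in kappa) r l) <= V w g0)%R.
  by rewrite -sumrN; apply: ler_sum => l _; exact: (deW_ge (mu_gt0 l) (h_ge0 l)).
have up := V_le Qm.
have -> : (\sum_(l in kappa) (D l + r l + mu l + c) = \sum_(l in kappa) D l
  + \sum_(l in kappa) r l + \sum_(l in kappa) (mu l + c))%R.
  by rewrite -!big_split /=; apply: eq_bigr => l _; ring.
have E3 : (\sum_(l in kappa) (c + c^-1 * Z l w (g0 + m).+1 ^+ 2 + mu l) =
   \sum_(l in kappa) (mu l + c) + E2 (g0 + m)%N)%R.
  by rewrite /E2 -big_split /=; apply: eq_bigr => l _; ring.
rewrite E3 in step.
move: step low up; set x1 := V w (g0 + m).+1; set x2 := V w (g0 + m)%N; set x3 := V w g0.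
set x4 := (\sum_(l in kappa) r l)%R; set x5 := (\sum_(l in kappa) D l)%R.
by move=> ? ? ?; lra.
Qed.

(** [path_delay] integrated over [C]: each on-step before the alarm gains [p l - q l] in the mean,
    the squares cost [s l / c] per step, and the off-steps cost at most [(p l - q l) * K l] in
    total. *)
Lemma sum_alive_le c m : (0 < c)%R ->
  ((\sum_(g0 <= k < g0 + m) fine (Ex P (fun w => (inC w && Q w k)%:R%R))) *
    (\sum_(l in kappa) (p l - q l) - \sum_(l in kappa) s l / c) <=
   (A + \sum_(l in kappa) (D l + r l + mu l + c) +
    \sum_(l in kappa) (p l - q l) * K l) * fine (P C))%R.
Proof.
move=> c0; have c0' : (0 <= c^-1)%R by rewrite invr_ge0 ltW.
have mO l k : measurable_fun setT (fun w => W l w k) by exact: (measurable_past (@mW l k)).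
have minCO : measurable_fun setT inC by exact: (measurable_past (minC (leqnn g0))).
have mQ k : measurable_fun setT ((fun w => Q w k) : pastT k -> bool).
  exact: measurable_alive_past.
pose y k l w := (inC w && Q w k && (0 <= W l w k)%R)%:R : R.
pose x k w := (inC w && Q w k)%:R : R.
pose o k l w := (inC w && (W l w k < 0)%R)%:R : R.
have mxp k : (g0 <= k)%N -> measurable_fun setT (x k : pastT k -> R).
  move=> gk; apply: measurable_bool_natr; apply: measurable_and => //; exact: minC.
have myp k l : (g0 <= k)%N -> measurable_fun setT (y k l : pastT k -> R).
  move=> gk; apply: measurable_bool_natr; apply: measurable_and.
    by apply: measurable_and => //; exact: minC.
  by apply: measurable_fun_ler; [exact: measurable_cst|exact: mW].
have mQO k : measurable_fun setT (fun w => Q w k) by exact: (measurable_past (mQ k)).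
have mx k : measurable_fun setT (x k).
  by apply: measurable_bool_natr; apply: measurable_and.
have my k l : measurable_fun setT (y k l).
  apply: measurable_bool_natr; apply: measurable_and; first exact: measurable_and.
  by apply: measurable_fun_ler => //; exact: measurable_cst.
have mo k l : measurable_fun setT (o k l).
  apply: measurable_bool_natr; apply: measurable_and => //.
  by apply: measurable_fun_ltr => //; exact: measurable_cst.
have b01 (b : bool) : (0 <= (b%:R : R) <= 1)%R by case: b => /=; rewrite ?lexx ?ler01.
have xE k : Ex P (x k) = (ExR (x k))%:E by apply: (@ExRE _ 1%R) => // w; exact: b01.
have yE k l : Ex P (y k l) = (ExR (y k l))%:E by apply: (@ExRE _ 1%R) => // w; exact: b01.
have oE k l : Ex P (o k l) = (ExR (o k l))%:E by apply: (@ExRE _ 1%R) => // w; exact: b01.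
have PCE : P C = (fine (P C))%:E by rewrite fineK// fin_num_measure//; exact: (past_measurable pastC).
have x0 k w : (0 <= x k w)%R by [].
have y0 k l w : (0 <= y k l w)%R by [].
have mZ l k : measurable_fun setT (fun w => Z l w k.+1) by exact: measurable_obs.
have mpos : measurable_fun setT (fun x : R => Num.max x 0%R).
  by apply: measurable_maxr => //; exact: measurable_cst.
have mneg : measurable_fun setT (fun x : R => Num.max (- x)%R 0%R).
  by apply: measurable_maxr; [exact: measurable_funN|exact: measurable_cst].
have msq : measurable_fun setT (fun x : R => x ^+ 2)%R by exact: measurable_funX.
pose fp k l w := (y k l w * Num.max (Z l w k.+1) 0)%R.
pose fn k l w := (y k l w * Num.max (- Z l w k.+1) 0)%R.
pose fs k l w := (c^-1 * (x k w * Z l w k.+1 ^+ 2))%R.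
have mfp k l : measurable_fun setT (fp k l).
  by apply: measurable_funM => //; exact: (measurableT_comp mpos (mZ l k)).
have mfn k l : measurable_fun setT (fn k l).
  by apply: measurable_funM => //; exact: (measurableT_comp mneg (mZ l k)).
have mxz k l : measurable_fun setT (fun w => x k w * Z l w k.+1 ^+ 2)%R.
  by apply: measurable_funM => //; exact: measurable_funX.
have mfs k l : measurable_fun setT (fs k l).
  by apply: measurable_funM => //; exact: measurable_cst.
have max0 (t : R) : (0 <= Num.max t 0)%R by rewrite le_max lexx orbT.
have fp0 k l w : (0 <= fp k l w)%R by rewrite mulr_ge0.
have fn0 k l w : (0 <= fn k l w)%R by rewrite mulr_ge0.
have fs0 k l w : (0 <= fs k l w)%R by rewrite mulr_ge0// mulr_ge0// sqr_ge0.
have Efp k l : (g0 <= k)%N -> l \in kappa -> Ex P (fp k l) = (ExR (y k l) * p l)%:E.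
  move=> gk lk; rewrite /fp (@Ex_mul_indep _ _ _ _ _ _ ind _ mphi k k.+1 l (y k l) (fun t => Num.max t 0%R))//.
    by rewrite yE mean_pos.
  exact: myp.
have Efn k l : (g0 <= k)%N -> l \in kappa -> Ex P (fn k l) = (ExR (y k l) * q l)%:E.
  move=> gk lk; rewrite /fn (@Ex_mul_indep _ _ _ _ _ _ ind _ mphi k k.+1 l (y k l) (fun t => Num.max (- t)%R 0%R))//.
    by rewrite yE mean_neg.
  exact: myp.
have Efs k l : (g0 <= k)%N -> l \in kappa -> Ex P (fs k l) = (c^-1 * (ExR (x k) * s l))%:E.
  move=> gk lk; rewrite /fs ExZ//; last by move=> w; rewrite mulr_ge0 ?sqr_ge0.
  rewrite (@Ex_mul_indep _ _ _ _ _ _ ind _ mphi k k.+1 l (x k) (fun t => t ^+ 2)%R)//.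
  - by rewrite xE mean_sq// -!EFinM.
  - exact: mxp.
  - by move=> t; rewrite sqr_ge0.
set c1 := (A + \sum_(l in kappa) (D l + r l + mu l + c))%R.
have c1_ge0 : (0 <= c1)%R.
  by rewrite addr_ge0//; apply: sumr_ge0 => l _; rewrite !addr_ge0// ltW.
have minCR : measurable_fun setT (fun w => (inC w)%:R : R) by exact: measurable_bool_natr.
have path w : (\sum_(g0 <= k < g0 + m) \sum_(l in kappa) fp k l w <=
   c1 * (inC w)%:R + \sum_(g0 <= k < g0 + m) \sum_(l in kappa) (fn k l w + fs k l w))%R.
  have := @path_delay c w m c0; rewrite /fp /fn /fs /y /x.
  case: (inC w) => /= H; last first.
    rewrite mulr0 add0r; apply: ler_sum => k _; apply: ler_sum => l _.
    by rewrite !mul0r mulr0 addr0.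
  rewrite mulr1 -/c1 in H *.
  have split1 : (\sum_(g0 <= k < g0 + m) (Q w k)%:R *
     \sum_(l in kappa) (0 <= W l w k)%R%:R * Z l w k.+1 =
     \sum_(g0 <= k < g0 + m) \sum_(l in kappa) (Q w k && (0 <= W l w k)%R)%:R * Num.max (Z l w k.+1) 0
   - \sum_(g0 <= k < g0 + m) \sum_(l in kappa) (Q w k && (0 <= W l w k)%R)%:R * Num.max (- Z l w k.+1) 0)%R.
    rewrite -sumrB; apply: eq_bigr => k _; rewrite -sumrB big_distrr /=.
    apply: eq_bigr => l _; rewrite -mulrBr -mulnb natrM mulrA; congr (_ * _)%R.
    case: (leP (Z l w k.+1) 0%R) => z0.
      by rewrite max_l ?oppr_ge0// sub0r opprK.
    by rewrite max_r ?subr0// oppr_le0 ltW.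
  have split2 : (\sum_(g0 <= k < g0 + m) \sum_(l in kappa)
     ((Q w k && (0 <= W l w k)%R)%:R * Num.max (- Z l w k.+1) 0 +
      c^-1 * ((Q w k)%:R * Z l w k.+1 ^+ 2)) =
     \sum_(g0 <= k < g0 + m) \sum_(l in kappa) (Q w k && (0 <= W l w k)%R)%:R * Num.max (- Z l w k.+1) 0
   + \sum_(g0 <= k < g0 + m) (Q w k)%:R * \sum_(l in kappa) c^-1 * Z l w k.+1 ^+ 2)%R.
    rewrite -big_split /=; apply: eq_bigr => k _; rewrite big_split /=; congr (_ + _)%R.
    by rewrite big_distrr /=; apply: eq_bigr => l _; rewrite mulrCA.
  by rewrite split2 addrA addrAC -lerBlDr -split1.
have main : (\sum_(g0 <= k < g0 + m) \sum_(l in kappa) ExR (y k l) * p l <=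
   c1 * fine (P C) + \sum_(g0 <= k < g0 + m) \sum_(l in kappa)
      (ExR (y k l) * q l + c^-1 * (ExR (x k) * s l)))%R.
  rewrite -lee_fin EFinD EFinM -PCE -PC -ExZ// -!sumEFin.
  rewrite (eq_big_nat _ _ (F2 := fun k => Ex P (fun w => \sum_(l in kappa) fp k l w)%R)); last first.
    by move=> k /andP[gk _]; rewrite Ex_sum// -sumEFin; apply: eq_bigr => l lk; rewrite Efp.
  rewrite [X in _ <= _ + X](eq_big_nat _ _ (F2 := fun k => Ex P (fun w => \sum_(l in kappa) (fn k l w + fs k l w))%R)); last first.
    move=> k /andP[gk _]; rewrite Ex_sum//.
    - by rewrite -sumEFin; apply: eq_bigr => l lk; rewrite ExD// EFinD Efn// Efs.
    - by move=> l; exact: measurable_funD.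
    - by move=> l w; rewrite addr_ge0.
  have mfpS k : measurable_fun setT (fun w => \sum_(l in kappa) fp k l w)%R.
    by under eq_fun do rewrite -big_filter; exact: measurable_sum.
  have mfnS k : measurable_fun setT (fun w => \sum_(l in kappa) (fn k l w + fs k l w))%R.
    under eq_fun do rewrite -big_filter; apply: measurable_sum => l; exact: measurable_funD.
  have fnS0 k w : (0 <= \sum_(l in kappa) (fn k l w + fs k l w))%R.
    by apply: sumr_ge0 => l _; rewrite addr_ge0.
  have fpS0 k w : (0 <= \sum_(l in kappa) fp k l w)%R by apply: sumr_ge0.
  rewrite -!Ex_sum// -ExD//.
  - apply: Ex_le => //.
    + exact: measurable_sum.
    + apply: measurable_funD; last exact: measurable_sum.
      by apply: measurable_funM => //; exact: measurable_cst.
    + by move=> w; apply: sumr_ge0.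
  - by apply: measurable_funM => //; exact: measurable_cst.
  - exact: measurable_sum.
  - by move=> w; rewrite mulr_ge0.
  - by move=> w; apply: sumr_ge0.
(* Steps before the alarm are on-steps, up to the off-steps, which [off_count_le] counts regardless
   of the alarm. *)
have xyo k l : (ExR (x k) - ExR (o k l) <= ExR (y k l))%R.
  rewrite lerBlDr -lee_fin EFinD -xE -yE -oE -ExD//.
  apply: Ex_le => //; first exact: measurable_funD.
  move=> w; rewrite /x /y /o; case: (inC w) => /=; last by rewrite addr0.
  by case: (alive _ k) => /=; case: leP => /=; rewrite ?addr0 ?add0r.
have off l : l \in kappa -> (\sum_(g0 <= k < g0 + m) ExR (o k l) <= K l * fine (P C))%R.
  move=> lk; have := off_count_le m lk; rewrite PCE -EFinM.
  rewrite (eq_bigr (fun k => (ExR (o k l))%:E)); last by move=> k _; rewrite -oE.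
  by rewrite sumEFin lee_fin.
rewrite -/c1 -[X in (X * _ <= _)%R]/(\sum_(g0 <= k < g0 + m) ExR (x k))%R.
set xs := (\sum_(g0 <= k < g0 + m) ExR (x k))%R.
have e1 : (\sum_(g0 <= k < g0 + m) \sum_(l in kappa) (ExR (x k) - ExR (o k l)) * (p l - q l)
   <= \sum_(g0 <= k < g0 + m) \sum_(l in kappa) ExR (y k l) * (p l - q l))%R.
  apply: ler_sum => k _; apply: ler_sum => l lk; apply: ler_wpM2r => //.
  by rewrite subr_ge0 ltW// qp.
have e2 : (\sum_(g0 <= k < g0 + m) \sum_(l in kappa) (ExR (x k) - ExR (o k l)) * (p l - q l)
   = xs * (\sum_(l in kappa) (p l - q l)) -
     \sum_(l in kappa) (p l - q l) * \sum_(g0 <= k < g0 + m) ExR (o k l))%R.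
  have -> : (\sum_(l in kappa) (p l - q l) * \sum_(g0 <= k < g0 + m) ExR (o k l) =
    \sum_(g0 <= k < g0 + m) \sum_(l in kappa) ExR (o k l) * (p l - q l))%R.
    rewrite exchange_big /=; apply: eq_bigr => l _; rewrite mulrC big_distrl /=.
    by [].
  rewrite /xs big_distrl -sumrB /=; apply: eq_bigr => k _.
  by rewrite big_distrr -sumrB /=; apply: eq_bigr => l _; rewrite mulrBl.
have e3 : (\sum_(l in kappa) (p l - q l) * \sum_(g0 <= k < g0 + m) ExR (o k l) <=
   (\sum_(l in kappa) (p l - q l) * K l) * fine (P C))%R.
  rewrite big_distrl /=; apply: ler_sum => l lk; rewrite -mulrA.
  by apply: ler_wpM2l; [rewrite subr_ge0 ltW// qp|exact: off].
have e4 : (\sum_(g0 <= k < g0 + m) \sum_(l in kappa)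
      (ExR (y k l) * q l + c^-1 * (ExR (x k) * s l)) =
   \sum_(g0 <= k < g0 + m) \sum_(l in kappa) ExR (y k l) * q l +
   xs * \sum_(l in kappa) s l / c)%R.
  rewrite /xs big_distrl -big_split /=; apply: eq_bigr => k _.
  rewrite big_split /=; congr (_ + _)%R; rewrite big_distrr /=.
  by apply: eq_bigr => l _; rewrite mulrC mulrA.
have e5 : (\sum_(g0 <= k < g0 + m) \sum_(l in kappa) ExR (y k l) * (p l - q l) =
  \sum_(g0 <= k < g0 + m) \sum_(l in kappa) ExR (y k l) * p l -
  \sum_(g0 <= k < g0 + m) \sum_(l in kappa) ExR (y k l) * q l)%R.
  rewrite -sumrB; apply: eq_bigr => k _; rewrite -sumrB; apply: eq_bigr => l _.
  by rewrite mulrBr.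
rewrite mulrBr mulrDl.
move: main e1 e3; rewrite e2 e4 e5.
set t1 := (\sum_(_ <= _ < _) \sum_(_ in kappa) _ * p _)%R.
set t2 := (\sum_(_ <= _ < _) \sum_(_ in kappa) _ * q _)%R.
set t3 := (xs * _)%R; set t4 := (\sum_(l in kappa) _ * \sum_(_ <= _ < _) _)%R.
set t5 := (xs * _)%R; set t6 := (_ * fine (P C))%R; set t7 := (_ * fine (P C))%R.
by move=> ? ? ?; lra.
Qed.

End Delay.

(** * Conditional expectations and their essential supremum *)

Section ConditionalExpectation.
Context {R : realType} {d : measure_display} {Omega : measurableType d}.
Variables (P : probability Omega R) (GG : set_system Omega).
Hypothesis subG : <<s GG >> `<=` @measurable _ Omega.
Variable V : Omega -> \bar R.
Hypotheses (mV : measurable_fun setT V) (V_ge0 : forall w, 0 <= V w).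
Hypothesis V_fin : \int[P]_w V w < +oo.

Local Notation GT := (g_sigma_algebraType GG).

Let intV (A : set GT) : \bar R := \int[P]_(w in A) V w.

Let intV0 : intV set0 = 0.
Proof. by rewrite /intV integral_set0. Qed.

Let intV_ge0 A : 0 <= intV A.
Proof. exact: integral_ge0. Qed.

Let intV_sigma_additive : semi_sigma_additive intV.
Proof.
move=> F mF tF mUF; have mFO k : measurable (F k : set Omega) by apply: subG; exact: mF.
rewrite /intV ge0_integral_bigcup//; last exact: measurable_funTS.
by apply: is_cvg_nneseries => n _ _; exact: integral_ge0.
Qed.

HB.instance Definition _ := isMeasure.Build _ _ _ intV
  intV0 intV_ge0 intV_sigma_additive.

Let intV_finite : fin_num_fun intV.
Proof.
apply: lty_fin_num_fun; exact: V_fin.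
Qed.

HB.instance Definition _ := Measure_isFinite.Build _ _ _ intV intV_finite.

Let mid : measurable_fun setT (idfun : Omega -> GT).
Proof. by move=> _ B mB; rewrite setTI; exact: subG. Qed.

Let idG : {mfun Omega >-> GT} :=
  HB.pack (idfun : Omega -> GT) (isMeasurableFun.Build _ _ _ _ _ mid).

(** Radon-Nikodym on the sub-sigma-algebra: [intV] is a finite measure there, dominated by the
    restriction of [P], which is the image of [P] under the identity into the coarser space. *)
Lemma cond_expectation_exists : exists E, is_cond_expectation P <<s GG >> V E.
Proof.
have dom : intV `<< distribution P idG.
  apply/null_content_dominatesP => A mA PA.
  rewrite /intV; apply: null_set_integral => //; first exact: subG.
  by apply: measurable_funTS.
have [E [E0 Efin iE EV]] := radon_nikodym_sigma_finite dom.
have mE := measurable_int _ iE.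
exists E; split => //.
  by move=> B mB; rewrite -[_ @^-1` _]setTI; exact: mE.
move=> C GC; rewrite -[RHS]/(intV C) EV//.
rewrite (@ge0_integral_pushforward _ _ _ _ _ _ mid P C E)//.
exact: measurable_funTS.
Qed.

(** Let [C] be the event that the conditional expectation is at least [B + e]. It is in the
    sub-sigma-algebra, so [(B + e) * P C <= B * P C] and [C] is null. *)
Lemma ess_sup_cond_expectation_le (B : R) : (0 <= B)%R ->
  (forall C, <<s GG >> C -> \int[P]_(w in C) V w <= B%:E * P C) ->
  ess_sup P (cond_expectation P <<s GG >> V) <= B%:E.
Proof.
move=> B0 VB; have [E0 EG EV] : is_cond_expectation P <<s GG >> V
    (cond_expectation P <<s GG >> V).
  exact: xgetPex cond_expectation_exists.
set E := cond_expectation P <<s GG >> V in E0 EG EV *.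
apply/lee_addgt0Pr => e e0; rewrite -EFinD; apply/ess_supP.
pose C := E @^-1` [set x | (B + e)%:E <= x].
have GC : <<s GG >> C.
  apply: EG; rewrite (_ : [set x | _] = `[(B + e)%:E, +oo[%classic).
    exact: emeasurable_itv.
  by apply/seteqP; split => x /=; rewrite in_itv /= andbT.
have mC : measurable C by exact: subG.
suff PC0 : P C = 0.
  by exists C; split => // w /= /negP; rewrite -ltNge => /ltW.
have : (B + e)%:E * P C <= B%:E * P C.
  apply: le_trans (VB _ GC); rewrite -EV// -integral_cst//.
  apply: ge0_le_integral => //.
  - by move=> w _; rewrite lee_fin addr_ge0// ltW.
  - apply: measurable_funTS => _ A mA; rewrite setTI; apply: subG; exact: EG.
have : P C \is a fin_num by exact: fin_num_measure.
have : 0 <= P C by [].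
case: (P C) => // x; rewrite -!EFinM !lee_fin => x0 _ H.
have x1 : (x <= 0)%R by rewrite -(pmulr_rle0 x e0); move: H; rewrite mulrDl; lra.
by rewrite (_ : x = 0%R)//; apply/le_anti; rewrite x1 x0.
Qed.

End ConditionalExpectation.

(** * From survival sums to the conditional delay *)

Section DelayBound.
Context {R : realType} {d : measure_display} {Omega : measurableType d}.
Variables (L : nat) (X : nat -> 'I_L -> {mfun Omega >-> R}).
Variable phi : 'I_L -> R -> R.
Hypothesis mphi : forall l, measurable_fun setT (phi l).
Variables (mu D : 'I_L -> R) (h : 'I_L -> \bar R).
Hypotheses (h_ge0 : forall l, 0 <= h l).
Local Notation Z l w := (obs X phi l w).
Local Notation pastT n := (g_sigma_algebraType (gens X n)).

(** [deS] at [k] is decided by observations before [k], so what the sensors reveal lies in the full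
    past. *)
Lemma information_past n :
  information X (fun n l w => deS (mu l) (h l) (Z l w) n) n `<=` past X n.
Proof.
apply: smallest_sub; first exact: smallest_sigma_algebra.
move=> _ [k [l [B [/andP[k1 kn] mB ->]]]].
apply: (@measurableI _ (pastT n)).
  apply: (@measurable_bool_set _ (pastT n)); rewrite /deS.
  apply: measurable_fun_ler; first exact: measurable_cst.
  have mz j (jn : (1 <= j <= n)%N) := @measurable_obs_past _ _ _ _ X _ mphi n l j jn.
  exact: (@measurable_deW _ _ (pastT n) (mu l) (h l) (h_ge0 l)
    (fun k w => Z l w k) n mz k.-1 (leq_trans (leq_pred k) kn)).
apply: sub_sigma_algebra; exists k, l, B; split => //; by rewrite k1 kn.
Qed.

Local Notation tau A w := (first_time (fusion X phi mu h D A w) : \bar R).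
Local Notation V A g w := (maxe (tau A w - g%:R%:E) 0).

Lemma measurable_tau A : measurable_fun setT (fun w => tau A w).
Proof.
rewrite (_ : (fun w => _) =
    fun w => \sum_(0 <= n <oo) (alive (fusion X phi mu h D A w) n)%:R%:E); last first.
  by apply/funext => w; rewrite first_timeE.
apply: ge0_emeasurable_sum => [n w _ _|n _]; first by rewrite lee_fin.
apply/measurable_EFinP; apply: measurable_bool_natr.
by apply: (measurable_past (n := n) (X := X)); exact: measurable_alive_past.
Qed.

Lemma measurable_delay A g : measurable_fun setT (fun w => V A g w).
Proof.
apply: measurable_maxe => //; apply: emeasurable_funB => //.
exact: measurable_tau.
Qed.

(** The right side counts [(tau - g0)^+], up to one more than the delay after [g0.+1]; it is the
    quantity that [sum_alive_le] controls. *)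
Lemma delay_le A g0 w : V A g0.+1 w <=
  \sum_(i <oo) (alive (fusion X phi mu h D A w) (i + g0)%N)%:R%:E.
Proof.
set al := fun i => (alive (fusion X phi mu h D A w) i)%:R%:E : \bar R.
have al0 i : 0 <= al i by rewrite lee_fin.
rewrite (@nneseries_addn _ al g0)// ge_max nneseries_ge0// andbT.
rewrite first_timeE (nneseries_split 0 g0)// add0n.
have le1 : \sum_(0 <= k < g0) al k <= g0.+1%:R%:E.
  apply: (@le_trans _ _ (\sum_(0 <= k < g0) 1%:E)).
    by apply: lee_sum => k _; rewrite lee_fin; case: (alive _ _).
  by rewrite sumEFin lee_fin sumr_const_nat subn0 ler_nat.
rewrite leeBlDr// addeC; exact: leeD.
Qed.

Lemma integral_delay_le (P : probability Omega R) A g0 (C : set Omega) (b : R) :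
  past X g0 C ->
  (forall m, (\sum_(g0 <= k < g0 + m) fine (Ex P (fun w =>
    (`[< C w >] && alive (fusion X phi mu h D A w) k)%:R%R)) <= b)%R) ->
  \int[P]_(w in C) V A g0.+1 w <= b%:E.
Proof.
move=> pC hb; have mC := past_measurable pC.
have mal k : measurable_fun setT (fun w => alive (fusion X phi mu h D A w) k).
  by apply: (measurable_past (n := k) (X := X)); exact: measurable_alive_past.
have malE k : measurable_fun setT (fun w => (alive (fusion X phi mu h D A w) k)%:R%:E : \bar R).
  by apply/measurable_EFinP; exact: measurable_bool_natr.
apply: (@le_trans _ _ (\int[P]_(w in C)
    \sum_(i <oo) (alive (fusion X phi mu h D A w) (i + g0)%N)%:R%:E)).
  apply: ge0_le_integral => //.
  - by move=> w _; rewrite le_max lexx orbT.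
  - by apply: measurable_funTS; exact: measurable_delay.
  - apply: measurable_funTS; apply: ge0_emeasurable_sum => [n w _ _|n _].
      by rewrite lee_fin.
    exact: malE.
  - by move=> w _; exact: delay_le.
rewrite integral_nneseries//; last first.
  by move=> n; apply: measurable_funTS; exact: malE.
have E k : \int[P]_(w in C) (alive (fusion X phi mu h D A w) k)%:R%:E =
    (fine (Ex P (fun w => (`[< C w >] && alive (fusion X phi mu h D A w) k)%:R%R)))%:E.
  have <- : Ex P (fun w => (`[< C w >] && alive (fusion X phi mu h D A w) k)%:R%R) =
      \int[P]_(w in C) (alive (fusion X phi mu h D A w) k)%:R%:E.
    rewrite [RHS]integral_mkcond; apply: eq_integral => w _; rewrite patchE.
    case: (boolP (w \in C)) => [/set_mem Cw|/negP wC]; first by rewrite asboolT.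
    by rewrite asboolF// => Cw; apply: wC; exact: mem_set.
  have mC' : measurable_fun setT (fun w => `[< C w >]).
    apply: (@measurable_fun_bool _ Omega setT _ true).
    rewrite (_ : _ `&` _ = C)// setTI; apply/seteqP; split => w /=.
      by move=> /asboolP.
    by move=> Cw; apply/asboolP.
  rewrite fineK//; apply: (@Ex_fin_le _ _ _ _ _ 1%R) => //.
  rewrite -(Ex_cst P 1%R); apply: Ex_le => //.
    by apply: measurable_bool_natr; exact: measurable_and.
  by move=> w; case: (_ && _).
apply: lime_le.
  by apply: is_cvg_nneseries => n _ _; rewrite integral_ge0// => w _; rewrite lee_fin.
apply: nearW => m; under eq_bigr do rewrite E.
rewrite sumEFin lee_fin; apply: le_trans (hb m).
by rewrite -{2}[g0]add0n big_addn addnC addnK.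
Qed.

End DelayBound.

(** Here [t] collects the means under [f] of the positive part, the negative part, the square and
    the half exponential of [llr g f]. For [(f0, f1)] these describe the increments before the
    change, for [(f1, f0)] their negatives after it. *)
Lemma llr_moments {R : realType} (nu : {measure set (measurableTypeR R) -> \bar R})
  (f g : R -> R) : is_density nu f -> is_density nu g -> KL nu f g < +oo ->
  0 < \int[nu]_x (`|llr g f x| * f x)%:E < +oo ->
  \int[nu]_x (llr g f x ^+ 2 * f x)%:E < +oo ->
  exists t : R * R * R * R,
  [/\ \int[nu]_x (Num.max (llr g f x) 0 * f x)%:E = t.1.1.1%:E,
      \int[nu]_x (Num.max (- llr g f x) 0 * f x)%:E = t.1.1.2%:E,
      \int[nu]_x (llr g f x ^+ 2 * f x)%:E = t.1.2%:E,
      (0 <= t.2 < 1)%R /\ \int[nu]_x (expR (llr g f x / 2) * f x)%:E = t.2%:E &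
      KL nu f g = (t.1.1.2 - t.1.1.1)%:E].
Proof.
move=> df dg KLfg /andP[m1_gt0 m1_fin] m2_fin.
have [mf f0 _] := df; have my := measurable_llr dg df.
set y := llr g f in my m1_gt0 m1_fin m2_fin *.
have part_fin (psi : R -> R) : measurable_fun setT psi ->
    (forall x, 0 <= psi x <= `|x|)%R ->
    \int[nu]_x (psi (y x) * f x)%:E \is a fin_num.
  move=> mpsi psi1; rewrite ge0_fin_numE; last first.
    apply: integral_ge0 => x _; rewrite lee_fin mulr_ge0//.
    by case/andP: (psi1 (y x)).
  apply: le_lt_trans m1_fin; apply: ge0_le_integral => //.
  - move=> x _; rewrite lee_fin mulr_ge0//; by case/andP: (psi1 (y x)).
  - apply/measurable_EFinP; apply: measurable_funM => //.
    exact: measurableT_comp.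
  - apply/measurable_EFinP; apply: measurable_funM => //.
    exact: measurableT_comp.
  - move=> x _; rewrite lee_fin; apply: ler_wpM2r => //.
    by case/andP: (psi1 (y x)).
have fin1 : \int[nu]_x (Num.max (y x) 0 * f x)%:E \is a fin_num.
  apply: (part_fin (fun x => Num.max x 0%R)).
    by apply: measurable_maxr => //; exact: measurable_cst.
  by move=> x; rewrite le_max lexx orbT ge_max ler_norm normr_ge0.
have fin2 : \int[nu]_x (Num.max (- y x) 0 * f x)%:E \is a fin_num.
  apply: (part_fin (fun x => Num.max (- x) 0)%R).
    by apply: measurable_maxr; [exact: measurable_funN|exact: measurable_cst].
  by move=> x; rewrite le_max lexx orbT ge_max -normrN ler_norm normr_ge0.
have fin3 : \int[nu]_x (y x ^+ 2 * f x)%:E \is a fin_num.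
  rewrite ge0_fin_numE//; apply: integral_ge0 => x _.
  by rewrite lee_fin mulr_ge0// sqr_ge0.
have e_ge0 : 0 <= \int[nu]_x (expR (y x / 2) * f x)%:E.
  by apply: integral_ge0 => x _; rewrite lee_fin mulr_ge0// expR_ge0.
have e_lt1 : \int[nu]_x (expR (y x / 2) * f x)%:E < 1.
  exact: integral_exp_half_llr_lt1 df dg KLfg m1_gt0.
have fin4 : \int[nu]_x (expR (y x / 2) * f x)%:E \is a fin_num.
  by rewrite ge0_fin_numE// (lt_trans e_lt1)// ltry.
exists (fine (\int[nu]_x (Num.max (y x) 0 * f x)%:E),
        fine (\int[nu]_x (Num.max (- y x) 0 * f x)%:E),
        fine (\int[nu]_x (y x ^+ 2 * f x)%:E),
        fine (\int[nu]_x (expR (y x / 2) * f x)%:E)).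
rewrite /= !fineK//; split => //.
  by split=> //; rewrite fine_ge0//= -lte_fin fineK.
by rewrite EFinB !fineK// (KL_llr df dg KLfg).
Qed.

(** * Application to the change-point model *)

Section Model.
Context {R : realType} (L : nat) (L_ge1 : (1 <= L)%N).
Variables (nu : 'I_L -> {sigma_finite_measure set (measurableTypeR R) -> \bar R}).
Variables (f0 f1 : 'I_L -> R -> R) (kappa : {set 'I_L}).
Hypothesis kappa_neq0 : kappa != finset.set0.
Variables (d : measure_display) (Omega : measurableType d).
Variables (P : option nat -> probability Omega R).
Variable X : nat -> 'I_L -> {mfun Omega >-> R}.
Hypothesis model : change_point_model nu f0 f1 kappa P X.
Hypothesis KL10 : forall l, 0 < KL (nu l) (f1 l) (f0 l) < +oo.
Hypothesis KL01 : forall l, 0 < KL (nu l) (f0 l) (f1 l) < +oo.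
Hypothesis moments0 : forall l k, (1 <= k <= 3)%N ->
  0 < llr_moment (nu l) k (f1 l) (f0 l) (f0 l) < +oo.
Hypothesis moments1 : forall l k, (1 <= k <= 3)%N ->
  0 < llr_moment (nu l) k (f1 l) (f0 l) (f1 l) < +oo.
Variables (mu D : 'I_L -> R).
Hypotheses (mu_gt0 : forall l, (0 < mu l)%R) (D_ge0 : forall l, (0 <= D l)%R).

Local Notation Pinf := (P None).
Let phi l : R -> R := llr (f1 l) (f0 l).
Local Notation Z l w := (obs X phi l w).

Let df0 l : is_density (nu l) (f0 l). Proof. by case: model => /(_ l)[]. Qed.
Let df1 l : is_density (nu l) (f1 l). Proof. by case: model => /(_ l)[]. Qed.

Let mphi l : measurable_fun setT (phi l).
Proof. exact: measurable_llr (df1 l) (df0 l). Qed.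

Let ind g : is_change_point g -> mutually_independent (P g)
  [set i : nat * 'I_L | (1 <= i.1)%N] (fun i => X i.1 i.2).
Proof. by case: model => _ _; apply. Qed.

Let dens0 l n : (1 <= n)%N -> has_density Pinf (X n l) (nu l) (f0 l).
Proof.
case: model => _ + _ n1 => /(_ None isT n l n1).
by rewrite /changed andbF.
Qed.

Let dens1 g l n : (1 <= g)%N -> (g <= n)%N -> l \in kappa ->
  has_density (P (Some g)) (X n l) (nu l) (f1 l).
Proof.
case: model => _ + _ g1 gn lk => /(_ (Some g) _ n l (leq_trans g1 gn)).
rewrite /changed gn lk; apply.
by rewrite /is_change_point; case: g g1 gn.
Qed.

Let moments0' l : exists t : R * R * R * R,
  [/\ \int[nu l]_x (Num.max (phi l x) 0 * f0 l x)%:E = t.1.1.1%:E,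
      \int[nu l]_x (Num.max (- phi l x) 0 * f0 l x)%:E = t.1.1.2%:E,
      \int[nu l]_x (phi l x ^+ 2 * f0 l x)%:E = t.1.2%:E,
      (0 <= t.2 < 1)%R /\ \int[nu l]_x (expR (phi l x / 2) * f0 l x)%:E = t.2%:E &
      KL (nu l) (f0 l) (f1 l) = (t.1.1.2 - t.1.1.1)%:E].
Proof.
apply: (llr_moments (df0 l) (df1 l)).
- by case/andP: (KL01 l).
- have := moments0 l (isT : (1 <= 1 <= 3)%N); rewrite /llr_moment.
  by under eq_integral do rewrite expr1.
- have /andP[_] := moments0 l (isT : (1 <= 2 <= 3)%N); rewrite /llr_moment.
  by under eq_integral do rewrite real_normK ?num_real//.
Qed.

Let moments1' l : exists t : R * R * R * R,
  [/\ \int[nu l]_x (Num.max (- phi l x) 0 * f1 l x)%:E = t.1.1.1%:E,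
      \int[nu l]_x (Num.max (phi l x) 0 * f1 l x)%:E = t.1.1.2%:E,
      \int[nu l]_x (phi l x ^+ 2 * f1 l x)%:E = t.1.2%:E,
      (0 <= t.2 < 1)%R /\ \int[nu l]_x (expR (- phi l x / 2) * f1 l x)%:E = t.2%:E &
      KL (nu l) (f1 l) (f0 l) = (t.1.1.2 - t.1.1.1)%:E].
Proof.
have E x : llr (f0 l) (f1 l) x = (- phi l x)%R by exact: llrC.
have [|||t] := @llr_moments R (nu l) _ _ (df1 l) (df0 l).
- by case/andP: (KL10 l).
- have := moments1 l (isT : (1 <= 1 <= 3)%N); rewrite /llr_moment.
  by under eq_integral do rewrite expr1 -/(phi l _) -normrN -E.
- have /andP[_] := moments1 l (isT : (1 <= 2 <= 3)%N); rewrite /llr_moment.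
  by under eq_integral do rewrite -/(phi l _) -normrN -E real_normK ?num_real//.
move=> [h1 h2 h3 [h4 h5] h6]; exists t; split => //.
- by rewrite -h1; apply: eq_integral => x _; rewrite E.
- by rewrite -h2; apply: eq_integral => x _; rewrite E opprK.
- by rewrite -h3; apply: eq_integral => x _; rewrite E sqrrN.
- by split=> //; rewrite -h5; apply: eq_integral => x _; rewrite E.
Qed.

Let Ex0 l n (psi : R -> R) : (1 <= n)%N -> measurable_fun setT psi ->
  (forall x, 0 <= psi x)%R ->
  Ex Pinf (fun w => psi (Z l w n)) = \int[nu l]_x (psi (phi l x) * f0 l x)%:E.
Proof.
move=> n1 mpsi psi0.
by apply: (integral_has_density (df0 l) (dens0 l n1) (phi := psi \o phi l)) => //;
  [exact: measurableT_comp|move=> x /=].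
Qed.

Let Ex1 g l n (psi : R -> R) : (1 <= g)%N -> (g <= n)%N -> l \in kappa ->
  measurable_fun setT psi -> (forall x, 0 <= psi x)%R ->
  Ex (P (Some g)) (fun w => psi (Z l w n)) = \int[nu l]_x (psi (phi l x) * f1 l x)%:E.
Proof.
move=> g1 gn lk mpsi psi0.
by apply: (integral_has_density (df1 l) (dens1 g1 gn lk) (phi := psi \o phi l)) => //;
  [exact: measurableT_comp|move=> x /=].
Qed.

Let mpos : measurable_fun setT (fun x : R => Num.max x 0%R).
Proof. by apply: measurable_maxr => //; exact: measurable_cst. Qed.

Let mneg : measurable_fun setT (fun x : R => Num.max (- x)%R 0%R).
Proof. by apply: measurable_maxr; [exact: measurable_funN|exact: measurable_cst]. Qed.

Let msq : measurable_fun setT (fun x : R => x ^+ 2)%R.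
Proof. exact: measurable_funX. Qed.

Let max0 (x : R) : (0 <= Num.max x 0)%R.
Proof. by rewrite le_max lexx orbT. Qed.

Lemma FAR_le (h : 'I_L -> \bar R) (alpha : R) : (forall l, 0 <= h l) ->
  (0 < alpha <= 1)%R ->
  FAR Pinf (fun w => dcs_time mu h D (L%:R * ln (L%:R / alpha))%R
    (llr_path f0 f1 X w)) <= alpha%:E.
Proof.
move=> h_ge0 /andP[a0 a1]; have L0 : (0 < L%:R :> R)%R by rewrite ltr0n.
have La : (1 <= L%:R / alpha)%R.
  by rewrite ler_pdivlMr// mul1r (le_trans a1)// ler1n.
have b0 : (0 <= ln (L%:R / alpha))%R by exact: ln_ge0.
have exp1 l n : (1 <= n)%N -> Ex Pinf (fun w => expR (Z l w n)) <= 1.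
  move=> n1; rewrite (Ex0 l n1 (psi := @expR R))//.
  by apply: (integral_exp_llr_le1 (df0 l) (df1 l)); case/andP: (KL01 l).
have := mean_time_false_alarm (ind (isT : is_change_point None)) mphi mu D h_ge0
  L_ge1 exp1 b0.
(* With [b = ln (L / alpha)], the bound [expR b / L] is [1 / alpha]. *)
rewrite lnK ?posrE ?divr_gt0// (_ : L%:R / alpha / L%:R = alpha^-1)%R; last first.
  by field; rewrite !gt_eqF.
rewrite /FAR -[X in _ <= X -> _]/(\int[Pinf]_w dcs_time mu h D (L%:R * ln (L%:R / alpha))%R
    (llr_path f0 f1 X w)).
case: (\int[Pinf]_w _) => [t| |//]; last by move=> _; rewrite invey lee_fin ltW.
rewrite lee_fin => at_; have t0 : (0 < t)%R by apply: lt_le_trans at_; rewrite invr_gt0.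
by rewrite inver gt_eqF// lee_fin -[alpha]invrK lef_pV2// posrE invr_gt0.
Qed.

Let ident l n (B : set R) : (1 <= n)%N -> measurable B ->
  Pinf (X n l @^-1` B) = Pinf (X 1%N l @^-1` B).
Proof. by move=> n1 mB; rewrite (dens0 l n1)// (@dens0 l 1%N). Qed.

Let half0 l : exists2 rho : R, (0 <= rho < 1)%R & forall n, (1 <= n)%N ->
  Ex Pinf (fun w => expR (Z l w n / 2))%R <= rho%:E.
Proof.
have [t [_ _ _ [rho01 E] _]] := moments0' l; exists t.2 => // n n1.
rewrite (Ex0 l n1 (psi := fun x => expR (x / 2)))// ?E//.
apply: measurableT_comp => //; apply: measurable_funM => //; exact: measurable_cst.
Qed.

Lemma PDC_eq (h : 'I_L -> \bar R) l : (forall l, 0 <= h l < +oo) ->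
  PDC Pinf (fun n w => deS (mu l) (h l) (llr_path f0 f1 X w l) n) =
  (\int[Pinf]_w ladder_time (llr_path f0 f1 X w l)) /
  (\int[Pinf]_w ladder_time (llr_path f0 f1 X w l) +
   'E_Pinf[fun w => off_time (mu l) (h l) (llr_path f0 f1 X w l)]).
Proof.
move=> /(_ l)/andP[h0 hoo]; have [rho /andP[rho0 rho1] hrho] := half0 l.
have hr : h l = (fine (h l))%:E by rewrite fineK// ge0_fin_numE.
exact: (PDC_renewal (ind (isT : is_change_point None)) mphi (mu_gt0 l) h0 hr
  (ident l) rho0 rho1 hrho).
Qed.

Lemma PTC_eq (h : 'I_L -> \bar R) l : (forall l, 0 <= h l < +oo) ->
  PTC Pinf (fun n w => deT (mu l) (h l) (D l) (llr_path f0 f1 X w l) n) =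
  (\int[Pinf]_w ladder_count (D l) (llr_path f0 f1 X w l)) /
  (\int[Pinf]_w ladder_time (llr_path f0 f1 X w l) +
   'E_Pinf[fun w => off_time (mu l) (h l) (llr_path f0 f1 X w l)]).
Proof.
move=> /(_ l)/andP[h0 hoo]; have [rho /andP[rho0 rho1] hrho] := half0 l.
have hr : h l = (fine (h l))%:E by rewrite fineK// ge0_fin_numE.
exact: (PTC_renewal (ind (isT : is_change_point None)) mphi (mu_gt0 l) h0 hr
  (D_ge0 l) (ident l) rho0 rho1 hrho).
Qed.

Lemma PDC_le l :
  PDC Pinf (fun n w => deS (mu l) +oo (llr_path f0 f1 X w l) n) <=
  (mu l)%:E / ((mu l)%:E + KL (nu l) (f0 l) (f1 l)).
Proof.
have [[[[p q] s] rho] /= [Ep Eq Es _ EKL]] := moments0' l.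
have pq : (p < q)%R by have /andP[+ _] := KL01 l; rewrite EKL lte_fin subr_gt0.
rewrite EKL -EFinD inver gt_eqF; last by rewrite addr_gt0 ?subr_gt0.
apply: (PDC_untruncated (ind (isT : is_change_point None)) mphi (mu_gt0 l) (s := s) _ _ _ pq) => n n1.
- by rewrite (Ex0 l n1 (psi := fun x => Num.max x 0%R))// Ep.
- by rewrite (Ex0 l n1 (psi := fun x => Num.max (- x)%R 0%R))// Eq.
- by rewrite (Ex0 l n1 msq (@sqr_ge0 R)) Es.
Qed.

(** [kl], [s] and [K] are chosen before [A], so for fixed [c] the numerator is [A] plus a
    constant. *)
Lemma WADD_le (h : 'I_L -> \bar R) : (forall l, 0 <= h l < +oo) ->
  exists (kl s : 'I_L -> R) (K : R -> R),
  [/\ forall l, KL (nu l) (f1 l) (f0 l) = (kl l)%:E,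
      forall l, (0 <= s l)%R
    & forall c A : R, (0 < c)%R -> (0 <= A)%R ->
      (0 < \sum_(l in kappa) kl l - \sum_(l in kappa) s l / c)%R ->
      (0 <= A + K c)%R /\
      WADD P (information X (fun n l w => deS (mu l) (h l) (llr_path f0 f1 X w l) n))
        (fun w => dcs_time mu h D A (llr_path f0 f1 X w)) <=
      ((A + K c) / (\sum_(l in kappa) kl l - \sum_(l in kappa) s l / c))%:E].
Proof.
move=> h01; have [t Ht] := choice moments1'.
pose q l := (t l).1.1.1; pose p l := (t l).1.1.2; pose s l := (t l).1.2.
pose rho l := (t l).2; pose r l := fine (h l).
have h_ge0 l : 0 <= h l by case/andP: (h01 l).
have hr : h = fun l => (r l)%:E.
  by apply/funext => l; rewrite /r fineK// ge0_fin_numE//; case/andP: (h01 l).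
have r_ge0 l : (0 <= r l)%R by rewrite fine_ge0.
have qp l : l \in kappa -> (q l < p l)%R.
  by move=> _; have [_ _ _ _ E] := Ht l; have /andP[+ _] := KL10 l; rewrite E lte_fin subr_gt0.
have rho0 l : (0 <= rho l)%R by have [_ _ _ [/andP[]]] := Ht l.
have rho1 l : l \in kappa -> (rho l < 1)%R by have [_ _ _ [/andP[]]] := Ht l.
have s0 l : (0 <= s l)%R.
  have [_ _ E _ _] := Ht l; rewrite -lee_fin -E; apply: integral_ge0 => x _.
  by rewrite lee_fin mulr_ge0 ?sqr_ge0//; case: (df1 l).
pose K l := (lyap_a (mu l) (r l) (rho l) + lyap_b (mu l) (r l))%R.
exists (fun l => p l - q l)%R, s, (fun c => \sum_(l in kappa) (D l + r l + mu l + c) +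
  \sum_(l in kappa) (p l - q l) * K l)%R; split => // [l|c A c0 A0 I0].
  by have [_ _ _ _] := Ht l.
set I := (\sum_(l in kappa) (p l - q l) - \sum_(l in kappa) s l / c)%R in I0 *.
set B := (A + _)%R.
have K0 l : l \in kappa -> (0 <= K l)%R.
  move=> lk; have := rho1 l lk => rl.
  by apply: addr_ge0; [exact: lyap_a_ge0|exact: lyap_b_ge0].
have B0 : (0 <= B)%R.
  rewrite addr_ge0// addr_ge0//; apply: sumr_ge0 => l lk.
    by rewrite !addr_ge0// ltW.
  by rewrite mulr_ge0 ?K0// subr_ge0 ltW// qp.
split=> //; apply: ge_ereal_sup => _ [g g1 <-].
(* The information is taken at [g.-1 = g0], and the post-change law starts with observation
   [g0.+1]. *)
case: g g1 => // g0 _; have cp : is_change_point (Some g0.+1) by [].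
pose Pg := P (Some g0.+1).
have bound C : past X g0 C ->
    \int[Pg]_(w in C) maxe (dcs_time mu h D A (llr_path f0 f1 X w) - g0.+1%:R%:E) 0
    <= (B / I * fine (Pg C))%:E.
  move=> pC; apply: (@integral_delay_le _ _ _ _ X phi mphi mu D h h_ge0 Pg A g0 C) => // m.
  have half l n : l \in kappa -> (g0 <= n)%N ->
      Ex Pg (fun w => expR (- Z l w n.+1 / 2))%R <= (rho l)%:E.
    move=> lk gn; have [_ _ _ [_ E4] _] := Ht l.
    rewrite (@Ex1 g0.+1 l n.+1 (fun x => expR (- x / 2)))// ?E4//.
    apply: measurableT_comp => //; apply: measurable_funM; last exact: measurable_cst.
    exact: measurable_funN.
  have Epos l n : l \in kappa -> (g0 <= n)%N ->
      Ex Pg (fun w => Num.max (Z l w n.+1) 0%R) = (p l)%:E.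
    move=> lk gn; have [_ E2 _ _ _] := Ht l.
    by rewrite (@Ex1 g0.+1 l n.+1 (fun x => Num.max x 0%R))// E2.
  have Eneg l n : l \in kappa -> (g0 <= n)%N ->
      Ex Pg (fun w => Num.max (- Z l w n.+1)%R 0%R) = (q l)%:E.
    move=> lk gn; have [E1 _ _ _ _] := Ht l.
    by rewrite (@Ex1 g0.+1 l n.+1 (fun x => Num.max (- x)%R 0%R))// E1.
  have Esq l n : l \in kappa -> (g0 <= n)%N ->
      Ex Pg (fun w => Z l w n.+1 ^+ 2)%R = (s l)%:E.
    move=> lk gn; have [_ _ E3 _ _] := Ht l.
    by rewrite (@Ex1 g0.+1 l n.+1 (fun x => x ^+ 2)%R _ _ lk msq (@sqr_ge0 R)) ?E3.
  rewrite mulrAC ler_pdivlMr//.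
  have := sum_alive_le (ind cp) mphi mu_gt0 r_ge0 D_ge0 rho0 rho1 half Epos Eneg Esq
    qp pC A0 m c0.
  by rewrite -hr /B addrA.
have infoP := @information_past _ _ _ _ X phi mphi mu h h_ge0 g0.
rewrite /information in infoP *.
apply: ess_sup_cond_expectation_le.
- by apply: (subset_trans infoP); exact: past_measurable.
- exact: (@measurable_delay _ _ _ _ X phi mphi mu D h h_ge0 A g0.+1).
- by move=> w; rewrite le_max lexx orbT.
- have := bound setT (@measurableT _ (g_sigma_algebraType (gens X g0))).
  by move=> /le_lt_trans; apply; rewrite ltry.
- by rewrite divr_ge0// ltW.
- move=> C GC; have pC := infoP _ GC; apply: le_trans (bound C pC) _.
  by rewrite EFinM fineK// fin_num_measure//; exact: (past_measurable pC).
Qed.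

Lemma WADD_asymptotic (h : 'I_L -> \bar R) : (forall l, 0 <= h l < +oo) ->
  limf_esup (fun A : R =>
    WADD P (information X (fun n l w => deS (mu l) (h l) (llr_path f0 f1 X w l) n))
        (fun w => dcs_time mu h D A (llr_path f0 f1 X w)) /
    (A%:E / \sum_(l in kappa) KL (nu l) (f1 l) (f0 l))) (+oo_ R) <= 1.
Proof.
move=> h01; have [kl [s [K [Ekl s0 HW]]]] := WADD_le h01.
have kl0 l : (0 < kl l)%R by rewrite -lte_fin -Ekl; case/andP: (KL10 l).
rewrite (eq_bigr (fun l => (kl l)%:E)) => [|l _]; last exact: Ekl.
rewrite sumEFin; set S := (\sum_(l in kappa) kl l)%R in HW *.
have S0 : (0 < S)%R.
  have /finset.set0Pn[l lk] := kappa_neq0.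
  by rewrite /S (bigD1 l)//= ltr_pwDl// sumr_ge0// => i _; exact: ltW.
pose Q := (\sum_(l in kappa) s l)%R.
have Q0 : (0 <= Q)%R by apply: sumr_ge0.
apply: limf_esup_le => e e0.
(* Makes [J <= S * e / (2 * (1 + e))], so [(1 + e) * (S - J) >= S * (1 + e / 2)]: half of the slack
   is left. [Q + 1] in place of [Q] keeps [c] positive. *)
pose c := ((Q + 1) * (2 * (1 + e)) / (S * e))%R.
have e1 : (0 < 1 + e)%R by rewrite addr_gt0.
have c0 : (0 < c)%R by rewrite divr_gt0 ?mulr_gt0// ltr_wpDl.
have Qc : (\sum_(l in kappa) s l / c <= S * e / (2 * (1 + e)))%R.
  rewrite -big_distrl /= -/Q ler_pdivrMr// /c.
  have -> : (S * e / (2 * (1 + e)) * ((Q + 1) * (2 * (1 + e)) / (S * e)) = Q + 1)%R.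
    by field; rewrite !gt_eqF.
  by rewrite lerDl.
set J := (\sum_(l in kappa) s l / c)%R in Qc HW.
have SJ : (S * (2 + e) / (2 * (1 + e)) <= S - J)%R.
  have -> : (S * (2 + e) / (2 * (1 + e)) = S - S * e / (2 * (1 + e)))%R.
    by field; rewrite gt_eqF.
  by rewrite lerD2l lerN2.
have SJ0 : (0 < S - J)%R by apply: lt_le_trans SJ; rewrite divr_gt0 ?mulr_gt0// addr_gt0.
(* The other half of the slack: beyond [2 * K c / e] the constant [K c] is at most [A * e / 2]. The
   1 keeps [A] positive. *)
exists (Num.max 1 (2 * K c / e))%R; split; first exact: num_real.
move=> A; rewrite gt_max => /andP[A1 AK] /=.
have A0 : (0 < A)%R by exact: lt_trans ltr01 A1.
have [B0 W] := HW c A c0 (ltW A0) SJ0.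
have AS0 : (0 < A / S)%R by rewrite divr_gt0.
rewrite (inver S) gt_eqF// -EFinM (inver (A / S)) gt_eqF//.
apply: (@le_trans _ _ (((A + K c) / (S - J))%:E * (A / S)^-1%:E)).
  by apply: lee_wpmul2r W; rewrite lee_fin invr_ge0 ltW.
rewrite -EFinM -EFinD lee_fin ler_pdivrMr// ler_pdivrMr//.
apply: (@le_trans _ _ ((1 + e) * (A / S) * (S * (2 + e) / (2 * (1 + e))))%R); last first.
  by apply: ler_wpM2l => //; rewrite mulr_ge0// ltW.
have -> : ((1 + e) * (A / S) * (S * (2 + e) / (2 * (1 + e))) = A * (2 + e) / 2)%R.
  by field; rewrite !gt_eqF.
move: AK; rewrite ltr_pdivrMr// => AK.
by rewrite ler_pdivlMr//; lra.
Qed.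

End Model.

Theorem theoremV2 (R : realType) (L : nat) (L_ge1 : (1 <= L)%N)
    (nu : 'I_L -> {sigma_finite_measure set (measurableTypeR R) -> \bar R})
    (f0 f1 : 'I_L -> R -> R) (kappa : {set 'I_L})
    (kappa_neq0 : kappa != finset.set0)
    (d : measure_display) (Omega : measurableType d)
    (P : option nat -> probability Omega R)
    (X : nat -> 'I_L -> {mfun Omega >-> R})
    (model : change_point_model nu f0 f1 kappa P X)
    (KL10 : forall l, 0 < KL (nu l) (f1 l) (f0 l) < +oo)
    (KL01 : forall l, 0 < KL (nu l) (f0 l) (f1 l) < +oo)
    (moments0 : forall l k, (1 <= k <= 3)%N ->
       0 < llr_moment (nu l) k (f1 l) (f0 l) (f0 l) < +oo)
    (moments1 : forall l k, (1 <= k <= 3)%N ->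
       0 < llr_moment (nu l) k (f1 l) (f0 l) (f1 l) < +oo)
    (mu : 'I_L -> R) (mu_gt0 : forall l, (0 < mu l)%R)
    (D : 'I_L -> R) (D_ge0 : forall l, (0 <= D l)%R) :
  let Pinf := P None in
  let Z := llr_path f0 f1 X in
  let S h := fun n l w => deS (mu l) (h l) (Z w l) n in
  let T h := fun n l w => deT (mu l) (h l) (D l) (Z w l) n in
  let tau h A := fun w => dcs_time mu h D A (Z w) in
  (forall h : 'I_L -> \bar R, (forall l, 0 <= h l < +oo) ->
    [/\ forall alpha : R, (0 < alpha <= 1)%R ->
          FAR Pinf (tau h (L%:R * ln (L%:R / alpha))%R) <= alpha%:E,
        forall l, PDC Pinf (fun n => S h n l) =
          (\int[Pinf]_w ladder_time (Z w l)) /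
          (\int[Pinf]_w ladder_time (Z w l) +
           'E_Pinf[fun w => off_time (mu l) (h l) (Z w l)]),
        forall l, PTC Pinf (fun n => T h n l) =
          (\int[Pinf]_w ladder_count (D l) (Z w l)) /
          (\int[Pinf]_w ladder_time (Z w l) +
           'E_Pinf[fun w => off_time (mu l) (h l) (Z w l)])
      & limf_esup (fun A : R =>
          WADD P (information X (S h)) (tau h A) /
          (A%:E / \sum_(l in kappa) KL (nu l) (f1 l) (f0 l))) (+oo_ R) <= 1])
  /\
  (forall h : 'I_L -> \bar R, (forall l, h l = +oo) ->
    forall l, PDC Pinf (fun n => S h n l) <=
      (mu l)%:E / ((mu l)%:E + KL (nu l) (f0 l) (f1 l))).
Proof.
move=> Pinf Z S T tau; split=> [h h01|h hoo l].
  have h_ge0 l : 0 <= h l by case/andP: (h01 l).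
  split=> [alpha alpha01|l|l|].
  - exact: (FAR_le L_ge1 model KL01 mu D h_ge0 alpha01).
  - exact: (PDC_eq model KL01 moments0 mu_gt0 l h01).
  - exact: (PTC_eq model KL01 moments0 mu_gt0 D_ge0 l h01).
  - exact: (WADD_asymptotic kappa_neq0 model KL10 moments1 mu_gt0 D_ge0 h01).
rewrite /S hoo.
exact: (PDC_le model KL01 moments0 mu_gt0 l).
Qed.
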